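(* Let $J=JP(2)$. The category $J\text{-mod}_1$ of finite-dimensional unital $J$-bimodules has infinitely many blocks, these blocks are pairwise equivalent, and each block is equivalent to the category of nilpotent representations of the quiver with two vertices $1,2$, a loop $\alpha$ at $1$, an arrow $\beta:1\to 2$, and a loop $\gamma$ at $2$, with the relation $\beta\alpha=\gamma\beta$.
   Context: All spaces are over $\mathbb C$. $JP(2)$ is the Jordan superalgebra of block matrices $\begin{bmatrix}A&B\\ C&A^T\end{bmatrix}$ with $A,B,C\in M_2(\mathbb C)$, $B^T=B$, $C^T=-C$ (even part: $B=C=0$; odd part: $A=0$) with product $a\cdot b=\frac12(ab+(-1)^{|a||b|}ba)$. A $J$-bimodule is a superspace $M$ with a linear (parity-preserving) map $J\otimes M\to M$ such that $J\oplus M$, with the product of $J$ extended by $a\cdot v=(-1)^{|a||v|}v\cdot a$ and $M\cdot M=0$, is a Jordan superalgebra. A bimodule is unital if the identity of $J$ acts as the identity operator. Morphisms are parity-preserving. A block is an indecomposable direct summand of the abelian category. A nilpotent representation of a quiver is a finite-dimensional representation on which all sufficiently long paths act by zero; $\beta\alpha$ means ''first $\alpha$, then $\beta$''. *)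

(* Defs.v *)
From HB Require Import structures.
From mathcomp Require Import all_boot all_order all_algebra.
From mathcomp Require Import ring.
From mathcomp Require Import boolp.

Set Implicit Arguments.
Unset Strict Implicit.
Unset Printing Implicit Defensive.

Import GRing.Theory.
Local Open Scope ring_scope.

Record superspace (K : fieldType) := Superspace {
  carrier :> vectType K;
  part : bool -> {vspace carrier};
  part_cap : (part false :&: part true)%VS = 0%VS;
  part_add : (part false + part true)%VS = fullv }.

Arguments part {K} s b.

Section Superspace.
Context (K : fieldType) (V : superspace K).

(* Homogeneous component of parity b (false is even, true is odd) *)
Definition hcomp (b : bool) : 'End(V) := daddv_pi (part V b) (part V (~~ b)).

Lemma hcompP b v : hcomp b v \in part V b.
Proof. exact: memv_pi. Qed.

Lemma part_capb b : (part V b :&: part V (~~ b))%VS = 0%VS.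
Proof. by case: b; rewrite /= ?part_cap // capvC part_cap. Qed.

Lemma hcomp_id b v : v \in part V b -> hcomp b v = v.
Proof. by move=> vb; apply: daddv_pi_id => //; exact: part_capb. Qed.

Lemma hcompD v : hcomp false v + hcomp true v = v.
Proof.
by apply: daddv_pi_add; [exact: part_cap | rewrite /= part_add memvf].
Qed.

End Superspace.

Section JordanSuperalgebra.
Context (K : fieldType).

(* Exponents of -1 are natural numbers: parities are coerced from bool. *)
Definition is_jordan_superalgebra (V : superspace K) (mul : V -> V -> V) : Prop :=
  [/\ (forall x, linear (mul x)) /\ (forall y, linear (mul^~ y)),
      forall a b x y, x \in part V a -> y \in part V b ->
        mul x y \in part V (a (+) b),
      forall a b x y, x \in part V a -> y \in part V b ->
        mul x y = (-1) ^+ (a * b) *: mul y x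
    & forall a b c d x y z t,
        x \in part V a -> y \in part V b -> z \in part V c -> t \in part V d ->
        mul (mul (mul x y) z) t
        + (-1) ^+ (b * c + b * d + c * d) *: mul (mul (mul x t) z) y
        + (-1) ^+ (a * b + a * c + a * d + c * d) *: mul (mul (mul y t) z) x
        = mul (mul x y) (mul z t)
          + (-1) ^+ (b * c) *: mul (mul x z) (mul y t)
          + (-1) ^+ (b * d + c * d) *: mul (mul x t) (mul y z)].

Record jordan_superalgebra := JordanSuperalgebra {
  jspace :> superspace K;
  jmul : jspace -> jspace -> jspace;
  jmulP : is_jordan_superalgebra jmul }.

Definition is_identity (J : jordan_superalgebra) (e : J) : Prop :=
  forall x : J, jmul e x = x /\ jmul x e = x.

End JordanSuperalgebra.

Ltac gen_entries :=
  repeat match goal with |- context [@fun_of_matrix ?T ?m ?n ?A ?i ?j] =>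
    move: (@fun_of_matrix T m n A i j) => ? end.

Section JordanIdentityMatrix.
Context (K : fieldType) (m : nat).
Implicit Types (X Y Z T : 'M[K]_m) (k s r q : K).

Lemma addmx_entry (p : nat) (A B : 'M[K]_(m, p)) i j : (A + B) i j = A i j + B i j.
Proof. by rewrite mxE. Qed.

Lemma oppmx_entry (p : nat) (A : 'M[K]_(m, p)) i j : (- A) i j = - A i j.
Proof. by rewrite mxE. Qed.

Lemma scalemx_entry (p : nat) a (A : 'M[K]_(m, p)) i j : (a *: A) i j = a * A i j.
Proof. by rewrite mxE. Qed.

Definition mx_entryE := (addmx_entry, oppmx_entry, scalemx_entry).

Lemma comb3_entry s r (A B C : 'M[K]_m) i j :
  (A + s *: B + r *: C) i j = A i j + s * B i j + r * C i j.
Proof. by rewrite !mxE. Qed.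

Lemma expand3 k s r q X Y Z T i j :
  let XY := k *: (X *m Y + s *: (Y *m X)) in
  let XYZ := k *: (XY *m Z + r *: (Z *m XY)) in
  (k *: (XYZ *m T + q *: (T *m XYZ))) i j
  = k ^+ 3 * ((X *m Y *m Z *m T) i j + s * (Y *m X *m Z *m T) i j
      + r * (Z *m X *m Y *m T) i j + r * s * (Z *m Y *m X *m T) i j
      + q * (T *m X *m Y *m Z) i j + q * s * (T *m Y *m X *m Z) i j
      + q * r * (T *m Z *m X *m Y) i j + q * r * s * (T *m Z *m Y *m X) i j).
Proof.
rewrite /= !(mulmxDl, mulmxDr, =^~ scalemxAl, =^~ scalemxAr) !mulmxA.
by rewrite !mx_entryE; gen_entries; ring.
Qed.

Lemma expand2 k s r q X Y Z T i j :
  let XY := k *: (X *m Y + s *: (Y *m X)) in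
  let ZT := k *: (Z *m T + r *: (T *m Z)) in
  (k *: (XY *m ZT + q *: (ZT *m XY))) i j
  = k ^+ 3 * ((X *m Y *m Z *m T) i j + s * (Y *m X *m Z *m T) i j
      + r * (X *m Y *m T *m Z) i j + r * s * (Y *m X *m T *m Z) i j
      + q * (Z *m T *m X *m Y) i j + q * s * (Z *m T *m Y *m X) i j
      + q * r * (T *m Z *m X *m Y) i j + q * r * s * (T *m Z *m Y *m X) i j).
Proof.
rewrite /= !(mulmxDl, mulmxDr, =^~ scalemxAl, =^~ scalemxAr) !mulmxA.
by rewrite !mx_entryE; gen_entries; ring.
Qed.

End JordanIdentityMatrix.

Lemma jordan_identity_of_mul (K : fieldType) (m : nat) (V : superspace K)
    (vs : {linear V -> 'M[K]_m}) (mul : V -> V -> V) (k : K) :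
  injective vs ->
  (forall a b x y, x \in part V a -> y \in part V b ->
     vs (mul x y) = k *: (vs x *m vs y + (-1) ^+ (a * b) *: (vs y *m vs x))) ->
  (forall a b x y, x \in part V a -> y \in part V b ->
     mul x y \in part V (a (+) b)) ->
  forall a b c d x y z t,
    x \in part V a -> y \in part V b -> z \in part V c -> t \in part V d ->
    mul (mul (mul x y) z) t
    + (-1) ^+ (b * c + b * d + c * d) *: mul (mul (mul x t) z) y
    + (-1) ^+ (a * b + a * c + a * d + c * d) *: mul (mul (mul y t) z) x
    = mul (mul x y) (mul z t)
      + (-1) ^+ (b * c) *: mul (mul x z) (mul y t)
      + (-1) ^+ (b * d + c * d) *: mul (mul x t) (mul y z).
Proof.
move=> vI homE grd a b c d x y z t hx hy hz ht.
have [[hxy hxz] hxt] := (grd _ _ _ _ hx hy, grd _ _ _ _ hx hz, grd _ _ _ _ hx ht).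
have [[hyz hyt] hzt] := (grd _ _ _ _ hy hz, grd _ _ _ _ hy ht, grd _ _ _ _ hz ht).
apply: vI; rewrite !(linearD, linearZ) /=.
rewrite (homE _ _ _ _ (grd _ _ _ _ hxy hz) ht) (homE _ _ _ _ hxy hz).
rewrite (homE _ _ _ _ (grd _ _ _ _ hxt hz) hy) (homE _ _ _ _ hxt hz).
rewrite (homE _ _ _ _ (grd _ _ _ _ hyt hz) hx) (homE _ _ _ _ hyt hz).
rewrite (homE _ _ _ _ hxy hzt) (homE _ _ _ _ hxz hyt) (homE _ _ _ _ hxt hyz).
rewrite (homE _ _ _ _ hx hy) (homE _ _ _ _ hx hz) (homE _ _ _ _ hx ht).
rewrite (homE _ _ _ _ hy hz) (homE _ _ _ _ hy ht) (homE _ _ _ _ hz ht).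
move: (vs x) (vs y) (vs z) (vs t) => X Y Z T.
apply/matrixP => i j.
rewrite [LHS]comb3_entry [RHS]comb3_entry.
rewrite [X in X + _ + _ = _]expand3 [X in _ + _ * X + _ = _]expand3.
rewrite [X in _ + _ * X = _]expand3.
rewrite [X in _ = X + _ + _]expand2 [X in _ = _ + _ * X + _]expand2.
rewrite [X in _ = _ + _ * X]expand2; gen_entries.
clear.
by case: a => [];  case: b => []; case: c => []; case: d => []; rewrite /=; ring.
Qed.

Section JP.
Context (K : fieldType) (n : nat).
Implicit Types X Y : 'M[K]_(n + n).

(* Vanishes exactly on the block matrices [A B; C A^T], B^T = B, C^T = -C. *)
Definition JP_defect X : 'M[K]_n * 'M[K]_n * 'M[K]_n :=
  (drsubmx X - (ulsubmx X)^T,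
   (ursubmx X)^T - ursubmx X,
   (dlsubmx X)^T + dlsubmx X).

Lemma JP_defect_linear : linear JP_defect.
Proof.
move=> a X Y; apply/eqP; rewrite !xpair_eqE.
by apply/andP; split; [apply/andP; split|];
  apply/eqP/matrixP => i j; rewrite !mxE; ring.
Qed.

HB.instance Definition _ :=
  GRing.isLinear.Build K 'M[K]_(n + n) _ _ JP_defect JP_defect_linear.

Definition JP_space : {vspace 'M[K]_(n + n)} := lker (linfun JP_defect).

Lemma mem_JP_space X :
  (X \in JP_space) = [&& drsubmx X == (ulsubmx X)^T,
    (ursubmx X)^T == ursubmx X & (dlsubmx X)^T == - dlsubmx X].
Proof.
by rewrite memv_ker lfunE /= !xpair_eqE !subr_eq0 addr_eq0 andbA.
Qed.

Definition JP_type : vectType K := subvs_of JP_space.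

Definition mx_part (b : bool) X : 'M[K]_(n + n) :=
  if b then block_mx 0 (ursubmx X) (dlsubmx X) 0
  else block_mx (ulsubmx X) 0 0 (drsubmx X).

Arguments mx_part : simpl never.

Lemma mx_part_linear b : linear (mx_part b).
Proof.
move=> a X Y; rewrite /mx_part.
by case: b; rewrite scale_block_mx add_block_mx; congr block_mx;
  apply/matrixP => i j; rewrite !mxE; ring.
Qed.

HB.instance Definition _ b :=
  GRing.isLinear.Build K 'M[K]_(n + n) 'M[K]_(n + n) _ (mx_part b)
    (mx_part_linear b).

Definition JP_part (b : bool) : {vspace JP_type} :=
  lker (linfun (mx_part (~~ b) \o vsval)).

Lemma mem_JP_part b (x : JP_type) :
  (x \in JP_part b) = (mx_part (~~ b) (vsval x) == 0).
Proof. by rewrite memv_ker lfunE. Qed.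

Lemma mx_partD X : mx_part false X + mx_part true X = X.
Proof. by rewrite /mx_part add_block_mx !add0r !addr0 submxK. Qed.

Lemma mx_part_id b c X : mx_part b (mx_part c X) = if b == c then mx_part b X else 0.
Proof.
by case: b c => [] [] /=; rewrite /mx_part ?(block_mxKul, block_mxKur, block_mxKdl, block_mxKdr) ?block_mx0.
Qed.

Lemma mx_part_JP b X : X \in JP_space -> mx_part b X \in JP_space.
Proof.
rewrite !mem_JP_space => /and3P[/eqP h1 /eqP h2 /eqP h3]; case: b => /=;
by rewrite block_mxKul block_mxKur block_mxKdl block_mxKdr ?trmx0 ?oppr0 ?h1 ?h2 ?h3 !eqxx.
Qed.

Lemma JP_part_cap : (JP_part false :&: JP_part true)%VS = 0%VS.
Proof.
apply/vspaceP => x; rewrite memv_cap !mem_JP_part memv0.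
apply/andP/eqP => [[/eqP /= h1 /eqP /= h0]|->].
  by apply: val_inj; rewrite -[LHS]mx_partD h0 h1 addr0.
by rewrite !linear0 !eqxx.
Qed.

Lemma JP_part_add : (JP_part false + JP_part true)%VS = fullv.
Proof.
apply/vspaceP => x; rewrite memvf; apply/memv_addP.
pose y b : JP_type := vsproj JP_space (mx_part b (vsval x)).
have yE b : vsval (y b) = mx_part b (vsval x).
  by rewrite vsprojK // mx_part_JP // subvsP.
exists (y false); first by rewrite mem_JP_part yE mx_part_id.
exists (y true); first by rewrite mem_JP_part yE mx_part_id.
by apply: val_inj; rewrite linearD /= !yE mx_partD.
Qed.

Definition JP_superspace : superspace K := Superspace JP_part_cap JP_part_add.

(* (xy + (-1)^{|x||y|} yx) / 2, extended bilinearly from homogeneous matrices *)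
Definition mx_jmul X Y : 'M[K]_(n + n) :=
  2^-1 *: \sum_(a : bool) \sum_(b : bool)
    (mx_part a X *m mx_part b Y
     + (-1) ^+ (a * b) *: (mx_part b Y *m mx_part a X)).

Lemma mx_jmulE X Y : mx_jmul X Y =
  let A := ulsubmx X in let B := ursubmx X in
  let C := dlsubmx X in let D := drsubmx X in
  let A' := ulsubmx Y in let B' := ursubmx Y in
  let C' := dlsubmx Y in let D' := drsubmx Y in
  2^-1 *: block_mx (A *m A' + A' *m A + (B *m C' - B' *m C))
                   (A *m B' + B' *m D + (B *m D' + A' *m B))
                   (C *m A' + D' *m C + (D *m C' + C' *m A))
                   (D *m D' + D' *m D + (C *m B' - C' *m B)).
Proof.
rewrite /mx_jmul /= !big_bool /= /mx_part; congr (_ *: _).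
rewrite !mulmx_block !expr0 !expr1 !scale1r !scale_block_mx !scaleN1r.
rewrite !add_block_mx !(mulmx0, mul0mx, addr0, add0r, oppr0).
by congr block_mx; rewrite addrC // [in LHS](addrC (C *m _)).
Qed.

Lemma mx_jmul_JP X Y :
  X \in JP_space -> Y \in JP_space -> mx_jmul X Y \in JP_space.
Proof.
move=> hX hY; rewrite mx_jmulE /=; apply: memvZ; move: hX hY.
rewrite !mem_JP_space !(block_mxKul, block_mxKur, block_mxKdl, block_mxKdr).
move=> /and3P[/eqP-> /eqP h2 /eqP h3] /and3P[/eqP-> /eqP k2 /eqP k3].
have trD (A B : 'M[K]_n) : (A + B)^T = A^T + B^T by rewrite linearD.
have trN (A : 'M[K]_n) : (- A)^T = - A^T by rewrite linearN.
rewrite !(trD, trN) !trmx_mul !trmxK h2 h3 k2 k3.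
rewrite !(mulmxN, mulNmx, opprD, opprK).
by apply/and3P; split; apply/eqP/matrixP => i j; rewrite !mx_entryE; ring.
Qed.

(* The projection vsproj is the identity here, by mx_jmul_JP. *)
Definition JP_mul (x y : JP_superspace) : JP_superspace :=
  vsproj JP_space (mx_jmul (vsval x) (vsval y)).

Lemma JP_mulE (x y : JP_superspace) :
  vsval (JP_mul x y) = mx_jmul (vsval x) (vsval y).
Proof. by rewrite vsprojK // mx_jmul_JP // subvsP. Qed.

Lemma mx_jmul_linearl Y : linear (mx_jmul^~ Y).
Proof.
move=> a X X'; rewrite /mx_jmul !big_bool /= !linearP /=.
move: (mx_part true X) (mx_part false X) (mx_part true X') (mx_part false X').
move: (mx_part true Y) (mx_part false Y) => Y1 Y0 X1 X0 X1' X0'.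
rewrite !(mulmxDl, mulmxDr, =^~ scalemxAl, =^~ scalemxAr).
by apply/matrixP => i j; rewrite !mx_entryE; gen_entries; ring.
Qed.

Lemma mx_jmul_linearr X : linear (mx_jmul X).
Proof.
move=> a Y Y'; rewrite /mx_jmul !big_bool /= !linearP /=.
move: (mx_part true Y) (mx_part false Y) (mx_part true Y') (mx_part false Y').
move: (mx_part true X) (mx_part false X) => X1 X0 Y1 Y0 Y1' Y0'.
rewrite !(mulmxDl, mulmxDr, =^~ scalemxAl, =^~ scalemxAr).
by apply/matrixP => i j; rewrite !mx_entryE; gen_entries; ring.
Qed.

Lemma mx_jmulC_hom a b X Y : mx_part (~~ a) X = 0 -> mx_part (~~ b) Y = 0 ->
  mx_jmul X Y = 2^-1 *: (X *m Y + (-1) ^+ (a * b) *: (Y *m X)).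
Proof.
move=> hX hY; have XE : mx_part a X = X.
  by rewrite -[RHS]mx_partD; case: a hX => /= ->; rewrite ?addr0 ?add0r.
have YE : mx_part b Y = Y.
  by rewrite -[RHS]mx_partD; case: b hY => /= ->; rewrite ?addr0 ?add0r.
rewrite /mx_jmul (bigD1 a) //= (bigD1 b) //= XE YE.
rewrite [X in _ + X]big1 => [|c ca]; last first.
  have -> : c = ~~ a by case: a c ca {hX XE} => [] [].
  by apply: big1 => d _; rewrite hX !(mul0mx, mulmx0, scaler0, addr0).
rewrite [X in _ + X + _]big1 ?addr0 // => d db.
have -> : d = ~~ b by case: b d db {hY YE} => [] [].
by rewrite hY !(mul0mx, mulmx0, scaler0, addr0).
Qed.

Lemma mx_part_hom b X : mx_part (~~ b) X = 0 -> mx_part b X = X.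
Proof.
by move=> hX; rewrite -[RHS]mx_partD; case: b hX => /= ->; rewrite ?addr0 ?add0r.
Qed.

Lemma mx_part_mul a b X Y : mx_part (~~ a) X = 0 -> mx_part (~~ b) Y = 0 ->
  mx_part (~~ (a (+) b)) (X *m Y) = 0.
Proof.
move=> /mx_part_hom <- /mx_part_hom <-; rewrite /mx_part.
case: a b => [] [] /=; rewrite mulmx_block !(mul0mx, mulmx0, addr0, add0r);
by rewrite ?(block_mxKul, block_mxKur, block_mxKdl, block_mxKdr) block_mx0.
Qed.

Lemma JP_jordan : is_jordan_superalgebra JP_mul.
Proof.
have homE a b (x y : JP_superspace) : x \in part _ a -> y \in part _ b ->
  vsval (JP_mul x y) = 2^-1 *: (vsval x *m vsval y
     + (-1) ^+ (a * b) *: (vsval y *m vsval x)).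
  rewrite !mem_JP_part JP_mulE => /eqP hx /eqP hy; exact: mx_jmulC_hom.
have grd a b (x y : JP_superspace) : x \in part _ a -> y \in part _ b ->
  JP_mul x y \in part JP_superspace (a (+) b).
  move=> hx hy; rewrite mem_JP_part (homE _ _ _ _ hx hy).
  move: hx hy; rewrite !mem_JP_part => /eqP hx /eqP hy.
  by rewrite linearZ linearD linearZ /= mx_part_mul // addbC mx_part_mul //
    scaler0 addr0 scaler0.
have com a b (x y : JP_superspace) : x \in part _ a -> y \in part _ b ->
  JP_mul x y = (-1) ^+ (a * b) *: JP_mul y x.
  move=> hx hy; apply: val_inj; rewrite linearZ /=.
  rewrite (homE _ _ _ _ hx hy) (homE _ _ _ _ hy hx).
  by case: a b {hx hy} => [] [];
    apply/matrixP => i j; rewrite !mx_entryE /=; ring.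
split; [|exact: grd|exact: com|].
  split=> [x|y] a u v; apply: val_inj; rewrite linearP /= !JP_mulE linearP.
    exact: mx_jmul_linearr.
  exact: mx_jmul_linearl.
move=> a b c d x y z t hx hy hz ht.
have vI : injective (fun x : JP_superspace => vsval x) by exact: val_inj.
exact: (@jordan_identity_of_mul K (n + n) JP_superspace vsval JP_mul 2^-1 vI
  homE grd a b c d x y z t hx hy hz ht).
Qed.

Definition JP : jordan_superalgebra K := JordanSuperalgebra JP_jordan.

End JP.

Section DirectSum.
Context (K : fieldType) (V W : superspace K).

Definition dsum_part (b : bool) : {vspace (V * W)%type} :=
  (linfun fst @^-1: part V b :&: linfun snd @^-1: part W b)%VS.

Lemma mem_dsum_part b u :
  (u \in dsum_part b) = (u.1 \in part V b) && (u.2 \in part W b).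
Proof. by rewrite memv_cap -!memv_preim !lfunE. Qed.

Lemma dsum_cap : (dsum_part false :&: dsum_part true)%VS = 0%VS.
Proof.
apply/vspaceP => -[x y]; rewrite memv_cap !mem_dsum_part memv0 /= andbACA.
by rewrite -!memv_cap !part_cap !memv0.
Qed.

Lemma dsum_add : (dsum_part false + dsum_part true)%VS = fullv.
Proof.
apply/vspaceP => -[x y]; rewrite memvf; apply/memv_addP.
exists (hcomp V false x, hcomp W false y).
  by rewrite mem_dsum_part !hcompP.
exists (hcomp V true x, hcomp W true y).
  by rewrite mem_dsum_part !hcompP.
by congr (_, _); rewrite hcompD.
Qed.

Definition dsum : superspace K := Superspace dsum_cap dsum_add.

End DirectSum.

Section Bimodule.
Context (K : fieldType) (J : jordan_superalgebra K).

(* v . a = (-1)^{|a||v|} a . v on homogeneous elements *)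
Definition right_act (M : superspace K) (act : J -> M -> M) (v : M) (a : J) : M :=
  \sum_(i : bool) \sum_(j : bool)
    (-1) ^+ (i * j) *: act (hcomp J i a) (hcomp M j v).

Definition null_ext_mul (M : superspace K) (act : J -> M -> M)
    (u w : dsum J M) : dsum J M :=
  (jmul u.1 w.1, act u.1 w.2 + right_act act u.2 w.1).

Record bimodule := Bimodule {
  bspace :> superspace K;
  bact : J -> bspace -> bspace;
  bact_linear : (forall a, linear (bact a)) /\ (forall v, linear (bact^~ v));
  bact_part : forall i j a v, a \in part J i -> v \in part bspace j ->
    bact a v \in part bspace (i (+) j);
  bact_jordan : is_jordan_superalgebra (null_ext_mul bact) }.

Definition unital (M : bimodule) : Prop :=
  exists2 e : J, is_identity e & forall v : M, bact e v = v.

Definition is_bimodule_hom (M N : bimodule) (f : 'Hom(M, N)) : Prop :=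
  (forall b v, v \in part M b -> f v \in part N b) /\
  (forall a v, f (bact a v) = bact a (f v)).

Definition bimodule_hom_pred (M N : bimodule) : {pred 'Hom(M, N)} :=
  fun f => `[< is_bimodule_hom f >].

Lemma bimodule_hom_closed M N : submod_closed (@bimodule_hom_pred M N).
Proof.
split=> [|k f g /asboolP[fp fa] /asboolP[gp ga]]; apply/asboolP; split.
- by move=> b v _; rewrite lfunE mem0v.
- move=> a v; rewrite !lfunE /=; have := (bact_linear N).1 a (-1) 0 0.
  by rewrite scaler0 addr0 scaleN1r addNr.
- by move=> b v vb; rewrite lfunE /= lfunE /= memvD ?memvZ ?fp ?gp.
- by move=> a v; rewrite !lfunE /= !lfunE /= fa ga (bact_linear N).1.
Qed.

HB.instance Definition _ M N :=
  GRing.isSubmodClosed.Build K 'Hom(bspace M, bspace N) (@bimodule_hom_pred M N)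
    (@bimodule_hom_closed M N).

Record bimodule_hom (M N : bimodule) := BimoduleHom {
  bhom_fun :> 'Hom(M, N);
  bhom_funP : bhom_fun \in @bimodule_hom_pred M N }.

HB.instance Definition _ M N := [isSub for @bhom_fun M N].
HB.instance Definition _ M N := [Choice of bimodule_hom M N by <:].
HB.instance Definition _ M N :=
  [SubChoice_isSubLmodule of bimodule_hom M N by <:].

End Bimodule.

Section LinearCategory.
Context (K : fieldType).

(* compc g f is first f, then g. *)
Record lincat := Lincat {
  obj :> Type;
  hom : obj -> obj -> lmodType K;
  idc : forall X, hom X X;
  compc : forall X Y Z, hom Y Z -> hom X Y -> hom X Z;
  comp_id_left : forall X Y (f : hom X Y), compc (idc Y) f = f;
  comp_id_right : forall X Y (f : hom X Y), compc f (idc X) = f;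
  compA : forall X Y Z T (h : hom Z T) (g : hom Y Z) (f : hom X Y),
    compc h (compc g f) = compc (compc h g) f;
  comp_linear_left : forall X Y Z (f : hom X Y),
    linear (fun g : hom Y Z => compc g f);
  comp_linear_right : forall X Y Z (g : hom Y Z),
    linear (fun f : hom X Y => compc g f) }.

Arguments hom {l} X Y.
Arguments idc {l} X.
Arguments compc {l X Y Z} g f.

Definition is_iso (C : lincat) (X Y : C) (f : hom X Y) : Prop :=
  exists g : hom Y X, compc g f = idc X /\ compc f g = idc Y.

Definition isomorphic (C : lincat) (X Y : C) : Prop :=
  exists f : hom X Y, is_iso f.

Definition zero_object (C : lincat) (X : C) : Prop := idc X = 0.

Definition is_biproduct (C : lincat) (Z X Y : C) : Prop :=
  exists (i : hom X Z) (j : hom Y Z) (p : hom Z X) (q : hom Z Y),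
    [/\ compc p i = idc X, compc q j = idc Y, compc p j = 0, compc q i = 0
      & compc i p + compc j q = idc Z].

Definition fullsub (C : lincat) (P : C -> Prop) : lincat :=
  @Lincat {X : C | P X} (fun X Y => hom (sval X) (sval Y))
    (fun X => idc (sval X)) (fun X Y Z g f => compc g f)
    (fun X Y => @comp_id_left C (sval X) (sval Y))
    (fun X Y => @comp_id_right C (sval X) (sval Y))
    (fun X Y Z T => @compA C (sval X) (sval Y) (sval Z) (sval T))
    (fun X Y Z => @comp_linear_left C (sval X) (sval Y) (sval Z))
    (fun X Y Z => @comp_linear_right C (sval X) (sval Y) (sval Z)).

(* Functors, hence equivalences, are K-linear. *)
Record linfunctor (C D : lincat) := Linfunctor {
  fobj :> C -> D;
  fmap : forall X Y : C, hom X Y -> hom (fobj X) (fobj Y);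
  fmap_linear : forall X Y : C, linear (@fmap X Y);
  fmap_id : forall X : C, fmap (idc X) = idc (fobj X);
  fmap_comp : forall (X Y Z : C) (g : hom Y Z) (f : hom X Y),
    fmap (compc g f) = compc (fmap g) (fmap f) }.

Arguments fmap {C D} l {X Y} f.

(* G F is naturally isomorphic to the identity of C. *)
Definition is_left_quasi_inverse (C D : lincat)
    (F : linfunctor C D) (G : linfunctor D C) : Prop :=
  exists eta : forall X : C, hom X (G (F X)),
    (forall X, is_iso (eta X)) /\
    (forall (X Y : C) (f : hom X Y),
       compc (eta Y) f = compc (fmap G (fmap F f)) (eta X)).

Definition equivalent (C D : lincat) : Prop :=
  exists (F : linfunctor C D) (G : linfunctor D C),
    is_left_quasi_inverse F G /\ is_left_quasi_inverse G F.

(* Full subcategories are given by predicates C -> Prop on objects. Writing them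
   as classical sets would make bimodule categories universe inconsistent. *)
Definition is_direct_sum (C : lincat) (P Q : C -> Prop) : Prop :=
  [/\ forall X Y, isomorphic X Y -> P X -> P Y,
      forall X Y, isomorphic X Y -> Q X -> Q Y,
      forall X Y, P X -> Q Y ->
        (forall f : hom X Y, f = 0) /\ (forall g : hom Y X, g = 0)
    & forall Z, exists X Y, [/\ P X, Q Y & is_biproduct Z X Y]].

Definition indecomposable (C : lincat) : Prop :=
  (exists X : C, ~ zero_object X) /\
  forall P Q : C -> Prop, is_direct_sum P Q ->
    (forall X, P X -> zero_object X) \/ (forall X, Q X -> zero_object X).

Definition block (C : lincat) (B : C -> Prop) : Prop :=
  (exists Q : C -> Prop, is_direct_sum B Q) /\ indecomposable (fullsub B).

Definition finitely_many (T : Type) (P : T -> Prop) : Prop :=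
  exists (n : nat) (e : 'I_n -> T), forall x, P x -> exists i, e i = x.

End LinearCategory.

Arguments hom {K l} X Y.
Arguments idc {K l} X.
Arguments compc {K l X Y Z} g f.
Arguments fmap {K C D} l {X Y} f.
Arguments block {K} C B.
Arguments fullsub {K} C P.

Section BimoduleCategory.
Context (K : fieldType) (J : jordan_superalgebra K).
Implicit Types M N P Q : bimodule J.

Lemma bimodule_id_subproof M : \1%VF \in @bimodule_hom_pred K J M M.
Proof. by apply/asboolP; split=> *; rewrite !lfunE. Qed.

Definition bimodule_id M : bimodule_hom M M :=
  BimoduleHom (bimodule_id_subproof M).

Lemma bimodule_comp_subproof M N P (g : bimodule_hom N P) (f : bimodule_hom M N) :
  (g \o f)%VF \in @bimodule_hom_pred K J M P.
Proof.
have /asboolP[gp ga] := bhom_funP g; have /asboolP[fp fa] := bhom_funP f.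
apply/asboolP; split=> [b v vb|a v]; rewrite !lfunE /=.
  exact/gp/fp.
by rewrite fa ga.
Qed.

Definition bimodule_comp M N P (g : bimodule_hom N P) (f : bimodule_hom M N) :
  bimodule_hom M P := BimoduleHom (bimodule_comp_subproof g f).

Lemma bimodule_comp_idl M N (f : bimodule_hom M N) :
  bimodule_comp (bimodule_id N) f = f.
Proof. by apply: val_inj; rewrite /= comp_lfun1l. Qed.

Lemma bimodule_comp_idr M N (f : bimodule_hom M N) :
  bimodule_comp f (bimodule_id M) = f.
Proof. by apply: val_inj; rewrite /= comp_lfun1r. Qed.

Lemma bimodule_compA M N P Q (h : bimodule_hom P Q) (g : bimodule_hom N P)
    (f : bimodule_hom M N) :
  bimodule_comp h (bimodule_comp g f) = bimodule_comp (bimodule_comp h g) f.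
Proof. by apply: val_inj; rewrite /= comp_lfunA. Qed.

Lemma bimodule_comp_linl M N P (f : bimodule_hom M N) :
  linear (fun g : bimodule_hom N P => bimodule_comp g f).
Proof. by move=> k g h; apply: val_inj; rewrite /= comp_lfunDl comp_lfunZl. Qed.

Lemma bimodule_comp_linr M N P (g : bimodule_hom N P) :
  linear (fun f : bimodule_hom M N => bimodule_comp g f).
Proof. by move=> k f h; apply: val_inj; rewrite /= comp_lfunDr comp_lfunZr. Qed.

Definition bimod : lincat K :=
  @Lincat K (bimodule J) (fun M N => bimodule_hom M N) bimodule_id
    bimodule_comp bimodule_comp_idl bimodule_comp_idr bimodule_compA
    bimodule_comp_linl bimodule_comp_linr.

Definition unital_bimod : lincat K := fullsub bimod (@unital K J).

End BimoduleCategory.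

Record quiver := Quiver {
  vertex : Type;
  arrow : vertex -> vertex -> Type }.

Inductive qpath (Q : quiver) (x : vertex Q) : vertex Q -> Type :=
| qpath_nil : qpath x x
| qpath_snoc y z : qpath x y -> arrow y z -> qpath x z.

Fixpoint qpath_length (Q : quiver) (x y : vertex Q) (p : qpath x y) : nat :=
  if p is qpath_snoc _ _ q _ then (qpath_length q).+1 else 0%N.

Section Representation.
Context (K : fieldType) (Q : quiver).

Record rep := Rep {
  rspace :> vertex Q -> vectType K;
  rmap : forall x y, arrow x y -> 'Hom(rspace x, rspace y) }.

Fixpoint qpath_map (V : rep) (x y : vertex Q) (p : qpath x y) :
    'Hom(V x, V y) :=
  match p in qpath _ y return 'Hom(V x, V y) with
  | qpath_nil => \1%VF
  | qpath_snoc _ _ q a => (rmap V a \o qpath_map V q)%VF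
  end.

Definition nilpotent_rep (V : rep) : Prop :=
  exists n : nat, forall (x y : vertex Q) (p : qpath x y),
    (n <= qpath_length p)%N -> qpath_map V p = 0.

Definition rep_family (V W : rep) : Type := forall x, 'Hom(V x, W x).

HB.instance Definition _ V W := gen_eqMixin (rep_family V W).
HB.instance Definition _ V W := gen_choiceMixin (rep_family V W).

Section Family.
Context (V W : rep).
Implicit Types f g h : rep_family V W.

Definition fam_zero : rep_family V W := fun x => 0.
Definition fam_opp f : rep_family V W := fun x => - f x.
Definition fam_add f g : rep_family V W := fun x => f x + g x.
Definition fam_scale (k : K) f : rep_family V W := fun x => k *: f x.

Fact fam_addA : associative fam_add.
Proof. by move=> f g h; apply: functional_extensionality_dep => x; apply: addrA. Qed.
Fact fam_addC : commutative fam_add.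
Proof. by move=> f g; apply: functional_extensionality_dep => x; apply: addrC. Qed.
Fact fam_add0 : left_id fam_zero fam_add.
Proof. by move=> f; apply: functional_extensionality_dep => x; apply: add0r. Qed.
Fact fam_addN : left_inverse fam_zero fam_opp fam_add.
Proof. by move=> f; apply: functional_extensionality_dep => x; apply: addNr. Qed.

HB.instance Definition _ :=
  GRing.isZmodule.Build (rep_family V W) fam_addA fam_addC fam_add0 fam_addN.

Fact fam_scaleA k l f : fam_scale k (fam_scale l f) = fam_scale (k * l) f.
Proof. by apply: functional_extensionality_dep => x; apply: scalerA. Qed.
Fact fam_scale1 : left_id 1 fam_scale.
Proof. by move=> f; apply: functional_extensionality_dep => x; apply: scale1r. Qed.
Fact fam_scaleDr : right_distributive fam_scale +%R.
Proof. by move=> k f g; apply: functional_extensionality_dep => x; apply: scalerDr. Qed.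
Fact fam_scaleDl f : {morph fam_scale^~ f : k l / k + l}.
Proof. by move=> k l; apply: functional_extensionality_dep => x; apply: scalerDl. Qed.

HB.instance Definition _ :=
  GRing.Zmodule_isLmodule.Build K (rep_family V W)
    fam_scaleA fam_scale1 fam_scaleDr fam_scaleDl.

End Family.

Definition is_rep_hom (V W : rep) (f : rep_family V W) : Prop :=
  forall x y (a : arrow x y), (f y \o rmap V a = rmap W a \o f x)%VF.

Definition rep_hom_pred (V W : rep) : {pred rep_family V W} :=
  fun f => `[< is_rep_hom f >].

Lemma rep_hom_closed V W : submod_closed (@rep_hom_pred V W).
Proof.
split=> [|k f g /asboolP fa /asboolP ga]; apply/asboolP => x y a.
  by rewrite comp_lfun0l comp_lfun0r.
rewrite (comp_lfunDl (k *: f y) (g y)) (comp_lfunDr _ (k *: f x) (g x)).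
by rewrite -comp_lfunZl -comp_lfunZr fa ga.
Qed.

HB.instance Definition _ V W :=
  GRing.isSubmodClosed.Build K (rep_family V W) (@rep_hom_pred V W)
    (@rep_hom_closed V W).

Record rep_hom (V W : rep) := RepHom {
  rhom_fun : rep_family V W;
  rhom_funP : rhom_fun \in @rep_hom_pred V W }.

HB.instance Definition _ V W := [isSub for @rhom_fun V W].
HB.instance Definition _ V W := [Choice of rep_hom V W by <:].
HB.instance Definition _ V W := [SubChoice_isSubLmodule of rep_hom V W by <:].

Definition rep_hom_at V W (f : rep_hom V W) x : 'Hom(V x, W x) := rhom_fun f x.

Coercion rep_hom_at : rep_hom >-> Funclass.

Lemma rep_id_subproof V : (fun x => \1%VF) \in @rep_hom_pred V V.
Proof. by apply/asboolP => x y a; rewrite comp_lfun1l comp_lfun1r. Qed.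

Definition rep_id V : rep_hom V V := RepHom (rep_id_subproof V).

Lemma rep_comp_subproof V W U (g : rep_hom W U) (f : rep_hom V W) :
  (fun x => (g x \o f x)%VF) \in @rep_hom_pred V U.
Proof.
have /asboolP ga := rhom_funP g; have /asboolP fa := rhom_funP f.
by apply/asboolP => x y a; rewrite -comp_lfunA fa !comp_lfunA ga.
Qed.

Definition rep_comp V W U (g : rep_hom W U) (f : rep_hom V W) : rep_hom V U :=
  RepHom (rep_comp_subproof g f).

Lemma rep_homP V W (f g : rep_hom V W) : (forall x, f x = g x) -> f = g.
Proof. by move=> fg; apply/val_inj/functional_extensionality_dep. Qed.

Lemma rep_comp_idl V W (f : rep_hom V W) : rep_comp (rep_id W) f = f.
Proof. by apply: rep_homP => x /=; rewrite comp_lfun1l. Qed.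

Lemma rep_comp_idr V W (f : rep_hom V W) : rep_comp f (rep_id V) = f.
Proof. by apply: rep_homP => x /=; rewrite comp_lfun1r. Qed.

Lemma rep_compA V W U T (h : rep_hom U T) (g : rep_hom W U) (f : rep_hom V W) :
  rep_comp h (rep_comp g f) = rep_comp (rep_comp h g) f.
Proof. by apply: rep_homP => x /=; rewrite comp_lfunA. Qed.

Lemma rep_comp_linl V W U (f : rep_hom V W) :
  linear (fun g : rep_hom W U => rep_comp g f).
Proof.
move=> k g h; apply: rep_homP => x /=.
by rewrite (comp_lfunDl (k *: g x) (h x)) -comp_lfunZl.
Qed.

Lemma rep_comp_linr V W U (g : rep_hom W U) :
  linear (fun f : rep_hom V W => rep_comp g f).
Proof.
move=> k f h; apply: rep_homP => x /=.
by rewrite (comp_lfunDr _ (k *: f x) (h x)) -comp_lfunZr.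
Qed.

Definition reps : lincat K :=
  @Lincat K rep (fun V W => rep_hom V W) rep_id rep_comp rep_comp_idl
    rep_comp_idr rep_compA rep_comp_linl rep_comp_linr.

End Representation.

Inductive JP2_vertex := vertex1 | vertex2.

Inductive JP2_arrow : JP2_vertex -> JP2_vertex -> Type :=
| alpha : JP2_arrow vertex1 vertex1
| beta : JP2_arrow vertex1 vertex2
| gamma : JP2_arrow vertex2 vertex2.

Definition JP2_quiver : quiver := Quiver JP2_arrow.

Definition JP2_relation (K : fieldType) (V : rep K JP2_quiver) : Prop :=
  (rmap V beta \o rmap V alpha = rmap V gamma \o rmap V beta)%VF.

Definition nilpotent_JP2_reps (K : fieldType) : lincat K :=
  fullsub (reps K JP2_quiver)
    (fun V : rep K JP2_quiver => nilpotent_rep V /\ JP2_relation V).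

(* Main.v *)
(* Let E, Y, X, P, C be the operators on a unital bimodule M of the doubled basis
   elements 2 E11, 2 E21, 2 E12, 2 B11, 2 (C12 - C21) of JP(2). The quadratic and
   cubic relations satisfied by the eight basis operators say that M is a module
   over an associative algebra, and a completion of these relations into rewriting
   rules yields the following. The operator
   z = C^2 / 2 is central; M is spanned freely by eight words applied to
   Va = {v | E v = 2 v, X v = 0} and eight words applied to
   Vb = {v | E v = 2 v, Y v = 0}; and n = X P C / 4 maps Vb to Va. All basis operators
   are given on these words by a table involving only z and n. Conversely the table
   turns every map n : Vb -> Va commuting with endomorphisms z of Va and Vb into a
   unital bimodule, once the parity of Va and Vb is chosen. So a bimodule is the same
   thing as a pair of such data, one for each parity, and splits according to the
   parity and the generalized eigenvalue t of z. The summand attached to (t, parity)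
   is the category of nilpotent representations, with alpha and gamma acting by z - t
   on Vb and Va and beta by n. This category is indecomposable because its two simple
   objects occur in the indecomposable object K -> K. *)

Require Import Defs.
From Stdlib Require Import ZArith.
From HB Require Import structures.
From mathcomp Require Import all_boot all_order all_algebra.
From mathcomp Require Import ring ssrZ.
From mathcomp Require Import boolp reals complex.
Import Defs.

Set Implicit Arguments.
Unset Strict Implicit.
Unset Printing Implicit Defensive.

Import Order.TTheory GRing.Theory Num.Theory.
Local Open Scope ring_scope.

(** * Rewriting noncommutative polynomials *)

(** Rewriting enters only through its soundness: every rule is an integral consequence of the
    relations, hence true in every unital bimodule, and two polynomials with the same normal form
    act in the same way. Freeness over Va and Vb is certified by dual elements: polynomials that
    read off the coefficient of each of the sixteen words and whose composites with the words sum to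
    the identity. In the other direction the same table is run on symbolic vectors, with z and n as
    commuting letters. The projection to a parity does not commute with odd operators, so the
    projection to a block cannot be written down on all of M at once. It is defined on Va and Vb,
    where it commutes with z and n, and extended along the words. For density, a representation (V1,
    V2) is fed into the table with the single space V2 x V1 in all sixteen coordinates. The bimodule
    obtained is too large, and the given representation is a retract of its image. Splitting the
    corresponding idempotent inside the block repairs this. *)

Definition word := seq nat.
Definition ncpoly := seq (Z * word).
Definition rule := (word * ncpoly)%type.

Fixpoint lex_lt (v w : word) : bool :=
  match v, w with
  | i :: v', j :: w' => (i < j)%N || (i == j) && lex_lt v' w'
  | _, _ => false
  end.

Definition word_lt (v w : word) : bool :=
  (size v < size w)%N || (size v == size w) && lex_lt v w.

(** A merge that keeps monomials in decreasing degree-lexicographic order, so that the head of a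
    list is its leading term. The inner fixpoint is there because each step consumes one of two
    lists. *)
Fixpoint padd (p : ncpoly) : ncpoly -> ncpoly :=
  fix padd_p (q : ncpoly) : ncpoly :=
  match p, q with
  | [::], _ => q
  | _, [::] => p
  | (c, v) :: p', (d, w) :: q' =>
    if v == w then
      if Z.eqb (Z.add c d) Z0 then padd p' q' else (Z.add c d, v) :: padd p' q'
    else if word_lt v w then (d, w) :: padd_p q' else (c, v) :: padd p' q
  end.

Definition pmono (c : Z) (v w : word) (p : ncpoly) : ncpoly :=
  [seq (Z.mul c t.1, v ++ t.2 ++ w) | t <- p].

Definition psub (p q : ncpoly) : ncpoly := padd p (pmono (Zneg xH) [::] [::] q).

Definition pnorm (p : ncpoly) : ncpoly := foldr (fun t => padd [:: t]) [::] p.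

Fixpoint strip (v w : word) : option word :=
  match v, w with
  | [::], _ => Some w
  | i :: v', j :: w' => if i == j then strip v' w' else None
  | _, [::] => None
  end.

Fixpoint head_redex (rs : seq rule) (w : word) : option (ncpoly * word) :=
  if rs is (l, p) :: rs' then
    if strip l w is Some w' then Some (p, w') else head_redex rs' w
  else None.

Fixpoint redex (rs : seq rule) (w : word) : option (word * ncpoly * word) :=
  if head_redex rs w is Some (p, w') then Some ([::], p, w') else
  if w is i :: w' then
    if redex rs w' is Some (v, p, w'') then Some (i :: v, p, w'') else None
  else None.

Fixpoint nform (n : nat) (rs : seq rule) (p : ncpoly) : ncpoly :=
  match n, p with
  | n'.+1, (c, w) :: p' =>
    if redex rs w is Some (u, q, v) then nform n' rs (padd (pmono c u v q) p')
    else (c, w) :: nform n' rs p'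
  | _, _ => p
  end.

(** Running out of fuel leaves a polynomial that is less reduced but still has the same value, so
    the bound can only make a check fail. *)
Definition fuel := 400%N.

(* Normalising after each letter keeps the intermediate words short. *)
Definition pmul (rs : seq rule) (p q : ncpoly) : ncpoly :=
  foldr padd [::] [seq pmono t.1 [::] [::]
    (foldr (fun i r => nform fuel rs (pmono (Zpos xH) [:: i] [::] r)) q t.2) | t <- p].

(** Solves p = 0 for its leading monomial. Coefficients stay in Z, so this succeeds only if the
    leading coefficient divides all others. *)
Definition orient (p : ncpoly) : option rule :=
  if p is (c, w) :: p' then
    if ~~ Z.eqb c Z0 && all (fun t => Z.eqb (Z.modulo t.1 c) Z0) p'
    then Some (w, [seq (Z.opp (Z.div t.1 c), t.2) | t <- p'])
    else None
  else None.

(** The S-polynomial of the ambiguity in which the word of s starts at position i of the word of r.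
    Both a proper overlap (w' empty) and an inclusion (v' empty) are covered; if the words do not
    match, the result is 0. *)
Definition overlap (r s : rule) (i : nat) : ncpoly :=
  let: (v, p) := r in let: (w, q) := s in
  let v' := drop (size v - i) w in let w' := drop (i + size w) v in
  if v ++ v' == take i v ++ w ++ w' then
    psub (pmono (Zpos xH) [::] v' p) (pmono (Zpos xH) (take i v) w' q)
  else [::].

Inductive hint := RelA of nat & nat & nat | RelB of nat & nat & nat
  | Overlap of nat & nat & nat.

Section Completion.
Context (relA relB : nat -> nat -> nat -> ncpoly).

(** Rules are consed, so reversing the list makes the indices in a hint count rules in their order
    of creation, and these indices stay valid as the list grows. *)
Definition hint_poly (rs : seq rule) (h : hint) : ncpoly :=
  match h with
  | RelA i j k => relA i j k
  | RelB i j k => relB i j k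
  | Overlap a b i => let r n := nth ([::], [:: (Zpos xH, [::])]) (rev rs) n in
      overlap (r a) (r b) i
  end.

Definition add_hint (rs : seq rule) (h : hint) : seq rule :=
  if orient (nform fuel rs (hint_poly rs h)) is Some r then r :: rs else rs.

End Completion.

Section Eval.
Context (K : numFieldType) (V : lmodType K) (op : nat -> {linear V -> V}).

Definition ZtoK (z : Z) : K := (int_of_Z z)%:~R.

Lemma ZtoKD a b : ZtoK (Z.add a b) = ZtoK a + ZtoK b.
Proof. by rewrite /ZtoK -[Z.add a b]/(a + b) rmorphD intrD. Qed.

Lemma ZtoKM a b : ZtoK (Z.mul a b) = ZtoK a * ZtoK b.
Proof. by rewrite /ZtoK -[Z.mul a b]/(a * b) rmorphM intrM. Qed.

Lemma ZtoKN a : ZtoK (Z.opp a) = - ZtoK a.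
Proof. by rewrite /ZtoK -[Z.opp a]/(- a) rmorphN mulrNz. Qed.

Lemma ZtoK_eq0 a : (ZtoK a == 0) = (a == Z0).
Proof. by rewrite /ZtoK intr_eq0 -(inj_eq (can_inj int_of_ZK)). Qed.

Definition weval (w : word) (x : V) : V := foldr (fun i => op i) x w.

Lemma weval_linear w : linear (weval w).
Proof. by elim: w => [|i w IH] a x y //=; rewrite IH linearP. Qed.

HB.instance Definition _ w :=
  GRing.isLinear.Build K V V *:%R (weval w) (weval_linear w).

Lemma weval_cat v w x : weval (v ++ w) x = weval v (weval w x).
Proof. by rewrite /weval foldr_cat. Qed.

Definition peval (p : ncpoly) (x : V) : V :=
  \sum_(t <- p) ZtoK t.1 *: weval t.2 x.

Lemma peval_nil x : peval [::] x = 0. Proof. exact: big_nil. Qed.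

Lemma peval_cons c w p x : peval ((c, w) :: p) x = ZtoK c *: weval w x + peval p x.
Proof. exact: big_cons. Qed.

Lemma peval1 c w x : peval [:: (c, w)] x = ZtoK c *: weval w x.
Proof. by rewrite peval_cons peval_nil addr0. Qed.

Lemma peval_linear p : linear (peval p).
Proof.
move=> a x y; elim: p => [|[c w] p IH]; first by rewrite !peval_nil scaler0 addr0.
rewrite !peval_cons IH linearP /= !scalerDr !scalerA mulrC.
by rewrite -!addrA; congr (_ + _); rewrite addrCA.
Qed.

HB.instance Definition _ p :=
  GRing.isLinear.Build K V V *:%R (peval p) (peval_linear p).

Lemma peval_padd p q x : peval (padd p q) x = peval p x + peval q x.
Proof.
elim: p q => [|[c v] p IHp]; first by case=> [|t q] /=; rewrite peval_nil add0r.
elim=> [|[d w] q IHq]; first by rewrite /= peval_nil addr0.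
rewrite /=; case: eqP => [->|_]; last first.
  case: ifP => _; rewrite peval_cons ?IHp ?[in LHS]IHq !peval_cons.
    by rewrite addrCA.
  by rewrite addrA.
rewrite !peval_cons addrACA -scalerDl -ZtoKD -IHp.
case: ifP => [/Z.eqb_eq ->|_]; last by rewrite peval_cons.
by rewrite [ZtoK _](_ : _ = 0) ?scale0r ?add0r //; apply/eqP; rewrite ZtoK_eq0.
Qed.

Lemma peval_pmono c v w p x :
  peval (pmono c v w p) x = ZtoK c *: weval v (peval p (weval w x)).
Proof.
elim: p => [|[d u] p IH]; first by rewrite /= !peval_nil linear0 scaler0.
rewrite /= !peval_cons IH linearD scalerDr /= ZtoKM -scalerA; congr (_ + _).
by rewrite !weval_cat [weval v (_ *: _)]linearZ.
Qed.

Lemma peval_psub p q x : peval (psub p q) x = peval p x - peval q x.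
Proof. by rewrite peval_padd peval_pmono /= scaleN1r. Qed.

Lemma peval_pnorm p x : peval (pnorm p) x = peval p x.
Proof.
elim: p => [|[c w] p IH]; first by [].
by rewrite -[pnorm _]/(padd [:: (c, w)] (pnorm p)) peval_padd IH peval1 peval_cons.
Qed.

Lemma peval_cat p q x : peval (p ++ q) x = peval p x + peval q x.
Proof. exact: big_cat. Qed.

Definition holds (r : rule) : Prop := forall x, weval r.1 x = peval r.2 x.

Inductive all_hold : seq rule -> Prop :=
| all_hold_nil : all_hold [::]
| all_hold_cons r rs : holds r -> all_hold rs -> all_hold (r :: rs).

Lemma all_hold_consP r rs : all_hold (r :: rs) <-> holds r /\ all_hold rs.
Proof.
split=> [h|[hr hrs]]; last exact: all_hold_cons.
by inversion h.
Qed.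

Lemma strip_cat v w w' : strip v w = Some w' -> w = v ++ w'.
Proof.
elim: v w => [|i v IH] w /=; first by case=> ->.
by case: w => [|j w] //; case: eqP => // -> /IH ->.
Qed.

Lemma head_redexP rs w p w' : all_hold rs -> head_redex rs w = Some (p, w') ->
  forall x, weval w x = peval p (weval w' x).
Proof.
elim: rs => [|[l q] rs IH] //= /all_hold_consP[hl hrs]; case E: (strip l w) => [u|]; last exact: IH.
by case=> <- <- x; rewrite (strip_cat E) weval_cat hl.
Qed.

Lemma redexP rs w u p v : all_hold rs -> redex rs w = Some (u, p, v) ->
  forall x, weval w x = weval u (peval p (weval v x)).
Proof.
move=> hrs; elim: w u p v => [|i w IH] u p v /=.
  by case E: head_redex => [[q z]|] // [<- <- <-] x; exact: (head_redexP hrs E x).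
case E: head_redex => [[q z]|].
  by case=> <- <- <- x; exact: (head_redexP hrs E x).
case E': (redex rs w) => [[[a q] b]|] // [<- <- <-] x /=.
by rewrite (IH _ _ _ E').
Qed.

Lemma peval_nform n rs p x : all_hold rs -> peval (nform n rs p) x = peval p x.
Proof.
move=> hrs; elim: n p => [|n IH] [|[c w] p] //=.
case E: redex => [[[u q] v]|]; last by rewrite !peval_cons IH.
by rewrite IH peval_padd peval_pmono -(redexP hrs E) peval_cons.
Qed.

#[global] Arguments nform : simpl never.

Lemma peval_pmul rs p q x : all_hold rs ->
  peval (pmul rs p q) x = peval p (peval q x).
Proof.
move=> hrs; elim: p => [|[c w] p IH]; first by rewrite !peval_nil.
rewrite /pmul /= peval_padd IH peval_cons peval_pmono /=; congr (_ *: _ + _).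
by elim: w => //= i w <-; rewrite peval_nform // peval_pmono /= scale1r.
Qed.

(** In characteristic 0 the leading integer can be cancelled after the exact division. *)
Lemma orientP p r : (forall x, peval p x = 0) -> orient p = Some r -> holds r.
Proof.
case: p => [|[c w] p] //= h; case: ifP => // /andP[c0 /allP dv] [<-] x /=.
have {}c0 : ZtoK c != 0 by rewrite ZtoK_eq0.
apply: (scalerI c0); apply/eqP; rewrite -subr_eq0; apply/eqP.
have := h x; rewrite peval_cons => <-; congr (_ + _); rewrite /peval big_map.
rewrite scaler_sumr -sumrN; apply: eq_big_seq => t /dv /Z.eqb_eq /= m0.
have cn : c <> Z0 by move=> e; move: c0; rewrite ZtoK_eq0 e eqxx.
rewrite scalerA -scaleNr; congr (_ *: _); rewrite ZtoKN mulrN opprK -ZtoKM.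
by congr ZtoK; have := Z.div_mod t.1 c cn; rewrite m0 Z.add_0_r.
Qed.

Lemma peval_overlap r s i x : holds r -> holds s -> peval (overlap r s i) x = 0.
Proof.
case: r s => [v p] [w q] hr hs; rewrite /overlap.
case: eqP => [e|_]; last exact: peval_nil.
rewrite peval_psub !peval_pmono !scale1r /= -[peval p _]hr -[peval q _]hs /=.
by rewrite -!weval_cat e -catA subrr.
Qed.

Lemma all_hold_nth rs n d : all_hold rs -> (n < size rs)%N -> holds (nth d rs n).
Proof.
by elim: rs n => [|r rs IH] [|n] //= /all_hold_consP[hr /IH hrs]; [|apply: hrs].
Qed.

Lemma all_hold_rcons rs r : all_hold (rcons rs r) <-> all_hold rs /\ holds r.
Proof.
elim: rs => [|s rs IH] /=; rewrite !all_hold_consP; last by rewrite IH; tauto.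
by tauto.
Qed.

Lemma all_hold_rev rs : all_hold rs -> all_hold (rev rs).
Proof.
elim: rs => [|r rs IH] // /all_hold_consP[hr /IH].
by rewrite rev_cons all_hold_rcons.
Qed.

Lemma all_hold_add_hint relA relB rs h :
  (forall i j k x, peval (relA i j k) x = 0) ->
  (forall i j k x, peval (relB i j k) x = 0) ->
  all_hold rs -> all_hold (add_hint relA relB rs h).
Proof.
move=> hA hB hrs; rewrite /add_hint; case E: orient => [r|] //=; apply: all_hold_cons => //.
apply: (orientP _ E) => x; rewrite peval_nform //; case: h {E} => [i j k|i j k|a b i] //=.
have holds_nth n : holds (nth ([::], [:: (Zpos xH, [::])]) (rev rs) n).
  case: (ltnP n (size (rev rs))) => [n_lt|n_ge].
    exact: all_hold_nth (all_hold_rev hrs) n_lt.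
  by rewrite nth_default // => y; rewrite peval1 scale1r.
exact: peval_overlap.
Qed.

Lemma all_hold_foldl relA relB rs hs :
  (forall i j k x, peval (relA i j k) x = 0) ->
  (forall i j k x, peval (relB i j k) x = 0) ->
  all_hold rs -> all_hold (foldl (add_hint relA relB) rs hs).
Proof.
move=> hA hB; elim: hs rs => //= h hs IH rs hrs.
exact/IH/all_hold_add_hint.
Qed.

End Eval.

(** * Relations and tables for JP(2) *)

(* The letters 0, ..., 7 stand for the operators of the doubled basis
   2 E11, 2 E21, 2 E12 (even), 2 B22, 2 (B12 + B21), 2 B11, 2 (C12 - C21) (odd)
   and 2 E22; doubling makes the structure constants integral. *)
Definition jp_parity (i : nat) : bool := i \in [:: 3; 4; 5; 6]%N.

Definition jp_const (i j : nat) : seq (Z * nat) :=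
  nth [::] (nth [::] (
  [:: [:: [:: (Zpos 2, 0)]; [:: (Zpos xH, 1)]; [:: (Zpos xH, 2)]; [::]; [:: (Zpos xH, 4)]; [:: (Zpos 2, 5)]; [:: (Zpos xH, 6)]; [::]];
  [:: [:: (Zpos xH, 1)]; [::]; [:: (Zpos xH, 0); (Zpos xH, 7)]; [::]; [:: (Zpos 2, 3)]; [:: (Zpos xH, 4)]; [::]; [:: (Zpos xH, 1)]];
  [:: [:: (Zpos xH, 2)]; [:: (Zpos xH, 0); (Zpos xH, 7)]; [::]; [:: (Zpos xH, 4)]; [:: (Zpos 2, 5)]; [::]; [::]; [:: (Zpos xH, 2)]];
  [:: [::]; [::]; [:: (Zpos xH, 4)]; [::]; [::]; [::]; [:: (Zneg xH, 1)]; [:: (Zpos 2, 3)]];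
  [:: [:: (Zpos xH, 4)]; [:: (Zpos 2, 3)]; [:: (Zpos 2, 5)]; [::]; [::]; [::]; [:: (Zneg xH, 0); (Zpos xH, 7)]; [:: (Zpos xH, 4)]];
  [:: [:: (Zpos 2, 5)]; [:: (Zpos xH, 4)]; [::]; [::]; [::]; [::]; [:: (Zpos xH, 2)]; [::]];
  [:: [:: (Zpos xH, 6)]; [::]; [::]; [:: (Zpos xH, 1)]; [:: (Zpos xH, 0); (Zneg xH, 7)]; [:: (Zneg xH, 2)]; [::]; [:: (Zpos xH, 6)]];
  [:: [::]; [:: (Zpos xH, 1)]; [:: (Zpos xH, 2)]; [:: (Zpos 2, 3)]; [:: (Zpos xH, 4)]; [::]; [:: (Zpos xH, 6)]; [:: (Zpos 2, 7)]]]
  : seq (seq (seq (Z * nat)))) i) j.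

Definition lc_mul (u v : seq (Z * nat)) : seq (Z * nat) :=
  flatten [seq flatten [seq [seq (Z.mul (Z.mul s.1 t.1) r.1, r.2)
    | r <- jp_const s.2 t.2] | t <- v] | s <- u].

Definition Zsign (b : bool) : Z := if b then Zneg xH else Zpos xH.

Definition lc_poly (c : Z) (v : word) (u : seq (Z * nat)) (w : word) : ncpoly :=
  [seq (Z.mul c t.1, v ++ t.2 :: w) | t <- u].

(** The Jordan superidentity with basis elements in its first three slots and a module element in
    the last one, read as a polynomial in the operators. An index out of range gives 0, so that the
    relation holds for all indices. *)
Definition jp_relA (i j k : nat) : ncpoly :=
  if [&& i < 8, j < 8 & k < 8]%N then
    let a := jp_parity i in let b := jp_parity j in let c := jp_parity k in
    pnorm (lc_poly (Zsign false) [::] (lc_mul (jp_const i j) [:: (Zpos xH, k)]) [::]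
      ++ [:: (Zsign (a && (b (+) c)), [:: j; k; i]); (Zsign (b && c), [:: i; k; j])]
      ++ lc_poly (Zsign true) [::] (jp_const i j) [:: k]
      ++ lc_poly (Zsign (~~ (b && c))) [::] (jp_const i k) [:: j]
      ++ lc_poly (Zsign (~~ (a && (b (+) c)))) [::] (jp_const j k) [:: i])
  else [::].

(** The same with the module element in the third slot. *)
Definition jp_relB (i j k : nat) : ncpoly :=
  if [&& i < 8, j < 8 & k < 8]%N then
    let a := jp_parity i in let b := jp_parity j in let d := jp_parity k in
    pnorm (lc_poly (Zsign ((a (+) b) && d)) [:: k] (jp_const i j) [::]
      ++ lc_poly (Zsign (a && b)) [:: j] (jp_const i k) [::]
      ++ lc_poly (Zsign false) [:: i] (jp_const j k) [::]
      ++ lc_poly (Zsign true) [::] (jp_const i j) [:: k]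
      ++ lc_poly (Zsign (~~ (a && (b (+) d)))) [::] (jp_const j k) [:: i]
      ++ lc_poly (Zsign (~~ (b && d))) [::] (jp_const i k) [:: j])
  else [::].

(* The letters 8 and 9 stand for projections onto the spaces Va and Vb of the
   header; letter 7 is eliminated by unitality. *)
Definition jp_rules0 : seq rule := rev
  [:: ([:: 7], [:: (Zneg xH, [:: 0]); (Zpos 2, [::])]);
      ([:: 0; 8], [:: (Zpos 2, [:: 8])]); ([:: 2; 8], [::]);
      ([:: 0; 9], [:: (Zpos 2, [:: 9])]); ([:: 1; 9], [::])]%N.

(* A completion of the defining relations: each step adds an oriented relation
   or the normal form of an overlap of two earlier rules. *)
Definition jp_hints : seq hint :=
  [:: RelB 0 0 3; RelB 0 1 3; RelB 0 2 3; RelB 1 1 5; RelB 1 2 5; RelB 0 3 4;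
  RelB 0 0 5; RelB 0 1 5; RelB 0 2 5; RelB 0 3 5; RelB 1 4 5; RelB 0 4 5;
  RelB 2 4 5; RelB 0 3 6; RelB 1 5 6; RelB 0 5 6; RelA 0 0 0; RelA 0 0 1;
  RelA 0 0 2; RelA 0 0 3; RelA 0 0 4; RelA 0 0 5; RelA 0 0 6; RelA 0 1 0;
  RelA 1 1 0; RelA 0 1 1; RelA 1 1 1; RelA 0 1 2; RelA 1 1 2; RelA 0 1 4;
  RelA 1 1 5; RelA 0 1 6; RelA 1 1 6; RelA 0 2 0; RelA 1 2 0; RelA 2 2 0;
  RelA 0 2 1; RelA 1 2 1; RelA 2 2 1; RelA 0 2 2; RelA 1 2 2; RelA 2 2 2;
  RelA 0 2 3; RelA 1 2 3; RelA 2 2 3; RelA 0 2 4; RelA 1 2 4; RelA 2 2 4;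
  RelA 0 2 5; RelA 1 2 5; RelA 2 2 5; RelA 0 2 6; RelA 1 2 6; RelA 2 2 6;
  RelA 0 3 2; RelA 2 3 2; RelA 2 3 4; RelA 0 3 5; RelA 1 3 6; RelA 2 3 6;
  RelA 0 4 5; RelA 1 4 5; RelA 2 4 5; RelA 3 4 5; RelA 0 4 6; RelA 1 4 6;
  RelA 2 4 6; RelA 0 5 6; RelA 1 5 6; RelA 4 5 6; RelA 0 6 0; RelA 1 6 0;
  RelA 2 6 0; RelA 4 6 0; RelA 0 6 1; RelA 1 6 1; RelA 2 6 1; RelA 0 6 2;
  RelA 1 6 2; RelA 2 6 2; RelA 4 6 2; RelA 5 6 2; RelA 0 6 6; RelA 1 6 6;
  RelA 2 6 6; Overlap 5 1 1; Overlap 5 3 1; Overlap 7 1 1; Overlap 7 3 1;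
  Overlap 8 4 1; Overlap 11 3 1; Overlap 12 4 1; Overlap 13 2 1;
  Overlap 7 21 1; Overlap 22 1 2; Overlap 23 3 2; Overlap 25 2 2;
  Overlap 26 12 2; Overlap 27 1 2; Overlap 27 3 2; Overlap 30 1 2;
  Overlap 32 3 2; Overlap 34 2 2; Overlap 35 13 2; Overlap 36 1 2;
  Overlap 36 3 2; Overlap 41 1 2; Overlap 44 3 2; Overlap 45 4 2;
  Overlap 56 1 2; Overlap 57 4 2; Overlap 59 1 2; Overlap 107 116 2;
  Overlap 19 116 1; Overlap 18 117 1; Overlap 59 3 2; Overlap 69 3 2;
  Overlap 71 2 2; Overlap 72 3 2; Overlap 73 4 2; Overlap 79 1 2;
  Overlap 81 2 2; Overlap 82 3 2; Overlap 83 4 2; Overlap 89 2 2;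
  Overlap 11 91 1; Overlap 24 91 1; Overlap 120 131 2; Overlap 10 131 1;
  Overlap 18 131 1; Overlap 14 93 1; Overlap 49 93 1; Overlap 12 94 1;
  Overlap 51 94 1; Overlap 53 95 1; Overlap 54 96 1; Overlap 13 111 1;
  Overlap 19 118 1; Overlap 18 119 1; Overlap 20 122 1; Overlap 18 134 1;
  Overlap 57 94 2; Overlap 56 95 2; Overlap 57 96 2; Overlap 36 99 2;
  Overlap 69 100 2; Overlap 36 103 2; Overlap 69 104 2; Overlap 57 106 2;
  Overlap 89 114 2; Overlap 78 121 1; Overlap 87 105 2; Overlap 70 115 2;
  Overlap 73 115 2; Overlap 87 149 2; Overlap 87 156 2; Overlap 8 110 1]%N.

Definition jp_rules : seq rule :=
  foldl (add_hint jp_relA jp_relB) jp_rules0 jp_hints.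

(* Words w such that w Va (the first eight) and w Vb (the last eight) span. *)
Definition basis_word (k : nat) : word :=
  nth [::] [:: [::]; [:: 1]; [:: 1; 1]; [:: 6]; [:: 1; 6]; [:: 6; 1];
    [:: 1; 1; 6]; [:: 6; 1; 6]; [::]; [:: 2]; [:: 2; 2]; [:: 5]; [:: 4];
    [:: 2; 5]; [:: 2; 4]; [:: 4; 5]]%N k.

Definition basis_end (k : nat) : nat := if (k < 8)%N then 8%N else 9%N.

(* Eight times the idempotents onto Va and Vb. *)
Definition end_poly (k : nat) : ncpoly :=
  if (k < 8)%N
  then [:: (Zpos xH, [:: 2; 2; 1; 1; 0; 0]); (Zneg xH, [:: 2; 2; 1; 1; 0])]%N
  else [:: (Zpos xH, [:: 1; 1; 2; 2; 0; 0]); (Zneg xH, [:: 1; 1; 2; 2; 0])]%N.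

(** Eight times an operator which, followed by the idempotent onto Va or Vb, picks the coefficient
    of the k-th word. For instance X Y v = 2 v on Va gives the entry 4 X for the word Y. *)
Definition dual_poly (k : nat) : ncpoly :=
  nth [::] [:: [:: (Zpos 8, [::])]; [:: (Zpos 4, [:: 2])]; [:: (Zpos 2, [:: 2; 2])];
    [:: (Zneg 4, [:: 4])]; [:: (Zneg 2, [:: 4; 2])]; [:: (Zneg 2, [:: 4; 2]); (Zpos 4, [:: 5])];
    [:: (Zneg 2, [:: 5; 2])]; [:: (Zneg 2, [:: 4; 5])];
    [:: (Zpos 8, [::])]; [:: (Zpos 4, [:: 1])]; [:: (Zpos 2, [:: 1; 1])]; [:: (Zneg 4, [:: 1; 6])];
    [:: (Zpos 4, [:: 6])]; [:: (Zneg 2, [:: 1; 1; 6])]; [:: (Zpos 2, [:: 6; 1]); (Zpos 2, [:: 1; 6])];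
    [:: (Zpos 2, [:: 6; 1; 6])]] k.

(* The entry (j, c, k, s) of row i says that letter i sends w_j v to a sum
   with the term c w_k v, c w_k z v or c w_k n v for s = 0, 1, 2, where
   z = C^2 / 2 is central and n = X P C / 4 maps Vb to Va. *)
Definition act_row (i : nat) : seq (nat * Z * nat * nat) :=
  nth [::] [:: [:: (0, Zpos 2, 0, 0); (1, Zpos xH, 1, 0); (3, Zpos xH, 3, 0);
    (4, Zneg xH, 5, 0); (4, Zpos xH, 4, 0); (5, Zpos xH, 5, 0);
    (5, Zneg xH, 4, 0); (6, Zpos xH, 6, 0); (7, Zpos xH, 7, 0);
    (8, Zpos 2, 8, 0); (9, Zpos xH, 9, 0); (11, Zpos 2, 11, 0);
    (12, Zpos xH, 12, 0); (13, Zpos xH, 13, 0); (14, Zpos 2, 11, 0);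
    (15, Zpos xH, 15, 0)];
  [:: (0, Zpos xH, 1, 0); (1, Zpos xH, 2, 0); (3, Zpos xH, 4, 0);
    (4, Zpos xH, 6, 0); (9, Zpos 2, 8, 0); (10, Zpos 2, 9, 0);
    (11, Zpos xH, 12, 0); (13, Zpos xH, 14, 0); (14, Zpos 2, 12, 0)];
  [:: (1, Zpos 2, 0, 0); (2, Zpos 2, 1, 0); (4, Zpos 2, 3, 0);
    (6, Zpos 2, 4, 0); (8, Zpos xH, 9, 0); (9, Zpos xH, 10, 0);
    (11, Zpos xH, 13, 0); (12, Zpos xH, 14, 0); (14, Zpos 2, 13, 0)];
  [:: (3, Zneg xH, 1, 0); (4, Zneg xH, 2, 0); (5, Zneg xH, 2, 0);
    (7, Zneg xH, 6, 0); (9, Zpos xH, 12, 0); (10, Zpos 2, 14, 0);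
    (10, Zneg 2, 11, 0); (13, Zpos xH, 15, 0)];
  [:: (3, Zneg 2, 0, 0); (4, Zneg 2, 1, 0); (6, Zneg 2, 2, 0);
    (7, Zpos 2, 5, 0); (8, Zpos xH, 12, 0); (9, Zpos xH, 14, 0);
    (10, Zpos 2, 13, 0); (11, Zpos xH, 15, 0)];
  [:: (4, Zneg 2, 0, 0); (5, Zpos 2, 0, 0); (6, Zneg 2, 1, 0);
    (7, Zpos 2, 3, 0); (8, Zpos xH, 11, 0); (9, Zpos xH, 13, 0);
    (12, Zneg xH, 15, 0)];
  [:: (0, Zpos xH, 3, 0); (1, Zpos xH, 5, 0); (2, Zneg xH, 6, 0);
    (3, Zpos 2, 0, 1); (4, Zpos xH, 7, 0); (5, Zpos 2, 1, 1);
    (6, Zneg 2, 2, 1); (7, Zpos 2, 4, 1); (8, Zpos xH, 12, 1);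
    (8, Zneg xH, 6, 2); (9, Zneg 2, 11, 1); (9, Zneg 2, 5, 2);
    (9, Zpos xH, 14, 1); (10, Zneg 2, 13, 1); (10, Zpos 4, 3, 2);
    (11, Zpos xH, 15, 1); (11, Zneg 2, 1, 2); (11, Zneg xH, 9, 0);
    (12, Zneg 2, 2, 2); (12, Zpos 2, 8, 0); (13, Zpos 4, 0, 2);
    (13, Zneg xH, 10, 0); (14, Zpos 2, 15, 1); (15, Zpos xH, 14, 0)];
  [:: (1, Zpos xH, 1, 0); (2, Zpos 2, 2, 0); (3, Zpos xH, 3, 0);
    (4, Zpos xH, 4, 0); (4, Zpos xH, 5, 0); (5, Zpos xH, 4, 0);
    (5, Zpos xH, 5, 0); (6, Zpos xH, 6, 0); (7, Zpos xH, 7, 0);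
    (9, Zpos xH, 9, 0); (10, Zpos 2, 10, 0); (12, Zpos xH, 12, 0);
    (13, Zpos xH, 13, 0); (14, Zneg 2, 11, 0); (14, Zpos 2, 14, 0);
    (15, Zpos xH, 15, 0)]]%N i.

Definition central_word : word := [:: 6; 6]%N.
Definition beta_word : word := [:: 2; 5; 6]%N.

(** Four times the table entry, since 4 z = 2 C^2 and 4 n = X P C have integral coefficients. *)
Definition act_term (w : word) (t : nat * Z * nat * nat) : ncpoly :=
  let: (_, c, k, s) := t in
  match s with
  | 0 => [:: (Z.mul (Zpos 4) c, basis_word k ++ w)]
  | 1 => [:: (Z.mul (Zpos 2) c, basis_word k ++ central_word ++ w)]
  | _ => [:: (c, basis_word k ++ beta_word ++ w)]
  end.

Definition act_check : bool :=
  all (fun i => all (fun j =>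
    let w := [:: basis_end j] in
    pmul jp_rules (psub [:: (Zpos 4, i :: basis_word j)] [::]) [:: (Zpos xH, w)]
      == pmul jp_rules (pnorm (flatten [seq act_term [::] t | t <- act_row i & t.1.1.1 == j]))
           [:: (Zpos xH, w)])
    (iota 0 16)) (iota 0 8).

(** The dual elements separate the words; the constant 64 is the product of the factors 8 in
    [end_poly] and [dual_poly]. *)
Definition dual_check : bool :=
  all (fun k => all (fun j =>
    pmul jp_rules (end_poly k) (pmul jp_rules (dual_poly k)
      [:: (Zpos xH, rcons (basis_word j) (basis_end j))])
      == if j == k then [:: (Zpos 64, [:: basis_end k])] else [::])
    (iota 0 16)) (iota 0 16).

(** The resolution of the identity by the words and their dual elements, which shows that the words
    span. *)
Definition complete_check : bool :=
  foldr padd [::] [seq pmul jp_rules [:: (Zpos xH, basis_word k)]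
      (pmul jp_rules (pmul jp_rules (end_poly k) [:: (Zpos xH, [::])])
        (pmul jp_rules (dual_poly k) [:: (Zpos xH, [::])])) | k <- iota 0 16]
  == [:: (Zpos 64, [::])].

Definition central_check : bool :=
  all (fun i => pmul jp_rules [:: (Zpos xH, i :: central_word)] [:: (Zpos xH, [::])]
    == pmul jp_rules [:: (Zpos xH, rcons central_word i)] [:: (Zpos xH, [::])]) (iota 0 8).

(** The images of the two idempotents satisfy the equations of Va and Vb, and X P C maps Vb into
    Va. *)
Definition end_check : bool :=
  let e2 := [:: (Zpos xH, [:: 0%N]); (Zneg 2, [::])] in
  [&& pmul jp_rules e2 (pmul jp_rules (end_poly 0) [:: (Zpos xH, [::])]) == [::],
      pmul jp_rules e2 (pmul jp_rules (end_poly 8) [:: (Zpos xH, [::])]) == [::],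
      pmul jp_rules [:: (Zpos xH, [:: 2%N])] (pmul jp_rules (end_poly 0) [:: (Zpos xH, [::])]) == [::],
      pmul jp_rules [:: (Zpos xH, [:: 1%N])] (pmul jp_rules (end_poly 8) [:: (Zpos xH, [::])]) == [::],
      pmul jp_rules e2 [:: (Zpos xH, rcons beta_word 9)] == [::] &
      pmul jp_rules [:: (Zpos xH, [:: 2%N])] [:: (Zpos xH, rcons beta_word 9)] == [::]].

Lemma act_checkT : act_check. Proof. by vm_cast_no_check (erefl true). Qed.

Lemma dual_checkT : dual_check. Proof. by vm_cast_no_check (erefl true). Qed.

Lemma complete_checkT : complete_check. Proof. by vm_cast_no_check (erefl true). Qed.

Lemma central_checkT : central_check. Proof. by vm_cast_no_check (erefl true). Qed.

Lemma end_checkT : end_check. Proof. by vm_cast_no_check (erefl true). Qed.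

(** * Null extensions *)

Section Coordinates.
Context (K : fieldType) (V : vectType K).

Definition vcoord (i : 'I_(\dim {:V})) (v : V) : K := coord (vbasis {:V}) i v.

Lemma vcoordD i u v : vcoord i (u + v) = vcoord i u + vcoord i v.
Proof. by rewrite /vcoord linearD. Qed.

Lemma vcoordN i v : vcoord i (- v) = - vcoord i v.
Proof. by rewrite /vcoord linearN. Qed.

Lemma vcoordZ i k v : vcoord i (k *: v) = k * vcoord i v.
Proof. by rewrite /vcoord linearZ. Qed.

Lemma vcoord0 i : vcoord i 0 = 0.
Proof. by rewrite /vcoord linear0. Qed.

Lemma vcoord_ext u v : (forall i, vcoord i u = vcoord i v) -> u = v.
Proof.
move=> e; rewrite (coord_vbasis (memvf u)) (coord_vbasis (memvf v)).
by apply: eq_bigr => i _; congr (_ *: _); exact: e.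
Qed.

End Coordinates.

Definition vcoordE := (vcoordD, vcoordN, vcoordZ, vcoord0).

(* Identities in a vector space are reduced to the scalars, where [ring] applies. *)
Ltac vcoords := apply: vcoord_ext => ?; rewrite !vcoordE;
  repeat match goal with |- context [vcoord ?i ?v] =>
    move: (vcoord i v) => ? end.

Section BimoduleRelations.
Context (K : numFieldType) (J : jordan_superalgebra K).
Implicit Types (x y z t : J).

Lemma neq_negb (b c : bool) : b != c -> b = ~~ c.
Proof. by case: b c => -[]. Qed.

Lemma hcomp_other (V : superspace K) b (v : V) :
  v \in part V b -> hcomp V (~~ b) v = 0.
Proof.
move=> vb; have := hcompD v; case: b vb => vb; rewrite /= (hcomp_id vb) //.
  by move/eqP; rewrite -subr_eq0 addrK => /eqP.
by move/eqP; rewrite addrC -subr_eq0 addrK => /eqP.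
Qed.

Section Action.
Context (M : superspace K) (act : J -> M -> M).

Definition relA_defect (a b c : bool) x y z (v : M) : M :=
  act (jmul (jmul x y) z) v
  + (-1) ^+ (a * b + a * c) *: act y (act z (act x v))
  + (-1) ^+ (b * c) *: act x (act z (act y v))
  - act (jmul x y) (act z v)
  - (-1) ^+ (b * c) *: act (jmul x z) (act y v)
  - (-1) ^+ (a * b + a * c) *: act (jmul y z) (act x v).

Definition relB_defect (a b d : bool) x y t (v : M) : M :=
  (-1) ^+ (a * d + b * d) *: act t (act (jmul x y) v)
  + (-1) ^+ (a * b) *: act y (act (jmul x t) v)
  + act x (act (jmul y t) v)
  - act (jmul x y) (act t v)
  - (-1) ^+ (a * b + a * d) *: act (jmul y t) (act x v)
  - (-1) ^+ (b * d) *: act (jmul x t) (act y v).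

Definition relations_hold : Prop :=
  forall a b c x y z, x \in part J a -> y \in part J b -> z \in part J c ->
  forall v, relA_defect a b c x y z v = 0 /\ relB_defect a b c x y z v = 0.

Hypothesis act_lin : (forall x, linear (act x)) /\ (forall v, linear (act^~ v)).
Hypothesis act_part : forall i j x v,
  x \in part J i -> v \in part M j -> act x v \in part M (i (+) j).

Lemma actDr x u v : act x (u + v) = act x u + act x v.
Proof. by have := act_lin.1 x 1 u v; rewrite !scale1r. Qed.

Lemma actr0 x : act x 0 = 0.
Proof. by apply: (addrI (act x 0)); rewrite -actDr !addr0. Qed.

Lemma actZr x k v : act x (k *: v) = k *: act x v.
Proof. by have := act_lin.1 x k v 0; rewrite actr0 !addr0. Qed.

Lemma actDl x y v : act (x + y) v = act x v + act y v.
Proof. by have := act_lin.2 v 1 x y; rewrite /= !scale1r. Qed.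

Lemma actl0 v : act 0 v = 0.
Proof. by apply: (addrI (act 0 v)); rewrite -actDl !addr0. Qed.

Lemma actZl x k v : act (k *: x) v = k *: act x v.
Proof. by have := act_lin.2 v k x 0; rewrite /= actl0 !addr0. Qed.

Lemma right_act_hom i j x v : x \in part J i -> v \in part M j ->
  right_act act v x = (-1) ^+ (i * j) *: act x v.
Proof.
move=> xi vj; rewrite /right_act (bigD1 i) //= (bigD1 j) //=.
rewrite (hcomp_id xi) (hcomp_id vj) [X in _ + X + _]big1 => [|j' j'j]; last first.
  by rewrite (neq_negb j'j) (hcomp_other vj) actr0 scaler0.
rewrite [X in _ + X]big1 => [|i' i'i]; first by rewrite !addr0.
by rewrite (neq_negb i'i) (hcomp_other xi); apply: big1 => j' _; rewrite actl0 scaler0.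
Qed.

Lemma null_ext_mul_hom a b (u w : dsum J M) :
  u \in part (dsum J M) a -> w \in part (dsum J M) b ->
  null_ext_mul act u w =
    (jmul u.1 w.1, act u.1 w.2 + (-1) ^+ (a * b) *: act w.1 u.2).
Proof.
rewrite !mem_dsum_part => /andP[u1 u2] /andP[w1 w2].
by rewrite /null_ext_mul (right_act_hom w1 u2) mulnC.
Qed.

Lemma null_ext_mul_part a b (u w : dsum J M) :
  u \in part (dsum J M) a -> w \in part (dsum J M) b ->
  null_ext_mul act u w \in part (dsum J M) (a (+) b).
Proof.
move=> ua wb; rewrite (null_ext_mul_hom ua wb); move: ua wb.
rewrite !mem_dsum_part => /andP[u1 u2] /andP[w1 w2] /=.
have [_ mul_part _ _] := jmulP J; rewrite mul_part //=.
by rewrite memvD ?act_part // memvZ // addbC act_part.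
Qed.

Lemma relA_defect0 a b c x y z : relA_defect a b c x y z 0 = 0.
Proof.
by rewrite /relA_defect !(actr0, scaler0, oppr0, addr0, subr0).
Qed.

Lemma relB_defect0 a b c x y z : relB_defect a b c x y z 0 = 0.
Proof.
by rewrite /relB_defect !(actr0, scaler0, oppr0, addr0, subr0).
Qed.

Lemma relA_defectD a b c x y z u v : relA_defect a b c x y z (u + v) =
  relA_defect a b c x y z u + relA_defect a b c x y z v.
Proof. by rewrite /relA_defect !actDr; vcoords; ring. Qed.

Lemma relB_defectD a b c x y z u v : relB_defect a b c x y z (u + v) =
  relB_defect a b c x y z u + relB_defect a b c x y z v.
Proof. by rewrite /relB_defect !actDr; vcoords; ring. Qed.

(** The module component of the identity is a sum over the slot holding the module element. The
    identity is supersymmetric in x, y, t, so these three slots produce one relation up to sign, and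
    z produces the other. *)
Lemma null_ext_jordan_defect a b c d (x y z t : dsum J M) :
  x \in part (dsum J M) a -> y \in part (dsum J M) b ->
  z \in part (dsum J M) c -> t \in part (dsum J M) d ->
  let mul := null_ext_mul act in
  (mul (mul (mul x y) z) t
    + (-1) ^+ (b * c + b * d + c * d) *: mul (mul (mul x t) z) y
    + (-1) ^+ (a * b + a * c + a * d + c * d) *: mul (mul (mul y t) z) x).2
  = (mul (mul x y) (mul z t)
    + (-1) ^+ (b * c) *: mul (mul x z) (mul y t)
    + (-1) ^+ (b * d + c * d) *: mul (mul x t) (mul y z)).2
  + (relA_defect a b c x.1 y.1 z.1 t.2
     + (-1) ^+ (b * c + b * d + c * d) *: relA_defect a d c x.1 t.1 z.1 y.2
     + (-1) ^+ (a * b + a * c + a * d + c * d) *: relA_defect b d c y.1 t.1 z.1 x.2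
     + (-1) ^+ (c * d) *: relB_defect a b d x.1 y.1 t.1 z.2).
Proof.
move=> xa yb zc td mul; rewrite /mul {mul}.
have [[xy xz] xt] := (null_ext_mul_part xa yb, null_ext_mul_part xa zc,
  null_ext_mul_part xa td).
have [[yz yt] zt] := (null_ext_mul_part yb zc, null_ext_mul_part yb td,
  null_ext_mul_part zc td).
rewrite (null_ext_mul_hom (null_ext_mul_part xy zc) td) (null_ext_mul_hom xy zc).
rewrite (null_ext_mul_hom (null_ext_mul_part xt zc) yb) (null_ext_mul_hom xt zc).
rewrite (null_ext_mul_hom (null_ext_mul_part yt zc) xa) (null_ext_mul_hom yt zc).
rewrite (null_ext_mul_hom xy zt) (null_ext_mul_hom xz yt) (null_ext_mul_hom xt yz).
rewrite (null_ext_mul_hom xa yb) (null_ext_mul_hom xa zc) (null_ext_mul_hom xa td).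
rewrite (null_ext_mul_hom yb zc) (null_ext_mul_hom yb td) (null_ext_mul_hom zc td).
have [_ _ mulC _] := jmulP J.
(* The relation with t in its second slot contains t z, the identity contains z t. *)
have tzE : jmul t.1 z.1 = (-1) ^+ (d * c) *: jmul z.1 t.1.
  by move: td zc; rewrite !mem_dsum_part => /andP[td _] /andP[zc _]; exact: mulC.
rewrite /relA_defect /relB_defect /= ?tzE ?(actZl, actZr, actDl, actDr).
vcoords; clear.
by case: a b c d => [] [] [] [] /=; ring.
Qed.

Lemma null_ext_jordan : relations_hold -> is_jordan_superalgebra (null_ext_mul act).
Proof.
move=> rel; have [[Jl Jr] Jpart JC Jjordan] := jmulP J; split.
- have linl k u w v : right_act act (k *: u + w) v =
      k *: right_act act u v + right_act act w v.
    rewrite /right_act !big_bool /= !linearP /=.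
    by rewrite !(actDr, actZr); vcoords; ring.
  have linr k u w v : right_act act v (k *: u + w) =
      k *: right_act act v u + right_act act v w.
    rewrite /right_act !big_bool /= !linearP /=.
    by rewrite !(actDl, actZl); vcoords; ring.
  split=> -[x u] k [y v] [z w]; congr (_, _).
  + exact: Jl.
  + by rewrite linr actDr actZr; vcoords; ring.
  + exact: Jr.
  + by rewrite linl actDl actZl; vcoords; ring.
- by move=> a b u w; exact: null_ext_mul_part.
- move=> a b u w ua wb; rewrite (null_ext_mul_hom ua wb) (null_ext_mul_hom wb ua).
  move: ua wb; rewrite !mem_dsum_part => /andP[u1 u2] /andP[w1 w2].
  congr (_, _) => /=; first exact: JC.
  by vcoords; case: a b {u1 u2 w1 w2} => [] []; ring.
move=> a b c d x y z t xa yb zc td.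
have := null_ext_jordan_defect xa yb zc td; rewrite /=.
move: xa yb zc td; rewrite !mem_dsum_part => /andP[xa _] /andP[yb _] /andP[zc _] /andP[td _].
rewrite (rel _ _ _ _ _ _ xa yb zc _).1 (rel _ _ _ _ _ _ xa td zc _).1.
rewrite (rel _ _ _ _ _ _ yb td zc _).1 (rel _ _ _ _ _ _ xa yb td _).2.
rewrite !scaler0 !addr0 => e; congr (_, _) => //; exact: Jjordan.
Qed.

End Action.

Lemma bimodule_relations (M : bimodule J) : relations_hold (@bact K J M).
Proof.
have [lin prt] := (bact_linear M, @bact_part K J M).
have [_ _ _ jac] := bact_jordan M.
move=> a b c x y z xa yb zc v.
have J0 i u : u \in part J i -> (u, 0) \in part (dsum J M) i.
  by move=> ui; rewrite mem_dsum_part ui mem0v.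
have M0 i u : u \in part M i -> (0, u) \in part (dsum J M) i.
  by move=> ui; rewrite mem_dsum_part ui mem0v.
(* The Jordan identity speaks of homogeneous elements only, the relations of all v; additivity in v
   bridges the gap. *)
suff hom d w : w \in part M d ->
    relA_defect (@bact K J M) a b c x y z w = 0 /\
    relB_defect (@bact K J M) a b c x y z w = 0.
  rewrite -[v]hcompD (relA_defectD lin) (relB_defectD lin).
  have [-> ->] := hom _ _ (hcompP false v).
  by have [-> ->] := hom _ _ (hcompP true v); rewrite !addr0.
move=> wd; split.
  (* With a single nonzero module component only one of the four defects survives: the first here,
     the last when w is put into the third slot. *)
  have := null_ext_jordan_defect lin prt (J0 _ _ xa) (J0 _ _ yb) (J0 _ _ zc) (M0 _ _ wd).
  cbv zeta; rewrite (jac _ _ _ _ _ _ _ _ (J0 _ _ xa) (J0 _ _ yb) (J0 _ _ zc) (M0 _ _ wd)).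
  rewrite [X in _ = X + _]/= [LHS]/= [X in _ + X]/=.
  rewrite !(relA_defect0 lin, relB_defect0 lin, scaler0, addr0) => /eqP.
  by rewrite -subr_eq0 opprD addNKr oppr_eq0 => /eqP.
have := null_ext_jordan_defect lin prt (J0 _ _ xa) (J0 _ _ yb) (M0 _ _ wd) (J0 _ _ zc).
cbv zeta; rewrite (jac _ _ _ _ _ _ _ _ (J0 _ _ xa) (J0 _ _ yb) (M0 _ _ wd) (J0 _ _ zc)).
rewrite [X in _ = X + _]/= [LHS]/= [X in _ + X]/=.
rewrite !(relA_defect0 lin, relB_defect0 lin, scaler0, addr0, add0r) => /eqP.
by rewrite -subr_eq0 opprD addNKr oppr_eq0 scaler_eq0 signr_eq0 => /eqP.
Qed.

End BimoduleRelations.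

(** * The doubled basis of JP(2) *)

Section JordanMul.
Context (K : fieldType) (J : jordan_superalgebra K).
Implicit Types x y z : J.

Lemma jmulDl x y z : jmul (x + y) z = jmul x z + jmul y z.
Proof. by have [[_ l] _ _ _] := jmulP J; have := l z 1 x y; rewrite /= !scale1r. Qed.

Lemma jmulDr x y z : jmul x (y + z) = jmul x y + jmul x z.
Proof. by have [[l _] _ _ _] := jmulP J; have := l x 1 y z; rewrite !scale1r. Qed.

Lemma jmul0l x : jmul 0 x = 0.
Proof. by apply: (addrI (jmul 0 x)); rewrite -jmulDl !addr0. Qed.

Lemma jmul0r x : jmul x 0 = 0.
Proof. by apply: (addrI (jmul x 0)); rewrite -jmulDr !addr0. Qed.

Lemma jmulZl k x y : jmul (k *: x) y = k *: jmul x y.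
Proof.
have [[_ l] _ _ _] := jmulP J.
by have := l y k x 0; rewrite /= jmul0l !addr0.
Qed.

Lemma jmulZr k x y : jmul x (k *: y) = k *: jmul x y.
Proof.
have [[l _] _ _ _] := jmulP J.
by have := l x k y 0; rewrite jmul0r !addr0.
Qed.

Lemma jmul_suml (I : Type) (r : seq I) (P : pred I) (F : I -> J) x :
  jmul (\sum_(i <- r | P i) F i) x = \sum_(i <- r | P i) jmul (F i) x.
Proof.
by elim/big_rec2: _ => [|i y z _ <-]; rewrite ?jmul0l ?jmulDl.
Qed.

Lemma jmul_sumr (I : Type) (r : seq I) (P : pred I) (F : I -> J) x :
  jmul x (\sum_(i <- r | P i) F i) = \sum_(i <- r | P i) jmul x (F i).
Proof.
by elim/big_rec2: _ => [|i y z _ <-]; rewrite ?jmul0r ?jmulDr.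
Qed.

End JordanMul.

Section JPBasis.
Context (K : numFieldType).
Local Notation J := (JP K 2).
Implicit Types (x y : J) (f g : nat -> K).

Lemma two_neq0 : (2 : K) != 0. Proof. by rewrite pnatr_eq0. Qed.

Definition mat2 (a b c d : K) : 'M[K]_2 :=
  \matrix_(i, j) if i == 0 then (if j == 0 then a else b) else (if j == 0 then c else d).

Lemma mat2E (A : 'M[K]_2) : A = mat2 (A 0 0) (A 0 1) (A 1 0) (A 1 1).
Proof.
apply/matrixP => i j; rewrite mxE.
have [-> | ->] : i = 0 \/ i = 1 by case: i => -[|[|//]] ?; [left|right]; apply: val_inj.
  by have [-> | ->] : j = 0 \/ j = 1 by case: j => -[|[|//]] ?; [left|right]; apply: val_inj.
by have [-> | ->] : j = 0 \/ j = 1 by case: j => -[|[|//]] ?; [left|right]; apply: val_inj.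
Qed.

Lemma mat2_tr a b c d : (mat2 a b c d)^T = mat2 a c b d.
Proof. by rewrite [LHS]mat2E !mxE. Qed.

Lemma mat2D a b c d a' b' c' d' :
  mat2 a b c d + mat2 a' b' c' d' = mat2 (a + a') (b + b') (c + c') (d + d').
Proof. by rewrite [LHS]mat2E !mxE. Qed.

Lemma mat2N a b c d : - mat2 a b c d = mat2 (- a) (- b) (- c) (- d).
Proof. by rewrite [LHS]mat2E !mxE. Qed.

Lemma mat2Z k a b c d : k *: mat2 a b c d = mat2 (k * a) (k * b) (k * c) (k * d).
Proof. by rewrite [LHS]mat2E !mxE. Qed.

Lemma mat2M a b c d a' b' c' d' : mat2 a b c d *m mat2 a' b' c' d' =
  mat2 (a * a' + b * c') (a * b' + b * d') (c * a' + d * c') (c * b' + d * d').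
Proof. by rewrite [LHS]mat2E !mxE !big_ord_recl !big_ord0 !mxE /= !addr0. Qed.

Definition jp_mx f : 'M[K]_(2 + 2) :=
  block_mx (mat2 (f 0%N) (f 2%N) (f 1%N) (f 7%N)) (mat2 (f 5%N) (f 4%N) (f 4%N) (f 3%N))
           (mat2 0 (f 6%N) (- f 6%N) 0) (mat2 (f 0%N) (f 1%N) (f 2%N) (f 7%N)).

Lemma jp_mx_JP f : jp_mx f \in JP_space K 2.
Proof.
rewrite mem_JP_space !(block_mxKul, block_mxKur, block_mxKdl, block_mxKdr).
by rewrite !mat2_tr mat2N opprK oppr0 !eqxx.
Qed.

Definition jp_of f : J := vsproj (JP_space K 2) (jp_mx f).

Lemma jp_ofE f : vsval (jp_of f : JP_type K 2) = jp_mx f.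
Proof. by rewrite vsprojK ?jp_mx_JP. Qed.

Definition jp_coord (k : nat) x : K^o :=
  let X := vsval (x : JP_type K 2) : 'M[K]_(2 + 2) in
  match k with
  | 0 => ulsubmx X 0 0 | 1 => ulsubmx X 1 0 | 2 => ulsubmx X 0 1
  | 3 => ursubmx X 1 1 | 4 => ursubmx X 0 1 | 5 => ursubmx X 0 0
  | 6 => dlsubmx X 0 1 | 7 => ulsubmx X 1 1
  | _ => 0
  end.

Lemma jp_of_coord x : jp_of (jp_coord^~ x) = x.
Proof.
apply: val_inj; rewrite /= jp_ofE; have := subvsP (x : JP_type K 2).
rewrite mem_JP_space => /and3P[/eqP tA /eqP tB /eqP tC].
rewrite -[RHS]submxK tA /jp_mx /jp_coord.
move: (ulsubmx _) (ursubmx _) (dlsubmx _) tB tC => A B C tB tC.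
have eB : B 1 0 = B 0 1 by have := congr1 (fun X : 'M_2 => X 0 1) tB; rewrite mxE.
have eC : C 1 0 = - C 0 1.
  by have := congr1 (fun X : 'M_2 => X 0 1) tC; rewrite !mxE.
have C0 a : C a a = 0.
  have h : C a a = - C a a.
    by have := congr1 (fun X : 'M_2 => X a a) tC; rewrite !mxE.
  have /eqP : 2 * C a a = 0 by rewrite mulr_natl mulr2n {1}h addNr.
  by rewrite mulf_eq0 (negPf two_neq0) => /eqP.
rewrite [in RHS](mat2E A) [in RHS](mat2E B) [in RHS](mat2E C) mat2_tr.
by rewrite !C0 eB eC.
Qed.

Lemma jp_coord_of f k : (k < 8)%N -> jp_coord k (jp_of f) = f k.
Proof.
rewrite /jp_coord jp_ofE !(block_mxKul, block_mxKur, block_mxKdl, block_mxKdr).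
by do 8?[case: k => [|k]; first by rewrite mxE].
Qed.

Definition const_coef (i j k : nat) : K :=
  \sum_(t <- jp_const i j | t.2 == k) ZtoK K t.1.

(** Here f and g are coordinates in the basis before doubling, while the constants refer to the
    doubled one, whence the factor 2 / 4. *)
Lemma jp_of_mul f g : jmul (jp_of f) (jp_of g) =
  jp_of (fun k => 2^-1 * \sum_(i <- iota 0 8) \sum_(j <- iota 0 8) f i * g j * const_coef i j k).
Proof.
apply: val_inj; rewrite /= JP_mulE !jp_ofE mx_jmulE /=.
rewrite !(block_mxKul, block_mxKur, block_mxKdl, block_mxKdr).
rewrite !(mat2M, mat2D, mat2N) scale_block_mx !mat2Z /jp_mx.
have z1 : ZtoK K (Zpos xH) = 1 by [].
have z1' : ZtoK K (Zneg xH) = - 1 by [].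
have z2 : ZtoK K (Zpos 2) = 2 by [].
rewrite /const_coef unlock /= z1 z1' z2.
by congr block_mx; congr mat2; ring.
Qed.

Lemma jp_coord_linear k : linear (jp_coord k).
Proof.
move=> c x y; rewrite /jp_coord linearP /=.
do 8?[case: k => [|k]; first by rewrite !mxE]; by rewrite scaler0 addr0.
Qed.

HB.instance Definition _ k :=
  GRing.isLinear.Build K J K^o *:%R (jp_coord k) (jp_coord_linear k).

Lemma jp_coord_ext x y :
  (forall k, (k < 8)%N -> jp_coord k x = jp_coord k y) -> x = y.
Proof.
move=> e; rewrite -[x]jp_of_coord -[y]jp_of_coord; apply: val_inj.
by rewrite /= !jp_ofE /jp_mx !e.
Qed.

Definition jp_basis (i : nat) : J := jp_of (fun k => if k == i then 2 else 0).

Lemma jp_coord_basis k i : (k < 8)%N ->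
  jp_coord k (jp_basis i) = if k == i then 2 else 0.
Proof. exact: jp_coord_of. Qed.

Lemma jp_basis_ge8 i : (8 <= i)%N -> jp_basis i = 0.
Proof.
move=> i8; apply: jp_coord_ext => k k8; rewrite jp_coord_basis // linear0.
by case: eqP => // ki; move: k8; rewrite ki ltnNge i8.
Qed.

Lemma jp_expand x : x = \sum_(k <- iota 0 8) (jp_coord k x / 2) *: jp_basis k.
Proof.
apply: jp_coord_ext => k k8; have k_in : k \in iota 0 8 by rewrite mem_iota.
rewrite linear_sum (bigD1_seq k k_in (iota_uniq 0 8)) /=.
rewrite linearZ /= jp_coord_basis // eqxx /GRing.scale /= divfK ?two_neq0 //.
rewrite big1 ?addr0 // => i ik; rewrite linearZ /= jp_coord_basis //.
by rewrite eq_sym (negPf ik) /GRing.scale /= mulr0.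
Qed.

Definition lc_val (u : seq (Z * nat)) : J :=
  \sum_(t <- u) ZtoK K t.1 *: jp_basis t.2.

Lemma jp_basis_mul i j : jmul (jp_basis i) (jp_basis j) = lc_val (jp_const i j).
Proof.
have nth_ge (T : Type) (d : T) s n : size s = 8 -> (8 <= n)%N -> nth d s n = d.
  by move=> sz n8; rewrite nth_default // sz.
case: (ltnP i 8) => i8; last first.
  by rewrite (jp_basis_ge8 i8) jmul0l /lc_val /jp_const (nth_ge _ _ _ _ _ i8) // nth_nil big_nil.
case: (ltnP j 8) => j8; last first.
  rewrite (jp_basis_ge8 j8) jmul0r /lc_val /jp_const nth_default ?big_nil //.
  by apply: leq_trans j8; do 8?[case: i i8 => [|i] //= i8].
rewrite /jp_basis jp_of_mul; apply: jp_coord_ext => k k8.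
have sum_delta n (F : nat -> K) : (n < 8)%N ->
    \sum_(m <- iota 0 8) (if m == n then F m else 0) = F n.
  move=> n8; have n_in : n \in iota 0 8 by rewrite mem_iota.
  rewrite (bigD1_seq n n_in (iota_uniq 0 8)) /= eqxx big1 ?addr0 // => m mn.
  by rewrite (negPf mn).
rewrite jp_coord_of // (eq_bigr (fun m => if m == i then
    \sum_(n <- iota 0 8) (if n == j then 4 * const_coef m n k else 0) else 0)); last first.
  move=> m _; case: eqP => _; last by apply: big1 => n _; rewrite !mul0r.
  by apply: eq_bigr => n _; case: eqP => _; rewrite ?mulr0 ?mul0r // -natrM.
rewrite !sum_delta // mulrA (_ : 2^-1 * 4 = 2); last first.
  by rewrite -[4]/(2 * 2)%N%:R natrM mulKf ?two_neq0.
rewrite /const_coef mulr_sumr big_mkcond /= linear_sum /=.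
apply: eq_bigr => t _; rewrite linearZ /= jp_coord_basis // eq_sym.
by case: eqP => _; rewrite /GRing.scale /= ?mulr0 // mulrC.
Qed.

End JPBasis.

Section JPRelations.
Context (K : numFieldType).
Local Notation J := (JP K 2).

Lemma jp_basis_part i : jp_basis K i \in part J (jp_parity i).
Proof.
case: (ltnP i 8) => i8; last by rewrite jp_basis_ge8 // mem0v.
rewrite mem_JP_part jp_ofE /jp_mx /mx_part !(block_mxKul, block_mxKur, block_mxKdl, block_mxKdr).
have z : mat2 0 0 0 0 = 0 :> 'M[K]_2 by rewrite [RHS]mat2E !mxE.
by do 8?[case: i i8 => [|i] i8 /=; first by rewrite ?oppr0 !z block_mx0].
Qed.

Lemma jp_parityP x b : x \in part J b ->
  x = \sum_(k <- iota 0 8 | jp_parity k == b) (jp_coord k x / 2) *: jp_basis K k.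
Proof.
move=> xb; rewrite -[LHS](hcomp_id xb) [in LHS](jp_expand x) linear_sum /= [RHS]big_mkcond.
apply: eq_bigr => k _; rewrite linearZ /=; case: eqP => [<-|/eqP nb].
  by congr (_ *: _); exact: hcomp_id (jp_basis_part k).
have := hcomp_other (jp_basis_part k); rewrite (neq_negb nb) negbK => ->.
by rewrite scaler0.
Qed.

Lemma jp_one : is_identity (2^-1 *: (jp_basis K 0 + jp_basis K 7) : J).
Proof.
have [_ _ JC _] := jmulP J; set u := 2^-1 *: _.
have u0 : u \in part J false.
  by rewrite memvZ // memvD // (jp_basis_part 0, jp_basis_part 7).
have ux x : jmul u x = x.
  rewrite [in LHS](jp_expand x) [RHS](jp_expand x) jmul_sumr.
  apply: eq_big_seq => k; rewrite mem_iota jmulZr => /andP[_ k8]; congr (_ *: _).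
  rewrite jmulZl jmulDl !jp_basis_mul /lc_val unlock.
  have z1 : ZtoK K (Zpos xH) = 1 by [].
  have z2 : ZtoK K (Zpos 2) = 2 by [].
  by do 8?[case: k k8 => [|k] k8 /=; first by rewrite ?z1 ?z2; vcoords; field].
move=> x; split; first exact: ux.
rewrite -[x]hcompD jmulDl; have h b : jmul (hcomp J b x) u = hcomp J b x.
  by rewrite (JC _ _ _ _ (hcompP b x) u0) muln0 scale1r ux.
by rewrite !h.
Qed.

Section Action.
Context (M : superspace K) (act : J -> M -> M) (op : nat -> {linear M -> M}).
Hypothesis act_lin : (forall x, linear (act x)) /\ (forall v, linear (act^~ v)).
Hypothesis opE : forall i v, (i < 8)%N -> op i v = act (jp_basis K i) v.

Definition lc_bound (u : seq (Z * nat)) : bool := all (fun t => t.2 < 8)%N u.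

Lemma jp_const_bound i j : lc_bound (jp_const i j).
Proof.
rewrite /jp_const; case: (ltnP i 8) => [i8|i8]; last first.
  by rewrite [nth _ _ i]nth_default ?nth_nil.
case: (ltnP j 8) => [j8|j8]; first by
  do 8?[case: i i8 => [|i] i8 //=; first by do 8?[case: j j8 => [|j] j8 //=]].
by do 8?[case: i i8 => [|i] i8 //=; first by rewrite nth_default].
Qed.

Lemma lc_mul_bound u w : lc_bound (lc_mul u w).
Proof.
apply/allP => t /flattenP[r1 /mapP[s _ ->]] /flattenP[r2 /mapP[q _ ->]] /mapP[r].
by move/(allP (jp_const_bound _ _)) => r8 ->.
Qed.

Lemma act_lc_val u v : act (lc_val K u) v =
  \sum_(t <- u) ZtoK K t.1 *: act (jp_basis K t.2) v.
Proof.
elim: u => [|t u IH]; first by rewrite /lc_val !big_nil (actl0 act_lin).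
by rewrite /lc_val !big_cons (actDl act_lin) (actZl act_lin) -IH.
Qed.

Lemma peval_lc_poly c v u w x : lc_bound u ->
  peval op (lc_poly c v u w) x =
    ZtoK K c *: weval op v (act (lc_val K u) (weval op w x)).
Proof.
rewrite act_lc_val; elim: u => [|[d i] u IH].
  by rewrite peval_nil big_nil linear0 scaler0.
rewrite /= => /andP[i8 /IH e]; rewrite peval_cons e big_cons linearD scalerDr /=.
congr (_ + _); rewrite weval_cat ZtoKM -scalerA /= opE //.
by rewrite [weval op v (_ *: _)]linearZ.
Qed.

Lemma lc_val_mul u w : jmul (lc_val K u) (lc_val K w) = lc_val K (lc_mul u w).
Proof.
rewrite /lc_mul {1}/lc_val jmul_suml [RHS]/lc_val big_flatten big_map.
apply: eq_bigr => s _; rewrite big_flatten big_map jmulZl /lc_val jmul_sumr scaler_sumr.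
apply: eq_bigr => t _; rewrite big_map jmulZr jp_basis_mul /lc_val !scaler_sumr.
by apply: eq_bigr => r _; rewrite /= !ZtoKM !scalerA.
Qed.

Lemma lc_val1 i : lc_val K [:: (Zpos xH, i)] = jp_basis K i.
Proof. by rewrite /lc_val big_cons big_nil scale1r addr0. Qed.

Lemma ZtoK_sign b : ZtoK K (Zsign b) = (-1) ^+ b.
Proof. by case: b. Qed.

Lemma peval_relA i j k v : (i < 8)%N -> (j < 8)%N -> (k < 8)%N ->
  peval op (jp_relA i j k) v =
  relA_defect act (jp_parity i) (jp_parity j) (jp_parity k)
    (jp_basis K i) (jp_basis K j) (jp_basis K k) v.
Proof.
move=> i8 j8 k8; rewrite /jp_relA i8 j8 k8 /= peval_pnorm !(peval_cat, peval_cons).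
rewrite !peval_lc_poly ?jp_const_bound ?lc_mul_bound //.
rewrite /relA_defect -(lc_val1 k) -?lc_val_mul !lc_val1 -!jp_basis_mul !ZtoK_sign /= !opE //.
rewrite -[ZtoK K (Zpos xH)]/1 -[ZtoK K (Zneg xH)]/(-1).
(* Without this, comparing the atoms unfolds the product of matrices. *)
repeat match goal with |- context [act ?x ?u] => generalize (act x u); intro end.
vcoords; move: (jp_parity i) (jp_parity j) (jp_parity k); clear.
by do 3!case; rewrite /=; ring.
Qed.

Lemma peval_relB i j k v : (i < 8)%N -> (j < 8)%N -> (k < 8)%N ->
  peval op (jp_relB i j k) v =
  relB_defect act (jp_parity i) (jp_parity j) (jp_parity k)
    (jp_basis K i) (jp_basis K j) (jp_basis K k) v.
Proof.
move=> i8 j8 k8; rewrite /jp_relB i8 j8 k8 /= peval_pnorm !peval_cat.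
rewrite !peval_lc_poly ?jp_const_bound //.
rewrite /relB_defect -!jp_basis_mul !ZtoK_sign /= !opE //.
rewrite -[ZtoK K (Zpos xH)]/1 -[ZtoK K (Zneg xH)]/(-1).
(* Without this, comparing the atoms unfolds the product of matrices. *)
repeat match goal with |- context [act ?x ?u] => generalize (act x u); intro end.
vcoords; move: (jp_parity i) (jp_parity j) (jp_parity k); clear.
by do 3!case; rewrite /=; ring.
Qed.

End Action.

End JPRelations.

(** * Unital bimodules *)

HB.instance Definition _ (K : numFieldType) (J : jordan_superalgebra K)
    (M : bimodule J) (x : J) :=
  GRing.isLinear.Build K M M *:%R (@bact K J M x) ((bact_linear M).1 x).

Section UnitalBimodules.
Context (K : numFieldType).
Local Notation J := (JP K 2).

Section OneBimodule.
Context (M : bimodule J).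

Definition bop (i : nat) : 'End(M) := linfun (bact (jp_basis K i)).

Lemma bopE i v : bop i v = bact (jp_basis K i) v.
Proof. exact: lfunE. Qed.

Definition Va : {vspace M} := (lker (bop 0 - 2 *: \1%VF) :&: lker (bop 2))%VS.
Definition Vb : {vspace M} := (lker (bop 0 - 2 *: \1%VF) :&: lker (bop 1))%VS.

Definition Vend (k : nat) : {vspace M} := if (k < 8)%N then Va else Vb.

Lemma mem_Va v : (v \in Va) = (bop 0 v == 2 *: v) && (bop 2 v == 0).
Proof.
by rewrite memv_cap !memv_ker !lfun_simp subr_eq0.
Qed.

Lemma mem_Vb v : (v \in Vb) = (bop 0 v == 2 *: v) && (bop 1 v == 0).
Proof.
by rewrite memv_cap !memv_ker !lfun_simp subr_eq0.
Qed.

(** The projections fix Va and Vb, so a statement about all v in Va becomes an identity between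
    words ending in the letter 8, and likewise for Vb and 9. *)
Definition mop (i : nat) : 'End(M) :=
  if (i < 8)%N then bop i else if i == 8%N then projv Va else projv Vb.

Local Notation mopL := (fun i => mop i : {linear M -> M}).

Definition wop (k : nat) : M -> M := weval mopL (basis_word k).

HB.instance Definition _ k := GRing.Linear.on (wop k).

Definition zop : 'End(M) := 2^-1 *: (bop 6 \o bop 6)%VF.
Definition nop : 'End(M) := 4^-1 *: (bop 2 \o bop 5 \o bop 6)%VF.

Lemma zopE v : zop v = 2^-1 *: bop 6 (bop 6 v).
Proof. by rewrite scale_lfunE comp_lfunE. Qed.

Lemma nopE v : nop v = 4^-1 *: bop 2 (bop 5 (bop 6 v)).
Proof. by rewrite scale_lfunE !comp_lfunE. Qed.

Definition sop (s : nat) : 'End(M) :=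
  match s with 0 => \1%VF | 1 => zop | _ => nop end.

(** The k-th coordinate of v, a vector of Va or Vb, with respect to the sixteen words. *)
Definition dop (k : nat) (v : M) : M :=
  64^-1 *: peval mopL (end_poly k) (peval mopL (dual_poly k) v).

Lemma mop_end k v : v \in Vend k -> mop (basis_end k) v = v.
Proof.
by rewrite /basis_end /Vend /mop; case: (k < 8)%N => /= vV; rewrite projv_id.
Qed.

Hypothesis unitM : unital M.

Lemma bop7 v : bop 7 v = 2 *: v - bop 0 v.
Proof.
have [e e_id e1] := unitM; have eE : e = 2^-1 *: (jp_basis K 0 + jp_basis K 7).
  by rewrite -[RHS](e_id _).1 (jp_one e).2.
have := e1 v; rewrite eE (actZl (bact_linear M)) (actDl (bact_linear M)) -!bopE.
move/(congr1 (fun u => 2 *: u)); rewrite scalerA divff ?two_neq0 // scale1r => <-.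
by rewrite addrAC subrr add0r.
Qed.

(** The relations come from the Jordan identity on the null extension; the starting rules come from
    unitality and from the equations of Va and Vb. *)
Lemma rules_hold : all_hold mopL jp_rules.
Proof.
have rel := @bimodule_relations K J M; have lin := bact_linear M.
have opE i v : (i < 8)%N -> mopL i v = bact (jp_basis K i) v.
  by rewrite /mop => ->; exact: bopE.
rewrite /jp_rules; apply: all_hold_foldl => [i j k v|i j k v|].
- case: (boolP [&& i < 8, j < 8 & k < 8]%N) => [/and3P[i8 j8 k8]|/negPf h].
    rewrite (peval_relA lin opE) //.
    exact: (rel _ _ _ _ _ _ (jp_basis_part K i) (jp_basis_part K j) (jp_basis_part K k) v).1.
  by rewrite /jp_relA h peval_nil.
- case: (boolP [&& i < 8, j < 8 & k < 8]%N) => [/and3P[i8 j8 k8]|/negPf h].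
    rewrite (peval_relB lin opE) //.
    exact: (rel _ _ _ _ _ _ (jp_basis_part K i) (jp_basis_part K j) (jp_basis_part K k) v).2.
  by rewrite /jp_relB h peval_nil.
have va v : projv Va v \in Va by exact: memv_proj.
have vb v : projv Vb v \in Vb by exact: memv_proj.
apply: all_hold_rev; apply: all_hold_cons => [v|].
  rewrite !peval_cons peval_nil addr0 /weval /= /mop /= bop7 scaleN1r addrC.
  by congr (_ + _); rewrite -[ZtoK _ _]/2.
apply: all_hold_cons => [v|].
  by rewrite peval1 /weval /= /mop /=; have:= va v; rewrite mem_Va => /andP[/eqP-> _].
apply: all_hold_cons => [v|].
  by rewrite peval_nil /weval /= /mop /=; have:= va v; rewrite mem_Va => /andP[_ /eqP->].
apply: all_hold_cons => [v|].
  by rewrite peval1 /weval /= /mop /=; have:= vb v; rewrite mem_Vb => /andP[/eqP-> _].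
apply: all_hold_cons => [v|]; last exact: all_hold_nil.
by rewrite peval_nil /weval /= /mop /=; have:= vb v; rewrite mem_Vb => /andP[_ /eqP->].
Qed.

Opaque jp_rules pmul.

Lemma pmul_eq p q p' q' v : pmul jp_rules p q = pmul jp_rules p' q' ->
  peval mopL p (peval mopL q v) = peval mopL p' (peval mopL q' v).
Proof. by move=> e; rewrite -!(peval_pmul _ _ _ rules_hold) e. Qed.

Lemma peval_one v : peval mopL [:: (Zpos xH, [::])] v = v.
Proof. by rewrite peval1 scale1r. Qed.

Lemma peval_end k v : v \in Vend k ->
  peval mopL [:: (Zpos xH, [:: basis_end k])] v = v.
Proof. by move=> vV; rewrite peval1 scale1r /= mop_end. Qed.

Lemma weval_mop w i v : weval mopL (rcons w i) v = weval mopL w (mop i v).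
Proof. by rewrite -cats1 weval_cat. Qed.

Lemma zop_central i v : (i < 8)%N -> bop i (zop v) = zop (bop i v).
Proof.
move=> i8; have := allP central_checkT i; rewrite mem_iota => /(_ i8)/eqP e.
have := pmul_eq v e; rewrite !peval_one !peval1 !scale1r weval_mop.
rewrite /weval /= /mop i8 /= => e'.
by rewrite !zopE linearZ; congr (_ *: _); exact: e'.
Qed.

Lemma zop_Vend k v : v \in Vend k -> zop v \in Vend k.
Proof.
rewrite /Vend; case: (k < 8)%N; rewrite (mem_Va, mem_Vb) => /andP[/eqP e0 /eqP e1];
by rewrite (mem_Va, mem_Vb) !zop_central // e0 e1 linearZ linear0 !eqxx.
Qed.

Lemma pmul_nil p q v : pmul jp_rules p q = [::] ->
  peval mopL p (peval mopL q v) = 0.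
Proof. by move=> e; rewrite -(peval_pmul _ _ _ rules_hold) e peval_nil. Qed.

Lemma pmul2_nil p q v : pmul jp_rules p (pmul jp_rules q [:: (Zpos xH, [::])]) = [::] ->
  peval mopL p (peval mopL q v) = 0.
Proof.
move=> /(pmul_nil v); rewrite (peval_pmul q _ _ rules_hold).
by rewrite peval1 scale1r.
Qed.

Lemma nop_Va v : v \in Vb -> nop v \in Va.
Proof.
move=> vV; have vV9 : v \in Vend 9 by [].
have four0 : (4 : K) != 0 by rewrite pnatr_eq0.
have wE : peval mopL [:: (Zpos xH, rcons beta_word 9%N)] v = 4 *: nop v.
  rewrite peval1 scale1r weval_mop (mop_end vV9) nopE /weval /= /mop /=.
  by rewrite scalerA divff ?scale1r.
have /and5P[_ _ _ _ /andP[/eqP e0 /eqP e2]] := end_checkT.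
have {e0} := pmul_nil v e0; have {e2} := pmul_nil v e2.
rewrite wE peval1 !peval_cons peval_nil addr0 scale1r /weval /= /mop /= !linearZ /=.
move/eqP; rewrite scaler_eq0 (negPf four0) /= => e2 e0.
rewrite mem_Va e2 andbT -subr_eq0; apply/eqP/(scalerI four0).
rewrite scaler0 scalerBr -[RHS]e0; congr (_ + _); first by rewrite scale1r.
by rewrite -[ZtoK K (Zneg 2)]/(-2) scaleNr scalerN.
Qed.

Lemma end_eq w : peval mopL [:: (Zpos xH, [:: 0%N]); (Zneg 2, [::])] w = 0 ->
  bop 0 w = 2 *: w.
Proof.
rewrite peval_cons peval1 scale1r /weval /= -[ZtoK K (Zneg 2)]/(-2) scaleNr.
exact: subr0_eq.
Qed.

Lemma end_poly_Vend k v : peval mopL (end_poly k) v \in Vend k.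
Proof.
have /and5P[/eqP ea /eqP eb /eqP ex /eqP ey _] := end_checkT.
have {ea} := end_eq (pmul2_nil v ea); have {eb} := end_eq (pmul2_nil v eb).
have {ex} := pmul2_nil v ex; have {ey} := pmul2_nil v ey.
have -> : end_poly k = end_poly (if (k < 8)%N then 0 else 8)%N.
  by rewrite /end_poly; case: (k < 8)%N.
have p1 i w : peval mopL [:: (Zpos xH, [:: i])] w = 0 -> mop i w = 0.
  by rewrite peval1 scale1r.
move=> /p1 ey /p1 ex eb ea.
rewrite /Vend; case: (k < 8)%N; rewrite (mem_Va, mem_Vb).
  by rewrite ea -[bop 2 _]/(mop 2 _) ex !eqxx.
by rewrite eb -[bop 1 _]/(mop 1 _) ey !eqxx.
Qed.

Lemma dop_Vend k v : dop k v \in Vend k.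
Proof. by rewrite memvZ ?end_poly_Vend. Qed.

Lemma nop_zop v : nop (zop v) = zop (nop v).
Proof. by rewrite !nopE linearZ /= -!zop_central. Qed.

Lemma sop_Vend s k j v : (s == 2)%N && (k < 8 <= j)%N || (s < 2)%N && ((k < 8) == (j < 8))%N ->
  v \in Vend j -> sop s v \in Vend k.
Proof.
case: s => [|[|s]] /=; rewrite /Vend.
- by move/eqP->; rewrite id_lfunE.
- by move/eqP->; exact: zop_Vend.
by rewrite orbF => /and3P[_ ->]; rewrite leqNgt => /negPf ->; exact: nop_Va.
Qed.

(** Freeness of the words over Va and Vb; [wop_dop] is the spanning half. *)
Lemma dop_wop k j v : (k < 16)%N -> (j < 16)%N -> v \in Vend j ->
  dop k (wop j v) = if j == k then v else 0.
Proof.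
move=> k16 j16 vV; have := allP dual_checkT k; rewrite mem_iota => /(_ k16) /allP/(_ j).
rewrite mem_iota => /(_ j16)/eqP e.
rewrite /dop /wop; have := congr1 (fun p => peval mopL p v) e; move=> {e}.
rewrite /= !(peval_pmul _ _ _ rules_hold) !peval1 scale1r weval_mop mop_end // => ->.
case: eqP => [jk|_]; last by rewrite peval_nil scaler0.
by rewrite -jk peval1 /= mop_end // scalerA mulVf ?scale1r // pnatr_eq0.
Qed.

Lemma wop_dop v : \sum_(k <- iota 0 16) wop k (dop k v) = v.
Proof.
have sumE (r : seq nat) (F : nat -> ncpoly) :
    peval mopL (foldr padd [::] [seq F k | k <- r]) v = \sum_(k <- r) peval mopL (F k) v.
  elim: r => [|k r IH]; first by rewrite big_nil peval_nil.
  by rewrite big_cons -IH -peval_padd.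
have /eqP/(congr1 (fun p => peval mopL p v)) := complete_checkT.
move/(etrans (esym (sumE _ _))) => e.
have n64 : (64 : K) != 0 by rewrite pnatr_eq0.
apply: (scalerI n64); rewrite scaler_sumr.
have -> : 64 *: v = peval mopL [:: (Zpos 64, [::])] v by rewrite peval1.
rewrite -e {e}; apply: eq_bigr => k _.
rewrite !(peval_pmul _ _ _ rules_hold) peval1 scale1r !peval_one.
by rewrite /dop linearZ /= scalerA divff // scale1r.
Qed.

(** Well-typedness of a table entry: 1 and z keep the type of the end, while n leads from a word on
    Vb to a word on Va. *)
Definition act_ok (j : nat) (t : nat * Z * nat * nat) : bool :=
  let: (_, _, k, s) := t in
  [&& k < 16, s < 3 & (s == 2) && (k < 8 <= j) || (s < 2) && ((k < 8) == (j < 8))]%N.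

Lemma act_row_ok i t : t \in act_row i -> act_ok t.1.1.1 t.
Proof.
case: (ltnP i 8) => i8; last by rewrite /act_row nth_default.
move: t; apply/allP.
by do 8?[case: i i8 => [|i] // i8].
Qed.

Lemma peval_act_term j c k s v : (s < 3)%N ->
  peval mopL (act_term [::] (j, c, k, s)) v = 4 *: (ZtoK K c *: wop k (sop s v)).
Proof.
have n4 : (4 : K) != 0 by rewrite pnatr_eq0.
have zE : weval mopL central_word v = 2 *: zop v.
  by rewrite zopE scalerA divff ?two_neq0 // scale1r.
have nE : weval mopL beta_word v = 4 *: nop v.
  by rewrite nopE scalerA divff // scale1r.
case: s => [|[|[|//]]] _; rewrite /act_term peval1 !weval_cat -/(wop k _).
- by rewrite ZtoKM -scalerA /= id_lfunE.
- rewrite ZtoKM zE linearZ /= !scalerA; congr (_ *: _).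
  by rewrite -[ZtoK K (Zpos 2)]/2 mulrAC -natrM.
by rewrite nE linearZ /= !scalerA mulrC.
Qed.

Lemma bop_wop i j v : (i < 8)%N -> (j < 16)%N -> v \in Vend j ->
  bop i (wop j v) =
  \sum_(t <- act_row i | t.1.1.1 == j) ZtoK K t.1.1.2 *: wop t.1.2 (sop t.2 v).
Proof.
move=> i8 j16 vV; have := allP act_checkT i; rewrite mem_iota => /(_ i8) /allP/(_ j).
rewrite mem_iota => /(_ j16)/eqP /(pmul_eq v); rewrite peval_end //.
rewrite peval_pnorm; have -> : psub [:: (Zpos 4, i :: basis_word j)] [::] = [:: (Zpos 4, i :: basis_word j)] by [].
rewrite peval1 /= {1}/mop i8 -/(weval _) -/(wop j v) => e.
have n4 : (4 : K) != 0 by rewrite pnatr_eq0.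
apply: (scalerI n4); rewrite -[4]/(ZtoK K (Zpos 4)) {}e.
rewrite -big_filter scaler_sumr.
have : all (act_ok j) [seq t <- act_row i | t.1.1.1 == j].
  by apply/allP => t; rewrite mem_filter => /andP[/eqP <-]; exact: act_row_ok.
elim: [seq _ <- _ | _] => [|[[[j' c] k] s] r IH]; first by rewrite big_nil peval_nil.
rewrite big_cons => /andP[] /= /and3P[_ s3 _] /IH <-.
rewrite peval_cat; congr (_ + _); exact: peval_act_term.
Qed.

Definition word_parity (k : nat) : bool :=
  foldr (fun i b => jp_parity i (+) b) false (basis_word k).

Lemma bop_part i b v : v \in part M b -> bop i v \in part M (jp_parity i (+) b).
Proof. by rewrite bopE; exact/bact_part/jp_basis_part. Qed.

Lemma weval_part w b v : all (fun i => i < 8)%N w -> v \in part M b ->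
  weval mopL w v \in part M (foldr (fun i c => jp_parity i (+) c) b w).
Proof.
elim: w => [|i w IH] //= /andP[i8 w8] vb; rewrite /mop i8.
exact/bop_part/IH.
Qed.

Lemma foldr_parity w b : foldr (fun i c => jp_parity i (+) c) b w =
  foldr (fun i c => jp_parity i (+) c) false w (+) b.
Proof. by elim: w => //= i w ->; rewrite addbA. Qed.

Lemma basis_word_bound k : all (fun i => i < 8)%N (basis_word k).
Proof. by do 16?[case: k => [|k] //]; rewrite /basis_word nth_default. Qed.

Lemma wop_part k b v : v \in part M b -> wop k v \in part M (word_parity k (+) b).
Proof. by rewrite /word_parity -foldr_parity; exact/weval_part/basis_word_bound. Qed.

Lemma peval_part c b p v :
  all (fun t => all (fun i => i < 8)%N t.2
    && (foldr (fun i d => jp_parity i (+) d) false t.2 == c)) p ->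
  v \in part M b -> peval mopL p v \in part M (c (+) b).
Proof.
move=> /allP h vb; rewrite /peval big_seq; apply: memv_suml => t /h /andP[t8 /eqP <-].
by rewrite memvZ // -foldr_parity weval_part.
Qed.

Lemma dop_part k b v : (k < 16)%N -> v \in part M b ->
  dop k v \in part M (word_parity k (+) b).
Proof.
move=> k16 vb; rewrite memvZ // -[_ (+) _]addFb; apply: peval_part.
  by rewrite /end_poly; case: (k < 8)%N.
by apply: peval_part vb; do 16?[case: k k16 => [|k] // k16].
Qed.

Lemma zop_part b v : v \in part M b -> zop v \in part M b.
Proof.
by move=> vb; rewrite zopE memvZ //; have := bop_part 6 (bop_part 6 vb); rewrite addbA.
Qed.

Lemma nop_part b v : v \in part M b -> nop v \in part M b.
Proof.
move=> vb; rewrite nopE memvZ //.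
by have := bop_part 2 (bop_part 5 (bop_part 6 vb)); rewrite !addbA.
Qed.

End OneBimodule.
End UnitalBimodules.

(** * Extension of homomorphisms, Fitting decomposition *)

Section Homs.
Context (K : numFieldType).
Local Notation J := (JP K 2).

Lemma dop_linear (M : bimodule J) k : linear (@dop K M k).
Proof.
move=> c u v; rewrite /dop (linearP (peval _ (dual_poly k))).
by rewrite (linearP (peval _ (end_poly k))) scalerDr !scalerA mulrC.
Qed.

HB.instance Definition _ (M : bimodule J) k :=
  GRing.isLinear.Build K M M *:%R (@dop K M k) (dop_linear k).

Section Extension.
Context (M N : bimodule J) (uM : unital M) (uN : unital N) (ga gb : 'Hom(M, N)).

Definition gend (k : nat) : 'Hom(M, N) := if (k < 8)%N then ga else gb.

Hypothesis g_Vend : forall k v, v \in Vend M k -> gend k v \in Vend N k.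
Hypothesis g_zop : forall k v, v \in Vend M k -> gend k (zop M v) = zop N (gend k v).
Hypothesis g_nop : forall v, v \in Vb M -> ga (nop M v) = nop N (gb v).
Hypothesis g_part : forall k b v,
  v \in Vend M k -> v \in part M b -> gend k v \in part N b.

(** The only candidate for a homomorphism restricting to [ga] on Va and [gb] on Vb, since
    homomorphisms commute with the words. *)
Definition ext_fun (v : M) : N :=
  \sum_(k <- iota 0 16) wop k (gend k (dop k v)).

Lemma ext_linear : linear ext_fun.
Proof.
move=> c u v; rewrite /ext_fun scaler_sumr -big_split; apply: eq_bigr => k _ /=.
by rewrite (linearP (@dop K M k)) linearP linearP.
Qed.

HB.instance Definition _ := GRing.isLinear.Build K M N *:%R ext_fun ext_linear.

Definition ext : 'Hom(M, N) := linfun ext_fun.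

Lemma extE v : ext v = \sum_(k <- iota 0 16) wop k (gend k (dop k v)).
Proof. exact: lfunE. Qed.

Lemma ext_wop j v : (j < 16)%N -> v \in Vend M j -> ext (wop j v) = wop j (gend j v).
Proof.
move=> j16 vV; rewrite extE.
have j_in : j \in iota 0 16 by rewrite mem_iota.
rewrite (bigD1_seq j j_in (iota_uniq 0 16)) (dop_wop uM j16 j16 vV) eqxx.
rewrite big_seq_cond big1 => [|k /andP[]]; first by rewrite /= addr0.
rewrite mem_iota => /andP[_ k16] kj.
by rewrite (dop_wop uM k16 j16 vV) eq_sym (negPf kj) !linear0.
Qed.

Lemma wop0 (P : bimodule J) (v : P) : wop 0 v = v. Proof. by []. Qed.
Lemma wop8 (P : bimodule J) (v : P) : wop 8 v = v. Proof. by []. Qed.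

Lemma ext_Va v : v \in Va M -> ext v = ga v.
Proof. by move=> vV; rewrite -[v in LHS]wop0 ext_wop. Qed.

Lemma ext_Vb v : v \in Vb M -> ext v = gb v.
Proof. by move=> vV; rewrite -[v in LHS]wop8 ext_wop. Qed.

Lemma gend_sop s k j v :
  (s == 2)%N && (k < 8 <= j)%N || (s < 2)%N && ((k < 8) == (j < 8))%N ->
  v \in Vend M j -> gend k (sop M s v) = sop N s (gend j v).
Proof.
case: s => [|[|s]] /=.
- by move/eqP=> e _; rewrite !id_lfunE /gend e.
- by move/eqP=> e; move: (@g_zop j v); rewrite /gend e.
rewrite orbF => /and3P[_ k8]; rewrite leqNgt => /negPf j8.
by rewrite /Vend /gend j8 k8; exact: g_nop.
Qed.

(** Both bimodules obey the same table, whose entries involve only words, z and n, and the given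
    maps intertwine z and n. *)
Lemma ext_bop i v : (i < 8)%N -> ext (bop M i v) = bop N i (ext v).
Proof.
move=> i8; rewrite -{1}(wop_dop uM v) linear_sum linear_sum.
rewrite [in RHS]extE linear_sum; apply: eq_big_seq => j; rewrite mem_iota => /andP[_ j16].
have dV := dop_Vend uM j v.
rewrite /= (bop_wop uM i8 j16 dV) (bop_wop uN i8 j16 (g_Vend dV)) linear_sum.
rewrite big_seq_cond [RHS]big_seq_cond; apply: eq_bigr => t /andP[/act_row_ok tok /eqP tj].
case: t tok tj => [[[j' c] k] s] /and3P[/= k16 _ ok] e; rewrite e in ok.
by rewrite linearZ /= (ext_wop k16 (sop_Vend uM ok dV)) (gend_sop ok dV).
Qed.

Lemma bact_sum (P : bimodule J) x (v : P) :
  bact x v = \sum_(k <- iota 0 8) (jp_coord k x / 2) *: bop P k v.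
Proof.
have lin := bact_linear P; rewrite [in LHS](jp_expand x).
elim: (iota 0 8) => [|k r IH]; first by rewrite !big_nil (actl0 lin).
by rewrite !big_cons (actDl lin) (actZl lin) -bopE IH.
Qed.

Lemma ext_bact x v : ext (bact x v) = bact x (ext v).
Proof.
rewrite !bact_sum linear_sum; apply: eq_big_seq => k.
by rewrite mem_iota linearZ => /andP[_ k8]; rewrite /= ext_bop.
Qed.

(** Taking the k-th coordinate and applying the k-th word shift the parity by the same amount. *)
Lemma ext_part b v : v \in part M b -> ext v \in part N b.
Proof.
move=> vb; rewrite extE big_seq; apply: memv_suml => k.
rewrite mem_iota => /andP[_ k16].
have := wop_part k (g_part (dop_Vend uM k v) (dop_part k16 vb)).
by rewrite addbA addbb.
Qed.

Lemma ext_hom : ext \in @bimodule_hom_pred K J M N.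
Proof. by apply/asboolP; split=> [b v|x v]; [exact: ext_part|exact: ext_bact]. Qed.

End Extension.

Section HomProperties.
Context (M N : bimodule J) (f : 'Hom(M, N)).
Hypothesis f_hom : f \in @bimodule_hom_pred K J M N.

Lemma hom_bop i v : f (bop M i v) = bop N i (f v).
Proof. by have /asboolP[_ fa] := f_hom; rewrite !bopE fa. Qed.

Lemma hom_zop v : f (zop M v) = zop N (f v).
Proof. by rewrite !zopE linearZ /= !hom_bop. Qed.

Lemma hom_nop v : f (nop M v) = nop N (f v).
Proof. by rewrite !nopE linearZ /= !hom_bop. Qed.

Lemma hom_Vend k v : v \in Vend M k -> f v \in Vend N k.
Proof.
rewrite /Vend; case: (k < 8)%N; rewrite (mem_Va, mem_Vb) => /andP[/eqP e0 /eqP e1];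
by rewrite (mem_Va, mem_Vb) -!hom_bop e0 e1 linearZ linear0 !eqxx.
Qed.

Lemma hom_part b v : v \in part M b -> f v \in part N b.
Proof. by have /asboolP[fp _] := f_hom; exact: fp. Qed.

Lemma hom_wop k v : f (wop k v) = wop k (f v).
Proof.
rewrite /wop; elim: (basis_word k) (basis_word_bound k) => //= i w IH /andP[i8 w8].
by rewrite /mop i8 hom_bop IH.
Qed.

End HomProperties.

Lemma hom_eq (M N : bimodule J) (f g : 'Hom(M, N)) : unital M ->
  f \in @bimodule_hom_pred K J M N -> g \in @bimodule_hom_pred K J M N ->
  {in Va M, f =1 g} -> {in Vb M, f =1 g} -> f = g.
Proof.
move=> uM fh gh ea eb; apply/lfunP => v; rewrite -(wop_dop uM v) !linear_sum.
apply: eq_bigr => k _ /=; rewrite (hom_wop fh) (hom_wop gh); congr (wop k _).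
have := dop_Vend uM k v; rewrite /Vend; case: (k < 8)%N => h; [exact: ea | exact: eb].
Qed.

End Homs.

(** * The Fitting decomposition of an endomorphism and its naturality *)

Section Fitting.
Context (K : fieldType).

Fixpoint lpow (V : vectType K) (f : 'End(V)) (n : nat) : 'End(V) :=
  if n is n'.+1 then (f \o lpow f n')%VF else \1%VF.

Lemma lpowD (V : vectType K) (f : 'End(V)) m n v : lpow f (m + n) v = lpow f m (lpow f n v).
Proof. by elim: m => [|m IH] /=; rewrite ?id_lfunE // !comp_lfunE IH. Qed.

Lemma lpow_comm (V W : vectType K) (f : 'End(V)) (g : 'End(W)) (h : 'Hom(V, W)) :
  (forall v, h (f v) = g (h v)) -> forall n v, h (lpow f n v) = lpow g n (h v).
Proof. by move=> fg; elim=> [|n IH] v /=; rewrite ?id_lfunE // !comp_lfunE fg IH. Qed.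

(** The kernels of the powers form an increasing chain that is constant from the first repetition
    on, and dimension forces a repetition at some exponent at most dim V. *)
Lemma lker_lpow_stable (V : vectType K) (f : 'End(V)) m n v :
  (\dim {:V} < n)%N -> lpow f m v = 0 -> lpow f n v = 0.
Proof.
pose d k := \dim (lker (lpow f k)).
have lkerS k : (lker (lpow f k) <= lker (lpow f k.+1))%VS.
  by apply/subvP => u; rewrite !memv_ker comp_lfunE => /eqP->; rewrite linear0.
have step k : d k = d k.+1 -> forall u i, lpow f (i + k) u = 0 -> lpow f k u = 0.
  move=> e u; have /eqP ek : lker (lpow f k) == lker (lpow f k.+1).
    by rewrite eqEdim lkerS /= -[\dim _]/(d k.+1) -[in X in (_ <= X)%N]/(d k) e leqnn.
  elim=> [|i IH] // h; apply: IH; apply/eqP; move/eqP: h.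
  by rewrite addSnnS addnC lpowD -memv_ker -ek memv_ker -lpowD addnC.
have [k k_le dk] : exists2 k, (k <= \dim {:V})%N & d k = d k.+1.
  have [/existsP[k /eqP dk]|/existsPn nd] :=
      boolP [exists k : 'I_(\dim {:V}).+1, d k == d k.+1].
    by exists k; rewrite // -ltnS.
  (* Without a repetition each of the dim V + 1 steps raises the dimension, which ends above dim
     V. *)
  have ge k : (k <= (\dim {:V}).+1)%N -> (k <= d k)%N.
    elim: k => // k IH k_lt; apply: leq_ltn_trans (IH (ltnW k_lt)) _.
    by rewrite ltn_neqAle (nd (Ordinal k_lt)) dimvS.
  have := ge _ (leqnn _); rewrite leqNgt ltnS dimvS ?subvf //.
move=> n_gt h; have hk : lpow f k v = 0.
  by apply: (step k dk v m); rewrite addnC lpowD h linear0.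
by rewrite -(subnK (leq_trans k_le (ltnW n_gt))) lpowD hk linear0.
Qed.

Section OneEndomorphism.
Context (V : vectType K) (f : 'End(V)).

(** One more than the dimension, to meet the strict bound of [lker_lpow_stable]. *)
Definition fit_exp : nat := (\dim {:V}).+1.
Definition fit_ker : {vspace V} := lker (lpow f fit_exp).
Definition fit_im : {vspace V} := limg (lpow f fit_exp).

Definition fitting : 'End(V) := daddv_pi fit_ker fit_im.

Lemma fit_cap : (fit_ker :&: fit_im = 0)%VS.
Proof.
apply/eqP; rewrite -subv0; apply/subvP => v; rewrite memv_cap memv_ker memv0.
case/andP=> /eqP h /memv_imgP[u _ e]; move: h; rewrite e -lpowD => h.
by apply/eqP; exact: lker_lpow_stable (ltnSn _) h.
Qed.

Lemma fit_add : (fit_ker + fit_im = fullv)%VS.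
Proof.
apply/eqP; rewrite eqEdim subvf /= dimv_disjoint_sum ?fit_cap //.
by rewrite -(limg_ker_dim (lpow f fit_exp) fullv) capfv.
Qed.

Lemma fittingE a b : a \in fit_ker -> b \in fit_im -> fitting (a + b) = a.
Proof.
move=> aK bI; rewrite linearD /= (daddv_pi_id fit_cap aK).
have bK := daddv_pi_add fit_cap (w := b).
have e : daddv_pi fit_im fit_ker b = b.
  by apply: daddv_pi_id => //; rewrite capvC fit_cap.
have := bK; rewrite e fit_add memvf => /(_ isT) /eqP.
by rewrite -subr_eq0 addrK => /eqP->; rewrite addr0.
Qed.

Lemma fitting_decomp v : exists a b, [/\ a \in fit_ker, b \in fit_im & v = a + b].
Proof.
have : v \in (fit_ker + fit_im)%VS by rewrite fit_add memvf.
by case/memv_addP => a aK [b bI ->]; exists a, b.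
Qed.

Lemma fitting_ker v : fitting v \in fit_ker.
Proof. exact: memv_pi. Qed.

Lemma fitting_id v : v \in fit_ker -> fitting v = v.
Proof. by move=> vK; rewrite -[v in LHS]addr0 fittingE ?mem0v. Qed.

Lemma fitting_nilp n v : lpow f n v = 0 -> fitting v = v.
Proof.
by move=> h; apply: fitting_id; rewrite memv_ker (lker_lpow_stable (ltnSn _) h).
Qed.

Lemma fit_im_lpow n v : v \in fit_im -> exists u, v = lpow f n u.
Proof.
have step u : u \in fit_im -> exists2 w, w \in fit_im & u = f w.
  case/memv_imgP=> w _ ->; have [a [b [aK bI ->]]] := fitting_decomp w.
  rewrite linearD /=; move: aK; rewrite memv_ker => /eqP->; rewrite add0r.
  (* One of the dim V + 1 factors f is split off; the rest keeps b in the stable image because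
     powers of f commute. *)
  exists (lpow f (\dim {:V}) b); last by rewrite -comp_lfunE.
  case/memv_imgP: bI => c _ ->; rewrite -lpowD addnC lpowD.
  exact: memv_img (memvf _).
elim: n v => [|n IH] v vI; first by exists v; rewrite id_lfunE.
have [w wI ->] := step v vI; have [u ->] := IH w wI.
by exists u; rewrite /= comp_lfunE.
Qed.

End OneEndomorphism.

(** An intertwiner preserves nilpotent vectors and infinitely divisible ones. These descriptions of
    the two summands do not mention the exponents, which differ between V and W. *)
Lemma fitting_natural (V W : vectType K) (f : 'End(V)) (g : 'End(W)) (h : 'Hom(V, W)) :
  (forall v, h (f v) = g (h v)) -> forall v, h (fitting f v) = fitting g (h v).
Proof.
move=> hf v; have [a [b [aK bI ->]]] := fitting_decomp f v.
rewrite (fittingE aK bI) linearD fittingE //.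
  move: aK; rewrite !memv_ker => /eqP aK; apply/eqP.
  have e : lpow g (fit_exp V) (h a) = 0 by rewrite -(lpow_comm hf) aK linear0.
  exact: lker_lpow_stable (ltnSn _) e.
have [u ->] := fit_im_lpow (fit_exp W) bI.
by rewrite -[_ (lpow f _ u)]/(h (lpow f (fit_exp W) u)) (lpow_comm hf) memv_img ?memvf.
Qed.

End Fitting.

(** * Linear categories *)

Section LinearCategoryTheory.
Context (K : fieldType).
Implicit Types (C D : lincat K).

Section Basics.
Context (C : lincat K).
Implicit Types X Y Z : C.

Lemma compcDl X Y Z (f : hom X Y) (g h : hom Y Z) :
  compc (g + h) f = compc g f + compc h f.
Proof. by have := @comp_linear_left K C X Y Z f 1 g h; rewrite !scale1r. Qed.

Lemma compcDr X Y Z (g : hom Y Z) (f h : hom X Y) :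
  compc g (f + h) = compc g f + compc g h.
Proof. by have := @comp_linear_right K C X Y Z g 1 f h; rewrite !scale1r. Qed.

Lemma comp0c X Y Z (f : hom X Y) : compc (0 : hom Y Z) f = 0.
Proof. by apply: (addrI (compc 0 f)); rewrite -compcDl !addr0. Qed.

Lemma compc0 X Y Z (g : hom Y Z) : compc g (0 : hom X Y) = 0.
Proof. by apply: (addrI (compc g 0)); rewrite -compcDr !addr0. Qed.

Lemma compcNl X Y Z (f : hom X Y) (g : hom Y Z) : compc (- g) f = - compc g f.
Proof. by apply: (addrI (compc g f)); rewrite -compcDl !subrr comp0c. Qed.

Lemma compcNr X Y Z (f : hom X Y) (g : hom Y Z) : compc g (- f) = - compc g f.
Proof. by apply: (addrI (compc g f)); rewrite -compcDr !subrr compc0. Qed.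

Lemma zero_hom_from X Y (f : hom X Y) : zero_object X -> f = 0.
Proof. by move=> z; rewrite -(comp_id_right f) z compc0. Qed.

Lemma isomorphic_sym X Y : isomorphic X Y -> isomorphic Y X.
Proof. by case=> f [g [gf fg]]; exists g, f. Qed.

Lemma zero_object_iso X Y : isomorphic X Y -> zero_object X -> zero_object Y.
Proof.
by case=> f [g [_ fg]] z; rewrite /zero_object -fg (zero_hom_from f z) comp0c.
Qed.

Lemma biproduct_sym Z X Y : is_biproduct Z X Y -> is_biproduct Z Y X.
Proof.
by case=> i [j [p [q [pi qj pj qi e]]]]; exists j, i, q, p; split=> //; rewrite addrC.
Qed.

Lemma biproduct_zero Z X Y : is_biproduct Z X Y -> zero_object Y -> isomorphic Z X.
Proof.
case=> i [j [p [q [pi qj pj qi e]]]] z; exists p, i; split=> //.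
by rewrite -e (zero_hom_from j z) comp0c addr0.
Qed.

Definition retract_of X Z : Prop :=
  exists (i : hom X Z) (p : hom Z X), compc p i = idc X.

Definition summand_closed (S : C -> Prop) : Prop :=
  forall X Z, S Z -> retract_of X Z -> S X.

Lemma biproduct_retractl Z X Y : is_biproduct Z X Y -> retract_of X Z.
Proof. by case=> i [j [p [q [pi _ _ _ _]]]]; exists i, p. Qed.

Lemma biproduct_retractr Z X Y : is_biproduct Z X Y -> retract_of Y Z.
Proof. by move/biproduct_sym/biproduct_retractl. Qed.

Lemma direct_sum_sym (P Q : C -> Prop) : is_direct_sum P Q -> is_direct_sum Q P.
Proof.
case=> rP rQ orth dec; split=> // [X Y QX PY|Z].
  by have [h1 h2] := orth _ _ PY QX; split.
by have [X [Y [PX QY b]]] := dec Z; exists Y, X; split=> //; exact: biproduct_sym.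
Qed.

(** If X is a retract of Z in P, the inclusion into X of its Q-component factors through Z, hence
    vanishes. *)
Lemma direct_sum_summand (P Q : C -> Prop) : is_direct_sum P Q -> summand_closed P.
Proof.
case=> rP rQ orth dec X Z PZ [i [p pi]].
have [X' [Y' [PX' QY' b]]] := dec X; apply: (rP X') => //.
apply/isomorphic_sym/(biproduct_zero b); case: b => i' [j' [p' [q' [_ qj _ _ _]]]].
rewrite /zero_object -qj; have -> : j' = 0; last by rewrite compc0.
rewrite -(comp_id_left j') -pi -compA.
by rewrite ((orth _ _ PZ QY').2 (compc i j')) compc0.
Qed.

Lemma direct_sum_restrict (S P Q : C -> Prop) :
  summand_closed S -> is_direct_sum P Q ->
  @is_direct_sum K (fullsub C S) (fun X : fullsub C S => P (sval X)) (fun X : fullsub C S => Q (sval X)).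
Proof.
move=> cS [rP rQ orth dec]; split=> [X Y [f [g fg]]|X Y [f [g fg]]|X Y|[Z SZ]].
- by apply: rP; exists f, g.
- by apply: rQ; exists f, g.
- exact: orth.
have [X [Y [PX QY b]]] := dec Z.
have SX := cS _ _ SZ (biproduct_retractl b).
have SY := cS _ _ SZ (biproduct_retractr b).
by exists (exist _ X SX : fullsub C S), (exist _ Y SY : fullsub C S).
Qed.

End Basics.

(** * Blocks cut out by idempotent endomorphisms of the identity functor *)

Section NaturalIdempotents.
Context (C : lincat K) (I : Type) (E : I -> forall X : C, hom X X).
Hypothesis E_natural : forall i (X Y : C) (f : hom X Y),
  compc f (E i X) = compc (E i Y) f.
Hypothesis E_idem : forall i X, compc (E i X) (E i X) = E i X.
Hypothesis split_idem : forall (X : C) (e : hom X X), compc e e = e ->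
  exists (Y : C) (i : hom Y X) (p : hom X Y), compc p i = idc Y /\ compc i p = e.

Definition in_block i (X : C) : Prop := E i X = idc X.
Definition off_block i (X : C) : Prop := E i X = 0.

(** Z is the sum of the images of E and 1 - E; by naturality a map between the two kinds of objects
    equals its composite with both the identity and zero. *)
Lemma natural_idem_sum i : is_direct_sum (in_block i) (off_block i).
Proof.
split=> [X Y [f [g [gf fg]]] EX|X Y [f [g [gf fg]]] EX|X Y EX EY|Z].
- by rewrite /in_block -[LHS]comp_id_right -fg compA -E_natural EX comp_id_right.
- by rewrite /off_block -[LHS]comp_id_right -fg compA -E_natural EX compc0 comp0c.
- split=> [f|g].
    by rewrite -[f]comp_id_right -EX E_natural EY comp0c.
  by rewrite -[g]comp_id_left -EX -E_natural EY compc0.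
have [X [a [p [pa ap]]]] := split_idem (E_idem i Z).
have [|Y [b [q [qb bq]]]] := @split_idem Z (idc Z - E i Z).
  rewrite compcDl comp_id_left compcNl compcDr comp_id_right compcNr E_idem.
  by rewrite subrr subr0.
have pE : compc p (E i Z) = p by rewrite -ap compA pa comp_id_left.
have Ea : compc (E i Z) a = a by rewrite -ap -compA pa comp_id_right.
have Eb : compc (E i Z) b = 0.
  have h : compc (idc Z - E i Z) b = b by rewrite -bq -compA qb comp_id_right.
  move: h; rewrite compcDl comp_id_left compcNl => /eqP.
  by rewrite -subr_eq0 addrC addrA addNr add0r oppr_eq0 => /eqP.
have qE : compc q (E i Z) = 0.
  have h : compc q (idc Z - E i Z) = q by rewrite -bq compA qb comp_id_left.
  move: h; rewrite compcDr comp_id_right compcNr => /eqP.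
  by rewrite -subr_eq0 addrC addrA addNr add0r oppr_eq0 => /eqP.
exists X, Y; split.
- by rewrite /in_block -[LHS]comp_id_left -pa -compA E_natural Ea.
- by rewrite /off_block -[LHS]comp_id_left -qb -compA E_natural Eb compc0.
exists a, b, p, q; split=> //.
- by rewrite -pE -compA Eb compc0.
- by rewrite -Ea compA qE comp0c.
by rewrite ap bq addrC subrK.
Qed.

Hypothesis E_nonzero : forall X, ~ zero_object X -> exists i, E i X <> 0.
Hypothesis indec : forall i, indecomposable (fullsub C (in_block i)).

Lemma in_block_block i : block C (in_block i).
Proof. by split; [exists (off_block i); exact: natural_idem_sum|exact: indec]. Qed.

(** Two indecomposable summands with a common nonzero object coincide, because the decomposition
    belonging to one cuts the other trivially. The common object X1 is the component in summand i of
    an object of B on which the i-th idempotent is not 0. *)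
Lemma block_in_block (B : C -> Prop) : block C B ->
  exists i, forall X, B X <-> in_block i X.
Proof.
case=> [[Q BQ]] [[[X0 BX0] X0nz] Bindec]; have [rB rQ _ dec] := BQ.
have [i EX0] := E_nonzero X0nz; exists i.
have dsi := natural_idem_sum i; have [rI rO _ deci] := dsi.
have clB := direct_sum_summand BQ; have clI := direct_sum_summand dsi.
have [X1 [Y1 [IX1 OY1 b1]]] := deci X0.
have X1nz : ~ zero_object X1.
  move=> z; apply: EX0; case: b1 => a [b [p [q [_ _ _ _ e]]]].
  rewrite -[E i X0]comp_id_right -e (zero_hom_from a z) comp0c add0r compA -E_natural.
  by rewrite OY1 compc0 comp0c.
have BX1 := clB _ _ BX0 (biproduct_retractl b1).
have [z|z] := Bindec _ _ (direct_sum_restrict clB dsi).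
  by case: X1nz; exact: (z (exist _ X1 BX1)).
have [z'|z'] := (indec i).2 _ _ (direct_sum_restrict clI BQ).
  by case: X1nz; exact: (z' (exist _ X1 IX1)).
move=> X; split=> [BX|IX].
  have [X' [Y' [IX' OY' b]]] := deci X; apply: (rI X') => //.
  apply/isomorphic_sym/(biproduct_zero b).
  exact: (z (exist _ Y' (clB _ _ BX (biproduct_retractr b))) OY').
have [X' [Y' [BX' QY' b]]] := dec X; apply: (rB X') => //.
apply/isomorphic_sym/(biproduct_zero b).
exact: (z' (exist _ Y' (clI _ _ IX (biproduct_retractr b))) QY').
Qed.

End NaturalIdempotents.

Lemma fmapD C D (F : linfunctor C D) X Y (f g : hom X Y) :
  fmap F (f + g) = fmap F f + fmap F g.
Proof. by have := @fmap_linear K C D F X Y 1 f g; rewrite !scale1r. Qed.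

Lemma fmap0 C D (F : linfunctor C D) (X Y : C) : fmap F (0 : hom X Y) = 0.
Proof. by apply: (addrI (fmap F 0)); rewrite -fmapD !addr0. Qed.

Lemma fmap_iso C D (F : linfunctor C D) (X Y : C) (f : hom X Y) :
  is_iso f -> is_iso (fmap F f).
Proof.
by case=> g [gf fg]; exists (fmap F g); rewrite -!fmap_comp gf fg !fmap_id.
Qed.

Lemma equivalent_sym C D : equivalent C D -> equivalent D C.
Proof. by case=> F [G [FG GF]]; exists G, F. Qed.

Section Composition.
Context (A C D : lincat K) (F : linfunctor A C) (G : linfunctor C D).

Lemma comp_functor_linear (X Y : A) :
  linear (fun f : hom X Y => fmap G (fmap F f)).
Proof. by move=> k f g; rewrite !fmap_linear. Qed.

Lemma comp_functor_id (X : A) : fmap G (fmap F (idc X)) = idc (G (F X)).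
Proof. by rewrite !fmap_id. Qed.

Lemma comp_functor_comp (X Y Z : A) (g : hom Y Z) (f : hom X Y) :
  fmap G (fmap F (compc g f)) = compc (fmap G (fmap F g)) (fmap G (fmap F f)).
Proof. by rewrite !fmap_comp. Qed.

Definition comp_functor : linfunctor A D :=
  @Linfunctor K A D (fun X => G (F X)) (fun X Y f => fmap G (fmap F f))
    comp_functor_linear comp_functor_id comp_functor_comp.

End Composition.

Lemma comp_iso C (X Y Z : C) (g : hom Y Z) (f : hom X Y) :
  is_iso g -> is_iso f -> is_iso (compc g f).
Proof.
case=> g' [g1 g2] [f' [f1 f2]]; exists (compc f' g'); split.
  by rewrite compA -(compA f') g1 comp_id_right.
by rewrite compA -(compA g) f2 comp_id_right.
Qed.

Lemma comp_quasi_inverse A C D (F : linfunctor A C) (F' : linfunctor C A)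
    (G : linfunctor C D) (G' : linfunctor D C) :
  is_left_quasi_inverse F F' -> is_left_quasi_inverse G G' ->
  is_left_quasi_inverse (comp_functor F G) (comp_functor G' F').
Proof.
case=> eta [eta_iso eta_nat] [mu [mu_iso mu_nat]].
exists (fun X => compc (fmap F' (mu (F X))) (eta X)); split=> [X|X Y f].
  by apply: comp_iso; [exact: fmap_iso|].
by rewrite -compA eta_nat !compA -!fmap_comp mu_nat.
Qed.

Lemma equivalent_trans A C D : equivalent A C -> equivalent C D -> equivalent A D.
Proof.
case=> F [F' [FF' F'F]] [G [G' [GG' G'G]]].
exists (comp_functor F G), (comp_functor G' F').
by split; exact: comp_quasi_inverse.
Qed.

Section FullyFaithful.
Context (C D : lincat K) (F : linfunctor C D).
Hypothesis F_faithful : forall (X Y : C) (f : hom X Y), fmap F f = 0 -> f = 0.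
Hypothesis F_full : forall (X Y : C) (g : hom (F X) (F Y)), exists f, fmap F f = g.
Hypothesis F_dense : forall Y : D, exists X : C, isomorphic (F X) Y.

Lemma fmapN (X Y : C) (f : hom X Y) : fmap F (- f) = - fmap F f.
Proof. by apply: (addrI (fmap F f)); rewrite -fmapD !subrr fmap0. Qed.

Lemma F_inj (X Y : C) (f g : hom X Y) : fmap F f = fmap F g -> f = g.
Proof.
move=> e; apply/eqP; rewrite -subr_eq0; apply/eqP/F_faithful.
by rewrite fmapD fmapN e subrr.
Qed.

(** The inverse functor needs preimages and isomorphisms as data, so they are chosen here. *)
Lemma dense_choice (Y : D) : {X : C & {f : hom (F X) Y & {g : hom Y (F X) |
  compc g f = idc (F X) /\ compc f g = idc Y}}}.
Proof.
have [X XY] := cid (F_dense Y); have [f fi] := cid XY; have [g gf] := cid fi.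
by exists X, f, g.
Qed.

Definition inv_obj (Y : D) : C := projT1 (dense_choice Y).
Definition inv_to (Y : D) : hom (F (inv_obj Y)) Y := projT1 (projT2 (dense_choice Y)).
Definition inv_from (Y : D) : hom Y (F (inv_obj Y)) :=
  sval (projT2 (projT2 (dense_choice Y))).

Lemma inv_fromK Y : compc (inv_to Y) (inv_from Y) = idc Y.
Proof. by case: (svalP (projT2 (projT2 (dense_choice Y)))). Qed.

Lemma inv_toK Y : compc (inv_from Y) (inv_to Y) = idc (F (inv_obj Y)).
Proof. by case: (svalP (projT2 (projT2 (dense_choice Y)))). Qed.

Definition preim (X Y : C) (g : hom (F X) (F Y)) : hom X Y := sval (cid (F_full g)).

Lemma preimK (X Y : C) (g : hom (F X) (F Y)) : fmap F (preim g) = g.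
Proof. exact: svalP (cid (F_full g)). Qed.

Definition inv_map (Y Z : D) (f : hom Y Z) : hom (inv_obj Y) (inv_obj Z) :=
  preim (compc (inv_from Z) (compc f (inv_to Y))).

Lemma inv_map_linear (Y Z : D) : linear (@inv_map Y Z).
Proof.
move=> k f g; apply: F_inj; rewrite fmap_linear !preimK.
by rewrite comp_linear_left comp_linear_right.
Qed.

Lemma inv_map_id Y : inv_map (idc Y) = idc (inv_obj Y).
Proof. by apply: F_inj; rewrite preimK comp_id_left inv_toK fmap_id. Qed.

Lemma inv_map_comp (X Y Z : D) (g : hom Y Z) (f : hom X Y) :
  inv_map (compc g f) = compc (inv_map g) (inv_map f).
Proof.
apply: F_inj; rewrite fmap_comp !preimK -!compA; congr (compc _ (compc _ _)).
by rewrite [compc (inv_to Y) _]compA inv_fromK comp_id_left.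
Qed.

Definition inv_functor : linfunctor D C :=
  @Linfunctor K D C inv_obj inv_map inv_map_linear inv_map_id inv_map_comp.

Lemma fully_faithful_equivalent : equivalent C D.
Proof.
exists F, inv_functor; split.
  exists (fun X => preim (inv_from (F X))); split=> [X|X Y f].
    exists (preim (inv_to (F X))); split; apply: F_inj; rewrite fmap_comp !preimK fmap_id.
      exact: inv_fromK.
    exact: inv_toK.
  apply: F_inj; rewrite !fmap_comp !preimK -!compA inv_fromK.
  by rewrite comp_id_right.
exists inv_from; split=> [Y|Y Z f].
  by exists (inv_to Y); rewrite inv_fromK inv_toK.
by rewrite preimK -!compA inv_fromK comp_id_right.
Qed.

End FullyFaithful.

Lemma quasi_inverse_faithful C D (F : linfunctor C D) (G : linfunctor D C) :
  is_left_quasi_inverse F G -> forall (X Y : C) (f : hom X Y), fmap F f = 0 -> f = 0.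
Proof.
case=> eta [eta_iso eta_nat] X Y f e; have [g [gh _]] := eta_iso Y.
by rewrite -[f]comp_id_left -gh -compA eta_nat e fmap0 comp0c compc0.
Qed.

Lemma fmap_isomorphic C D (F : linfunctor C D) (X Y : C) :
  isomorphic X Y -> isomorphic (F X) (F Y).
Proof. by case=> f fi; exists (fmap F f); exact: fmap_iso. Qed.

Lemma fmap_zero C D (F : linfunctor C D) (X : C) : zero_object X -> zero_object (F X).
Proof. by move=> z; rewrite /zero_object -fmap_id z fmap0. Qed.

Lemma indecomposable_equivalent C D :
  equivalent C D -> indecomposable D -> indecomposable C.
Proof.
case=> F [G [FG GF]] [[Y0 Y0nz] indecD].
have isoC X : isomorphic X (G (F X)) by case: FG => eta [h _]; exists (eta X).
have isoD Y : isomorphic Y (F (G Y)) by case: GF => eta [h _]; exists (eta Y).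
split.
  exists (G Y0) => z; apply: Y0nz.
  exact: zero_object_iso (isomorphic_sym (isoD Y0)) (fmap_zero F z).
move=> P Q [rP rQ orth dec].
have faith := quasi_inverse_faithful GF.
(* A decomposition of C is pulled back along G to one of D; the components of Z are the F-images of
   those of G Z. *)
have ds : is_direct_sum (fun Y => P (G Y)) (fun Y => Q (G Y)).
  split=> [X Y XY|X Y XY|X Y PX QY|Z].
  - exact/rP/fmap_isomorphic.
  - exact/rQ/fmap_isomorphic.
  - have [h1 h2] := orth _ _ PX QY.
    by split=> f; apply: faith; [exact: h1|exact: h2].
  have [X [Y [PX QY [i [j [p [q [pi qj pj qi e]]]]]]]] := dec (G Z).
  have [u [v [vu uv]]] := isoD Z.
  exists (F X), (F Y); split; first exact: rP PX.
    exact: rQ QY.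
  exists (compc v (fmap F i)), (compc v (fmap F j)), (compc (fmap F p) u), (compc (fmap F q) u).
  have h (X1 X2 : C) (s : hom (G Z) X2) (r : hom X1 (G Z)) :
      compc (compc (fmap F s) u) (compc v (fmap F r)) = fmap F (compc s r).
    by rewrite compA -(compA (fmap F s)) uv comp_id_right fmap_comp.
  rewrite !h pi qj pj qi !fmap_id !fmap0; split=> //.
  rewrite -!compA ![compc (fmap F _) (compc (fmap F _) u)]compA -!fmap_comp.
  by rewrite -compcDr -compcDl -fmapD e fmap_id comp_id_left vu.
have [z|z] := indecD _ _ ds; [left|right] => X hX.
  apply: zero_object_iso (isomorphic_sym (isoC X)) _; apply: fmap_zero; apply: z.
  exact: rP hX.
apply: zero_object_iso (isomorphic_sym (isoC X)) _; apply: fmap_zero; apply: z.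
exact: rQ hX.
Qed.

End LinearCategoryTheory.

(** * Idempotents of bimodules and blocks *)

Section SplitIdempotent.
Context (K : numFieldType) (J : jordan_superalgebra K).
Context (M : bimodule J) (uM : unital M) (e : 'End(M)).
Hypothesis e_hom : e \in @bimodule_hom_pred K J M M.
Hypothesis e_idem : forall v, e (e v) = e v.

Let e_part b v : v \in part M b -> e v \in part M b.
Proof. by have /asboolP[h _] := e_hom; exact: h. Qed.

Let e_bact x v : e (bact x v) = bact x (e v).
Proof. by have /asboolP[_ h] := e_hom; exact: h. Qed.

Definition split_type : vectType K := subvs_of (limg e).

Lemma split_fix (u : split_type) : e (vsval u) = vsval u.
Proof. by have /memv_imgP[w _ ->] := subvsP u; rewrite e_idem. Qed.

Lemma split_mem v : e v = v -> v \in limg e.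
Proof. by move=> <-; rewrite memv_img ?memvf. Qed.

Lemma split_inj (u v : split_type) : vsval u = vsval v -> u = v.
Proof. exact: val_inj. Qed.

Lemma split_valP k (u v : split_type) :
  vsval (k *: u + v) = k *: vsval u + vsval v.
Proof. exact: linearP. Qed.

Definition split_part b : {vspace split_type} :=
  (linfun (vsval : split_type -> M) @^-1: part M b)%VS.

Lemma mem_split_part b (u : split_type) : (u \in split_part b) = (vsval u \in part M b).
Proof. by rewrite -memv_preim lfunE. Qed.

Lemma split_cap : (split_part false :&: split_part true)%VS = 0%VS.
Proof.
apply/vspaceP => u; rewrite memv_cap !mem_split_part -memv_cap part_cap !memv0.
by rewrite -(inj_eq val_inj).
Qed.

Lemma split_add : (split_part false + split_part true)%VS = fullv.
Proof.
apply/vspaceP => u; rewrite memvf; apply/memv_addP.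
pose c b : split_type := vsproj (limg e) (e (hcomp M b (vsval u))).
have cE b : vsval (c b) = e (hcomp M b (vsval u)).
  by rewrite vsprojK // memv_img ?memvf.
exists (c false); first by rewrite mem_split_part cE e_part // hcompP.
exists (c true); first by rewrite mem_split_part cE e_part // hcompP.
apply: split_inj; rewrite -[c false]scale1r split_valP !cE scale1r -linearD hcompD.
exact/esym/split_fix.
Qed.

Definition split_space : superspace K := Superspace split_cap split_add.

Definition split_act (x : J) (u : split_space) : split_space :=
  vsproj (limg e) (bact x (vsval (u : split_type))).

Lemma split_actE x (u : split_space) :
  vsval (split_act x u : split_type) = bact x (vsval (u : split_type)).
Proof. by rewrite vsprojK // split_mem // e_bact split_fix. Qed.

Lemma split_act_linear :
  (forall x, linear (split_act x)) /\ (forall v, linear (split_act^~ v)).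
Proof.
have [l r] := bact_linear M; split=> [x k u v|v k x y]; apply: split_inj.
  by rewrite split_valP !split_actE split_valP l.
by rewrite split_valP !split_actE r.
Qed.

Lemma split_act_part i j x u : x \in part J i -> u \in part split_space j ->
  split_act x u \in part split_space (i (+) j).
Proof. by rewrite !mem_split_part split_actE; exact: bact_part. Qed.

(** The relations pass to the image along the injective inclusion, and [null_ext_jordan] turns them
    back into the Jordan identity. *)
Lemma split_relations : relations_hold split_act.
Proof.
move=> a b c x y z xa yb zc u.
have [rA rB] := bimodule_relations xa yb zc (vsval (u : split_type)).
have sD (w w' : split_type) : vsval (w + w') = vsval w + vsval w' by exact: linearD.
have sN (w : split_type) : vsval (- w) = - vsval w by exact: linearN.
have sZ k (w : split_type) : vsval (k *: w) = k *: vsval w by exact: linearZ.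
by split; apply: split_inj; [rewrite -[RHS]rA /relA_defect | rewrite -[RHS]rB /relB_defect];
  rewrite !(sD, sN, sZ, split_actE).
Qed.

Definition split_bimod : bimodule J :=
  Bimodule split_act_linear split_act_part
    (null_ext_jordan split_act_linear split_act_part split_relations).

Lemma split_unital : unital split_bimod.
Proof.
have [o o_id o1] := uM; exists o => // v.
by apply: split_inj; rewrite split_actE o1.
Qed.

Definition split_in : 'Hom(split_bimod, M) := linfun (vsval : split_type -> M).

Definition split_out : 'Hom(M, split_bimod) :=
  linfun (vsproj (limg e) \o e : M -> split_type).

Lemma split_inE u : split_in u = vsval (u : split_type). Proof. exact: lfunE. Qed.

Lemma split_outE v : vsval (split_out v : split_type) = e v.
Proof. by rewrite lfunE /= vsprojK // memv_img ?memvf. Qed.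

Lemma split_in_hom : split_in \in @bimodule_hom_pred K J split_bimod M.
Proof.
apply/asboolP; split=> [b u|x u]; rewrite !split_inE ?split_actE //.
by rewrite mem_split_part.
Qed.

Lemma split_out_hom : split_out \in @bimodule_hom_pred K J M split_bimod.
Proof.
apply/asboolP; split=> [b v vb|x v]; first by rewrite mem_split_part split_outE e_part.
by apply: split_inj; rewrite split_actE !split_outE e_bact.
Qed.

End SplitIdempotent.

Lemma unital_bimod_split (K : numFieldType) (J : jordan_superalgebra K)
    (X : unital_bimod J) (e : hom X X) : compc e e = e ->
  exists (Y : unital_bimod J) (i : hom Y X) (p : hom X Y),
    compc p i = idc Y /\ compc i p = e.
Proof.
case: X e => M uM [f f_hom] /(congr1 val) /= ff.
have idem v : f (f v) = f v by rewrite -[in RHS]ff comp_lfunE.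
exists (exist _ (split_bimod f_hom idem) (split_unital uM f_hom idem)).
exists (BimoduleHom (split_in_hom f_hom idem)), (BimoduleHom (split_out_hom f_hom idem)).
split; apply: val_inj; apply/lfunP => v; rewrite /= comp_lfunE.
  apply: split_inj; rewrite split_outE split_inE id_lfunE.
  exact: split_fix.
by rewrite split_inE split_outE.
Qed.

Lemma part_hcomp (K : numFieldType) (M N : superspace K) (f : 'Hom(M, N)) :
  (forall b v, v \in part M b -> f v \in part N b) ->
  forall b v, f (hcomp M b v) = hcomp N b (f v).
Proof.
move=> fp b v; rewrite -[v in RHS](hcompD v) linearD /= linearD /=.
have h c := hcomp_id (fp _ _ (hcompP c v)).
have /= h1 := hcomp_other (fp _ _ (hcompP false v)).
have /= h0 := hcomp_other (fp _ _ (hcompP true v)).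
by case: b; rewrite h ?h1 ?h0 ?add0r ?addr0.
Qed.

Section StableEigenvector.
Context (K : numClosedFieldType) (V : vectType K) (U : {vspace V}) (f : 'End(V)).

Lemma stable_eigenvector : (forall v, v \in U -> f v \in U) -> U != 0%VS ->
  exists t w, [/\ w \in U, w != 0 & f w = t *: w].
Proof.
move=> fU U0; set b := vbasis U.
have bU i : b`_i \in U.
  case: (ltnP i (size b)) => i_lt; first by rewrite vbasis_mem // mem_nth.
  by rewrite nth_default ?mem0v.
(* Row i holds the coordinates of the image of the i-th basis vector, so that row eigenvectors of A
   are coordinates of eigenvectors of f. *)
pose A : 'M[K]_(\dim U) := \matrix_(i, j) coord b j (f b`_i).
have [|t /eigenvalueP[r rA r0]] := eigenvalue_closed A.
  by rewrite lt0n dimv_eq0.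
exists t, (\sum_i r 0 i *: b`_i); split.
- by apply: memv_suml => i _; rewrite memvZ.
- apply: contraNneq r0 => e; apply/eqP/rowP => i; rewrite mxE.
  have /freeP fr := basis_free (vbasisP U).
  exact: fr e i.
rewrite linear_sum /= scaler_sumr.
transitivity (\sum_i r 0 i *: \sum_j A i j *: b`_j).
  apply: eq_bigr => i _; rewrite linearZ /= [f _](coord_vbasis (fU _ (bU i))).
  by congr (_ *: _); apply: eq_bigr => j _; rewrite mxE.
under eq_bigr do rewrite scaler_sumr.
rewrite exchange_big /=; apply: eq_bigr => j _.
have rAj : \sum_i r 0 i * A i j = t * r 0 j.
  by have := congr1 (fun m : 'rV_(\dim U) => m 0 j) rA; rewrite [LHS]mxE [RHS]mxE.
by rewrite [RHS]scalerA -rAj scaler_suml; apply: eq_bigr => i _; rewrite scalerA.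
Qed.

End StableEigenvector.

(** * Projections to a parity and a generalized eigenvalue of z *)

Section Blocks.
Context (K : numFieldType).
Local Notation J := (JP K 2).
Implicit Types (t : K) (eps : bool).

Definition zshift (M : bimodule J) t : 'End(M) := zop M - t *: \1%VF.

Lemma zshiftE (M : bimodule J) t v : zshift M t v = zop M v - t *: v.
Proof. by rewrite !lfun_simp. Qed.

Lemma hom_zshift (M N : bimodule J) (f : 'Hom(M, N)) t :
  f \in @bimodule_hom_pred K J M N -> forall v, f (zshift M t v) = zshift N t (f v).
Proof. by move=> fh v; rewrite !zshiftE linearB linearZ /= hom_zop. Qed.

(** Not a homomorphism on M, because odd operators exchange the parities. It is used on Va and Vb,
    and [blk_ext] extends it from there. *)
Definition blk (M : bimodule J) (te : K * bool) : 'End(M) :=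
  (hcomp M te.2 \o fitting (zshift M te.1))%VF.

Lemma blkE M te v : blk M te v = hcomp M te.2 (fitting (zshift M te.1) v).
Proof. exact: comp_lfunE. Qed.

Lemma blk_natural (M N : bimodule J) te (f : 'Hom(M, N)) :
  (forall b v, v \in part M b -> f v \in part N b) ->
  (forall v, f (zop M v) = zop N (f v)) ->
  forall v, f (blk M te v) = blk N te (f v).
Proof.
move=> fp fz v; rewrite !blkE part_hcomp //; congr (hcomp N _ _).
by apply: fitting_natural => w; rewrite !zshiftE linearB linearZ /= fz.
Qed.

Section OneModule.
Context (M : bimodule J) (uM : unital M).

Lemma zshift_part t b v : v \in part M b -> zshift M t v \in part M b.
Proof. by move=> vb; rewrite zshiftE memvB ?memvZ ?zop_part. Qed.

Lemma hcomp_fitting t b v :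
  hcomp M b (fitting (zshift M t) v) = fitting (zshift M t) (hcomp M b v).
Proof.
apply: fitting_natural => w; apply/esym/part_hcomp => c u; exact: zshift_part.
Qed.

Lemma fitting_part t b v :
  v \in part M b -> fitting (zshift M t) v \in part M b.
Proof.
by move=> vb; rewrite -(hcomp_id vb) -hcomp_fitting hcompP.
Qed.

Lemma blk_part te b v : v \in part M b -> blk M te v \in part M b.
Proof.
move=> vb; rewrite blkE; have fb := fitting_part te.1 vb.
case: (eqVneq te.2 b) => [->|/neq_negb ->]; first exact: hcompP.
by rewrite hcomp_other ?mem0v.
Qed.

Lemma blk_zop te v : blk M te (zop M v) = zop M (blk M te v).
Proof. by symmetry; apply: blk_natural => //; exact: zop_part. Qed.

Lemma blk_nop te v : blk M te (nop M v) = nop M (blk M te v).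
Proof. by symmetry; apply: blk_natural => [|w]; [exact: nop_part|exact: nop_zop]. Qed.

(** The letters 0, 1, 2 are those in the equations of Va and Vb. They are even, hence commute with
    the parity projection. *)
Lemma blk_even i te v : (i < 3)%N -> blk M te (bop M i v) = bop M i (blk M te v).
Proof.
move=> i3; symmetry; apply: blk_natural => [b w wb|w].
  by have := bop_part i wb; case: i i3 => [|[|[|]]].
by rewrite zop_central // (leq_trans i3).
Qed.

Lemma blk_Vend te k v : v \in Vend M k -> blk M te v \in Vend M k.
Proof.
rewrite /Vend; case: (k < 8)%N; rewrite (mem_Va, mem_Vb) => /andP[/eqP e0 /eqP e1];
by rewrite (mem_Va, mem_Vb) -!blk_even // e0 e1 linearZ linear0 !eqxx.
Qed.

Lemma blk_idem te v : blk M te (blk M te v) = blk M te v.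
Proof.
rewrite !blkE -hcomp_fitting (fitting_id (fitting_ker _ v)).
exact: hcomp_id (hcompP _ _).
Qed.

Definition blk_ext te : 'Hom(M, M) := ext (blk M te) (blk M te).

Lemma gend_same (N : bimodule J) (g : 'Hom(M, N)) k : gend g g k = g.
Proof. by rewrite /gend; case: ifP. Qed.

Lemma blk_ext_hom te : blk_ext te \in @bimodule_hom_pred K J M M.
Proof.
apply: ext_hom => // [k v|k v vV|v vV|k b v vV]; rewrite ?gend_same.
- exact: blk_Vend.
- exact: blk_zop.
- exact: blk_nop.
- exact: blk_part.
Qed.

Lemma blk_ext_Vend te k v : v \in Vend M k -> blk_ext te v = blk M te v.
Proof.
rewrite /Vend; case: (k < 8)%N => vV; [apply: ext_Va vV | apply: ext_Vb vV] => //.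
Qed.

End OneModule.

Definition blk_hom (te : K * bool) (X : unital_bimod J) : hom X X :=
  BimoduleHom (blk_ext_hom (svalP X) te).

Lemma bimodule_hom_eq (X Y : unital_bimod J) (f g : hom X Y) :
  (forall k v, v \in Vend (sval X) k ->
    (f : bimodule_hom _ _) v = (g : bimodule_hom _ _) v) -> f = g.
Proof.
move=> e; apply: val_inj; apply: (hom_eq (svalP X) (bhom_funP f) (bhom_funP g)) => v vV.
  exact: (e 0).
exact: (e 8).
Qed.

Lemma blk_hom_natural te (X Y : unital_bimod J) (f : hom X Y) :
  compc f (blk_hom te X) = compc (blk_hom te Y) f.
Proof.
apply: bimodule_hom_eq => k v vV; rewrite /= !comp_lfunE /=.
have fh := bhom_funP f.
rewrite (blk_ext_Vend (svalP X) _ vV) (blk_ext_Vend (svalP Y) _ (hom_Vend fh vV)).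
apply: blk_natural => [b w wb|w]; first exact: (hom_part fh wb).
exact: (hom_zop fh).
Qed.

Lemma blk_hom_idem te (X : unital_bimod J) :
  compc (blk_hom te X) (blk_hom te X) = blk_hom te X.
Proof.
apply: bimodule_hom_eq => k v vV; rewrite /= !comp_lfunE /=.
have uX := svalP X; rewrite (blk_ext_Vend uX _ vV).
by rewrite (blk_ext_Vend uX _ (blk_Vend uX _ vV)) blk_idem.
Qed.

Lemma in_blockP te (X : unital_bimod J) : in_block blk_hom te X <->
  forall k v, v \in Vend (sval X) k -> blk (sval X) te v = v.
Proof.
have uX := svalP X; split=> [e k v vV|e].
  rewrite -(blk_ext_Vend uX _ vV); have := congr1 (fun f : bimodule_hom _ _ => f v) e.
  by rewrite /= id_lfunE.
apply: bimodule_hom_eq => k v vV; rewrite /= id_lfunE.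
by rewrite (blk_ext_Vend uX _ vV) (e k).
Qed.

Lemma in_block_part te (X : unital_bimod J) k v : in_block blk_hom te X ->
  v \in Vend (sval X) k -> v \in part (sval X) te.2.
Proof. by move=> /in_blockP h vV; rewrite -(h k v vV) blkE hcompP. Qed.

Lemma in_block_nilp te (X : unital_bimod J) k v : in_block blk_hom te X ->
  v \in Vend (sval X) k ->
  lpow (zshift (sval X) te.1) (fit_exp (sval X)) v = 0.
Proof.
move=> Xin vV; have vp := in_block_part Xin vV.
have /in_blockP h := Xin; have := h k v vV; rewrite blkE.
rewrite (hcomp_id (fitting_part _ vp)) => e.
by apply/eqP; rewrite -memv_ker -e fitting_ker.
Qed.

Lemma in_block_intro te (X : unital_bimod J) n :
  (forall k v, v \in Vend (sval X) k ->
    v \in part (sval X) te.2 /\ lpow (zshift (sval X) te.1) n v = 0) ->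
  in_block blk_hom te X.
Proof.
move=> h; apply/in_blockP => k v /h[vp vz].
by rewrite blkE (fitting_nilp vz) hcomp_id.
Qed.

End Blocks.

(** A nonzero bimodule has a nonzero homogeneous vector in Va or Vb, and the space of such vectors
    of that parity is stable under z. An eigenvector there survives the projection for its
    eigenvalue and parity. *)
Lemma blk_hom_nonzero (K : numClosedFieldType) (X : unital_bimod (JP K 2)) :
  ~ zero_object X -> exists te, blk_hom te X <> 0.
Proof.
move=> Xnz; have uX := svalP X; set M := sval X in uX *.
have [k [v [vV v0]]] : exists k v, v \in Vend M k /\ v <> 0.
  apply: contrapT => h; apply: Xnz; apply: bimodule_hom_eq => k v vV.
  have -> : v = 0 by apply: contrapT => v0; apply: h; exists k, v.
  by rewrite !linear0.
have [eps h0] : exists eps, hcomp M eps v != 0.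
  apply: contrapT => h; apply: v0; rewrite -(hcompD v).
  have z b : hcomp M b v = 0.
    by apply/eqP; apply: contrapT => /negP hb; apply: h; exists b.
  by rewrite !z addr0.
pose U := (Vend M k :&: part M eps)%VS.
have hU : hcomp M eps v \in U.
  rewrite memv_cap hcompP andbT; move: vV.
  have ev i w : (i < 3)%N -> hcomp M eps (bop M i w) = bop M i (hcomp M eps w).
    move=> i3; symmetry; apply: part_hcomp => b u ub.
    by have := bop_part i ub; case: i i3 => [|[|[|]]].
  rewrite /Vend; case: (k < 8)%N; rewrite !(mem_Va, mem_Vb) => /andP[/eqP e0 /eqP e1];
  by rewrite -!ev // e0 e1 linearZ linear0 !eqxx.
have [w||t [w [wU w0 wt]]] := @stable_eigenvector K M U (zop M).
- by rewrite !memv_cap => /andP[wV we]; rewrite zop_Vend ?zop_part.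
- by apply/eqP => U0; move: hU h0; rewrite U0 memv0 => ->.
exists (t, eps) => e; case/negP: w0; apply/eqP.
have := congr1 (fun f : bimodule_hom _ _ => f w) e; rewrite /= [in RHS]zero_lfunE.
move: wU; rewrite memv_cap => /andP[wV we].
rewrite (blk_ext_Vend uX _ wV) blkE /= (@fitting_nilp _ _ _ 1) ?hcomp_id //.
by rewrite /= comp_lfunE id_lfunE zshiftE wt subrr.
Qed.

(** * Representations of the quiver *)

Section JP2Representations.
Context (K : fieldType).
Local Notation rep2 := (rep K JP2_quiver).

Section Paths.
Context (V : rep2).

Let a : 'End(V vertex1) := @rmap K JP2_quiver V vertex1 vertex1 alpha.
Let b : 'Hom(V vertex1, V vertex2) := @rmap K JP2_quiver V vertex1 vertex2 beta.
Let c : 'End(V vertex2) := @rmap K JP2_quiver V vertex2 vertex2 gamma.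

(** Normal forms of paths modulo the relation: a path from 1 to 2 uses beta once, and every alpha
    before it can be traded for a gamma after it. *)
Definition path_value (x y : JP2_vertex) : nat -> 'Hom(V x, V y) -> Prop :=
  match x, y return nat -> 'Hom(V x, V y) -> Prop with
  | vertex1, vertex1 => fun n f => f = lpow a n
  | vertex1, vertex2 => fun n f => exists2 m, n = m.+1 & f = (lpow c m \o b)%VF
  | vertex2, vertex1 => fun _ _ => False
  | vertex2, vertex2 => fun n f => f = lpow c n
  end.

Lemma qpath_value (rel : JP2_relation V) (x y : JP2_vertex) (p : @qpath JP2_quiver x y) :
  path_value (qpath_length p) (qpath_map V p).
Proof.
have ba n : (b \o lpow a n)%VF = (lpow c n \o b)%VF.
  elim: n => [|n IH] /=; first by rewrite comp_lfun1l comp_lfun1r.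
  have rel' : (b \o a = c \o b)%VF := rel.
  by rewrite comp_lfunA rel' -!comp_lfunA IH.
elim: p => [|y' z p IH ar]; first by case: x.
case: ar p IH => p; case: x p => p //=.
- by move=> ->.
- by move=> ->; exists (qpath_length p).
- case=> m -> ->; exists m.+1 => //=; by rewrite comp_lfunA.
- by move=> ->.
Qed.

Lemma nilpotent_of_loops n : JP2_relation V -> lpow a n = 0 -> lpow c n = 0 ->
  nilpotent_rep V.
Proof.
(* The extra 1 pays for the arrow beta in a path from 1 to 2. *)
move=> rel an cn; exists n.+1 => x y p n_lt.
have z (U : vectType K) (f : 'End(U)) m : lpow f n = 0 -> (n <= m)%N -> lpow f m = 0.
  by move=> fn /subnK <-; apply/lfunP => v; rewrite lpowD fn !zero_lfunE linear0.
have := qpath_value rel p; case: x p n_lt => p n_lt; case: y p n_lt => p n_lt //=.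
- by move=> ->; rewrite (z _ _ _ an) // ltnW.
- by case=> m e ->; rewrite (z _ _ _ cn) ?comp_lfun0l // -ltnS -e.
- by move=> ->; rewrite (z _ _ _ cn) // ltnW.
Qed.

Fixpoint loop_path (x : vertex JP2_quiver) (l : arrow x x) (n : nat) : qpath x x :=
  if n is n'.+1 then qpath_snoc (loop_path l n') l else qpath_nil x.

Lemma loop_path_length (x : vertex JP2_quiver) (l : arrow x x) n : qpath_length (loop_path l n) = n.
Proof. by elim: n => //= n ->. Qed.

Lemma loop_path_map (x : vertex JP2_quiver) (l : arrow x x) n :
  qpath_map V (loop_path l n) = lpow (rmap V l) n.
Proof. by elim: n => //= n ->. Qed.

Lemma loops_of_nilpotent : nilpotent_rep V -> exists n, lpow a n = 0 /\ lpow c n = 0.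
Proof.
case=> n h; exists n.
have ha := h _ _ (@loop_path vertex1 alpha n); have hc := h _ _ (@loop_path vertex2 gamma n).
move: ha hc; rewrite !loop_path_length !loop_path_map leqnn.
by move=> -> // -> //.
Qed.

End Paths.

Section Constructors.
Context (V1 V2 : vectType K) (a : 'End(V1)) (b : 'Hom(V1, V2)) (c : 'End(V2)).

Definition rep2_space (x : JP2_vertex) : vectType K :=
  match x with vertex1 => V1 | vertex2 => V2 end.

Definition rep2_map (x y : JP2_vertex) (l : JP2_arrow x y) :
    'Hom(rep2_space x, rep2_space y) :=
  match l in JP2_arrow x y return 'Hom(rep2_space x, rep2_space y) with
  | alpha => a | beta => b | gamma => c
  end.

Definition rep2_of : rep2 := @Rep K JP2_quiver rep2_space rep2_map.

End Constructors.

Section HomConstructor.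
Context (V W : rep2) (f1 : 'Hom(V vertex1, W vertex1)) (f2 : 'Hom(V vertex2, W vertex2)).

Definition rep2_family : rep_family V W := fun x : JP2_vertex =>
  match x return 'Hom(V x, W x) with vertex1 => f1 | vertex2 => f2 end.

Lemma rep2_hom_subproof :
  (f1 \o @rmap K JP2_quiver V vertex1 vertex1 alpha
    = @rmap K JP2_quiver W vertex1 vertex1 alpha \o f1)%VF ->
  (f2 \o @rmap K JP2_quiver V vertex1 vertex2 beta
    = @rmap K JP2_quiver W vertex1 vertex2 beta \o f1)%VF ->
  (f2 \o @rmap K JP2_quiver V vertex2 vertex2 gamma
    = @rmap K JP2_quiver W vertex2 vertex2 gamma \o f2)%VF ->
  rep2_family \in @rep_hom_pred K JP2_quiver V W.
Proof. by move=> ha hb hc; apply/asboolP => x y []. Qed.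

End HomConstructor.

Lemma lpow_ker0 (V : vectType K) (f : 'End(V)) n (v : V) :
  lpow f n = 0 -> (forall w : V, f w = 0 -> w = 0) -> v = 0.
Proof.
move=> fn f0; have : lpow f n v = 0 by rewrite fn zero_lfunE.
by elim: n {fn} => [|n IH] /=; rewrite ?id_lfunE // comp_lfunE => /f0.
Qed.

(** One formula for the three representations K -> 0, 0 -> K and K -> K: [pid_mx 1] is the identity
    if m = n = 1, and it is empty if m or n is 0. *)
Definition brick_map (m n : nat) (v : 'rV[K]_m) : 'rV[K]_n := v *m pid_mx 1.

HB.instance Definition _ m n := GRing.Linear.copy (@brick_map m n)
  (mulmxr (pid_mx 1 : 'M[K]_(m, n))).

Definition brick (m n : nat) : rep2 :=
  rep2_of (0 : 'End('rV[K]_m)) (linfun (@brick_map m n)) (0 : 'End('rV[K]_n)).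

Lemma brick_nilp m n : nilpotent_rep (brick m n) /\ JP2_relation (brick m n).
Proof.
have rel : JP2_relation (brick m n).
  by rewrite /JP2_relation /= comp_lfun0l comp_lfun0r.
by split=> //; apply: (@nilpotent_of_loops _ 1) => //=; rewrite comp_lfun0l.
Qed.

Definition brick_obj m n : nilpotent_JP2_reps K := exist _ (brick m n) (brick_nilp m n).

(** The sum makes sense for m = 0 as well as m = 1; for m = 1 this is the map from K onto the line
    of w. *)
Definition line_map (m : nat) (W : vectType K) (w : W) (u : 'rV[K]_m) : W :=
  (\sum_i u ord0 i) *: w.

Lemma line_map_linear m W w : linear (@line_map m W w).
Proof.
move=> k u v; rewrite /line_map scalerA -scalerDl mulr_sumr -big_split /=.
by congr (_ *: _); apply: eq_bigr => i _; rewrite !mxE.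
Qed.

HB.instance Definition _ m (W : vectType K) (w : W) :=
  GRing.isLinear.Build K 'rV[K]_m W _ (@line_map m W w) (@line_map_linear m W w).

Lemma line_map1 (W : vectType K) (w : W) : linfun (@line_map 1 W w) (const_mx 1) = w.
Proof. by rewrite lfunE /= /line_map big_ord1 mxE scale1r. Qed.

Section BrickHom.
Context (m n : nat) (Y : rep2) (w1 : Y vertex1) (w2 : Y vertex2).
Hypothesis w1_alpha : @rmap K JP2_quiver Y vertex1 vertex1 alpha w1 = 0.
Hypothesis w12_beta : forall u : 'rV[K]_m, line_map w2 (brick_map n u)
  = line_map (@rmap K JP2_quiver Y vertex1 vertex2 beta w1) u.
Hypothesis w2_gamma : @rmap K JP2_quiver Y vertex2 vertex2 gamma w2 = 0.

Lemma brick_hom_subproof :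
  @rep2_family (brick m n) Y (linfun (@line_map m _ w1)) (linfun (@line_map n _ w2))
    \in @rep_hom_pred K JP2_quiver (brick m n) Y.
Proof.
apply: rep2_hom_subproof; apply/lfunP => u;
  rewrite ![in LHS]comp_lfunE ![in RHS]comp_lfunE !(zero_lfunE, lfunE) /=.
- by rewrite linear0 /line_map linearZ /= w1_alpha scaler0.
- by rewrite w12_beta /line_map linearZ.
- by rewrite linear0 /line_map linearZ /= w2_gamma scaler0.
Qed.

Definition brick_hom : rep_hom (brick m n) Y := RepHom brick_hom_subproof.

End BrickHom.

Lemma endo_row1 (f : 'End('rV[K]_1)) : exists k, f = k *: \1%VF.
Proof.
exists (f (const_mx 1) ord0 ord0); apply/lfunP => u.
have -> : u = u ord0 ord0 *: const_mx 1.
  by apply/rowP => i; rewrite !mxE mulr1 (ord1 i).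
rewrite scale_lfunE id_lfunE linearZ /=; apply/rowP => i.
by rewrite !mxE (ord1 i) mulr1 mulrC.
Qed.

Lemma hom_row0 (W : vectType K) (f g : 'Hom('rV[K]_0, W)) : f = g.
Proof. by apply/lfunP => u; rewrite (thinmx0 u) !linear0. Qed.

Lemma brick_map11 (u : 'rV[K]_1) : brick_map 1 u = u.
Proof. by rewrite /brick_map pid_mx_1 mulmx1. Qed.

Definition brick_indices (m n : nat) : Prop :=
  [\/ m = 1%N /\ n = 0%N, m = 0%N /\ n = 1%N | m = 1%N /\ n = 1%N].

Lemma brick_end (m n : nat) (f : rep_hom (brick m n) (brick m n)) : brick_indices m n ->
  exists k, f = k *: rep_id (brick m n).
Proof.
case=> -[em en]; subst m n.
- have [k fk] := endo_row1 (f vertex1).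
  by exists k; apply: rep_homP => -[]; [exact: fk|exact: hom_row0].
- have [k fk] := endo_row1 (f vertex2).
  by exists k; apply: rep_homP => -[]; [exact: hom_row0|exact: fk].
have [k fk] := endo_row1 (f vertex1); have [l fl] := endo_row1 (f vertex2).
exists k; apply: rep_homP => -[]; first exact: fk.
apply: (etrans fl); congr (_ *: _).
(* Compatibility with beta, the identity of K, forces the two scalars to agree. *)
have /asboolP/(_ vertex1 vertex2 beta)/lfunP/(_ (const_mx 1)) := rhom_funP f.
have -> : rhom_fun f vertex1 = k *: \1%VF := fk.
have -> : rhom_fun f vertex2 = l *: \1%VF := fl.
rewrite !comp_lfunE !scale_lfunE !id_lfunE linearZ /= !lfunE /= brick_map11.
by move/rowP/(_ ord0); rewrite !mxE !mulr1.
Qed.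

Lemma rep_hom_eq_at (V W : rep2) (f g : rep_hom V W) (x : JP2_vertex) : f = g ->
  rep_hom_at f x = rep_hom_at g x.
Proof. by move->. Qed.

Lemma id_rV1_neq0 : \1%VF <> 0 :> 'End('rV[K]_1).
Proof.
move/lfunP/(_ (const_mx 1)); rewrite id_lfunE zero_lfunE => /rowP/(_ ord0).
by rewrite !mxE => /eqP; rewrite oner_eq0.
Qed.

Lemma brick_nonzero m n : brick_indices m n -> ~ zero_object (brick_obj m n).
Proof.
case=> -[em en] z; subst m n; apply: id_rV1_neq0.
- exact: (rep_hom_eq_at vertex1 z).
- exact: (rep_hom_eq_at vertex2 z).
- exact: (rep_hom_eq_at vertex1 z).
Qed.

(** The projection of X to its P-component is a scalar k. For k = 0 the P-component vanishes;
    otherwise k q = q i p = 0 kills the Q-component. *)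
Lemma brick_side (C : lincat K) (P Q : C -> Prop) (X : C) :
  is_direct_sum P Q -> (forall f : hom X X, exists k, f = k *: idc X) -> P X \/ Q X.
Proof.
case=> rP rQ orth dec Xk; have [X' [Y' [PX QY b]]] := dec X.
have bs := biproduct_sym b.
case: (b) => i [j [p [q [pi qj pj qi e]]]].
have [k ek] := Xk (compc i p); have [k0|k0] := eqVneq k 0.
  right; apply: (rQ Y') => //; apply/isomorphic_sym/(biproduct_zero bs).
  rewrite /zero_object -(comp_id_left (idc X')) -pi.
  have -> : compc (compc p i) (compc p i) = compc p (compc (compc i p) i).
    by rewrite !compA.
  by rewrite ek k0 scale0r comp0c compc0.
left; apply: (rP X') => //; apply/isomorphic_sym/(biproduct_zero b).
have q0 : q = 0.
  have lin : compc q (k *: idc X) = k *: compc q (idc X).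
    by have := comp_linear_right q k (idc X) 0; rewrite !compc0 !addr0.
  have : k *: q = 0 by rewrite -[q]comp_id_right -lin -ek compA qi comp0c.
  by move/eqP; rewrite scaler_eq0 (negbTE k0) => /eqP.
by rewrite /zero_object -qj q0 comp0c.
Qed.

Lemma brick_obj_side (P Q : nilpotent_JP2_reps K -> Prop) m n : is_direct_sum P Q ->
  brick_indices m n -> P (brick_obj m n) \/ Q (brick_obj m n).
Proof.
move=> PQ mn; apply: (@brick_side (nilpotent_JP2_reps K) _ _ _ PQ) => f.
exact: brick_end.
Qed.

Lemma direct_sum_hom_side (C : lincat K) (P Q : C -> Prop) (X Y : C) :
  is_direct_sum P Q -> (exists f : hom X Y, f <> 0) -> P X \/ Q X -> P Y \/ Q Y ->
  (P X -> P Y) /\ (P Y -> P X).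
Proof.
case=> _ _ orth _ [f f0] sX sY; split=> h.
  by case: sY => // h'; case: f0; apply: (orth _ _ h h').1.
by case: sX => // h'; case: f0; apply: (orth _ _ h h').2.
Qed.

(* With both simple representations in one summand, an object of the other one has
   injective, hence vanishing, nilpotent loops. *)
Lemma other_side_zero (P Q : nilpotent_JP2_reps K -> Prop) : is_direct_sum P Q ->
  P (brick_obj 1 0) -> P (brick_obj 0 1) -> forall Y, Q Y -> zero_object Y.
Proof.
move=> [_ _ orth _] P1 P2 [Y [nY rY]] QY.
have [N [aN cN]] := loops_of_nilpotent nY.
have Y2 : forall w : Y vertex2, w = 0.
  move=> w; apply: (lpow_ker0 w cN) => {}w cw.
  pose h : rep_hom (brick 0 1) Y := @brick_hom 0 1 Y 0 w (linear0 _)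
    (fun u => ltac:(by rewrite (thinmx0 u) !linear0)) cw.
  have /(rep_hom_eq_at vertex2) : h = 0 := (orth _ _ P2 QY).1 h.
  by move/lfunP/(_ (const_mx 1)); rewrite [LHS]line_map1 zero_lfunE.
have Y1 : forall w : Y vertex1, w = 0.
  move=> w; apply: (lpow_ker0 w aN) => {}w aw.
  pose h : rep_hom (brick 1 0) Y := @brick_hom 1 0 Y w 0 aw
    (fun u => etrans (Y2 _) (esym (Y2 _))) (linear0 _).
  have /(rep_hom_eq_at vertex1) : h = 0 := (orth _ _ P1 QY).1 h.
  by move/lfunP/(_ (const_mx 1)); rewrite [LHS]line_map1 zero_lfunE.
by apply: rep_homP => -[]; apply/lfunP => v; [rewrite [LHS]Y1 [RHS]Y1|rewrite [LHS]Y2 [RHS]Y2].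
Qed.

(** The simple at vertex 2 is a subobject of K -> K and the simple at vertex 1 a quotient, so all
    three lie on the same side of a decomposition. *)
Lemma brick_homs :
  (exists f : hom (brick_obj 0 1) (brick_obj 1 1), f <> 0) /\
  (exists f : hom (brick_obj 1 1) (brick_obj 1 0), f <> 0).
Proof.
have one_neq0 : const_mx 1 <> 0 :> 'rV[K]_1.
  by move/rowP/(_ ord0); rewrite !mxE => /eqP; rewrite oner_eq0.
have z : (0 : 'End('rV[K]_1)) (const_mx 1) = 0 by exact: zero_lfunE.
split.
  have h1 (u : 'rV[K]_0) : line_map (const_mx 1 : 'rV[K]_1) (brick_map 1 u)
      = line_map (linfun (@brick_map 1 1) 0) u.
    by rewrite (thinmx0 u) !linear0.
  exists (@brick_hom 0 1 (brick 1 1) 0 (const_mx 1) (linear0 _) h1 z).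
  move/(rep_hom_eq_at vertex2)/lfunP/(_ (const_mx 1)).
  by rewrite [LHS]line_map1 zero_lfunE.
have h1 (u : 'rV[K]_1) : line_map (0 : 'rV[K]_0) (brick_map 1 u)
    = line_map (linfun (@brick_map 1 0) (const_mx 1)) u.
  by apply/rowP => -[].
exists (@brick_hom 1 1 (brick 1 0) (const_mx 1) 0 z h1 (linear0 _)).
move/(rep_hom_eq_at vertex1)/lfunP/(_ (const_mx 1)).
by rewrite [LHS]line_map1 zero_lfunE.
Qed.

Lemma nilpotent_JP2_reps_indecomposable : indecomposable (nilpotent_JP2_reps K).
Proof.
have b10 : brick_indices 1 0 by constructor.
have b01 : brick_indices 0 1 by constructor 2.
have b11 : brick_indices 1 1 by constructor 3.
split; first by exists (brick_obj 1 0); exact: brick_nonzero.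
have main (P Q : nilpotent_JP2_reps K -> Prop) : is_direct_sum P Q ->
    P (brick_obj 1 1) -> forall Y, Q Y -> zero_object Y.
  move=> PQ P11; have [h1 h2] := brick_homs.
  apply: (other_side_zero PQ).
    by apply: (direct_sum_hom_side PQ h2 _ _).1 => //; exact: brick_obj_side.
  by apply: (direct_sum_hom_side PQ h1 _ _).2 => //; exact: brick_obj_side.
move=> P Q PQ; case: (brick_obj_side PQ b11) => h; [right|left].
  exact: main PQ h.
exact: main (direct_sum_sym PQ) h.
Qed.

End JP2Representations.

(** * The functor on a block *)

Section Restriction.
Context (K : fieldType) (V W : vectType K) (U : {vspace V}) (U' : {vspace W}).

Definition restr (f : 'Hom(V, W)) : 'Hom(subvs_of U, subvs_of U') :=
  linfun (vsproj U' \o f \o vsval).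

Lemma restrE (f : 'Hom(V, W)) (u : subvs_of U) : (forall v, v \in U -> f v \in U') ->
  vsval (restr f u) = f (vsval u).
Proof. by move=> fU; rewrite lfunE /= vsprojK // fU // subvsP. Qed.

Lemma restr_linear : linear restr.
Proof.
move=> k f g; apply/lfunP => u; rewrite add_lfunE scale_lfunE.
by rewrite /restr !lfunE /= add_lfunE scale_lfunE linearP.
Qed.

(** [ext] expects maps on the whole of M but evaluates them on Va and Vb, so some linear extension
    is supplied. *)
Definition unrestr (h : 'Hom(subvs_of U, subvs_of U')) : 'Hom(V, W) :=
  linfun (vsval \o h \o vsproj U).

Lemma unrestrE (h : 'Hom(subvs_of U, subvs_of U')) u :
  unrestr h (vsval u) = vsval (h u).
Proof. by rewrite lfunE /= vsvalK. Qed.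

Lemma unrestr_mem (h : 'Hom(subvs_of U, subvs_of U')) v : unrestr h v \in U'.
Proof. by rewrite lfunE; exact: subvsP. Qed.

End Restriction.

Lemma restr_comp (K : fieldType) (V1 V2 V3 : vectType K) (U1 : {vspace V1})
    (U2 : {vspace V2}) (U3 : {vspace V3}) (g : 'Hom(V2, V3)) (f : 'Hom(V1, V2)) :
  (forall v, v \in U1 -> f v \in U2) -> (forall v, v \in U2 -> g v \in U3) ->
  restr U1 U3 (g \o f) = (restr U2 U3 g \o restr U1 U2 f)%VF.
Proof.
move=> fU gU; apply/lfunP => u; apply: val_inj; rewrite comp_lfunE /= !restrE ?comp_lfunE //.
by move=> v /fU/gU; rewrite comp_lfunE.
Qed.

Section BlockFunctor.
Context (K : numFieldType).
Local Notation J := (JP K 2).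
Implicit Types (M N : bimodule J) (t : K).

Definition block_rep M t : rep K JP2_quiver :=
  rep2_of (restr (Vb M) (Vb M) (zshift M t)) (restr (Vb M) (Va M) (nop M))
    (restr (Va M) (Va M) (zshift M t)).

Section OneModule.
Context (M : bimodule J) (uM : unital M) (t : K).

Lemma zshift_Va v : v \in Va M -> zshift M t v \in Va M.
Proof. by move=> vV; rewrite zshiftE memvB ?memvZ //; exact: (@zop_Vend _ _ uM 0). Qed.

Lemma zshift_Vb v : v \in Vb M -> zshift M t v \in Vb M.
Proof. by move=> vV; rewrite zshiftE memvB ?memvZ //; exact: (@zop_Vend _ _ uM 8). Qed.

Lemma block_rep_relation : JP2_relation (block_rep M t).
Proof.
apply/lfunP => u; rewrite !comp_lfunE; apply: val_inj; rewrite /=.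
rewrite !restrE; try by [exact: zshift_Va|exact: zshift_Vb|exact: nop_Va].
by rewrite !zshiftE linearB linearZ /= nop_zop.
Qed.

Lemma block_rep_nilpotent n :
  (forall k v, v \in Vend M k -> lpow (zshift M t) n v = 0) -> nilpotent_rep (block_rep M t).
Proof.
move=> h; have lE (U : {vspace M}) (f : 'End(M)) (m : nat) (u : subvs_of U) :
    (forall v, v \in U -> f v \in U) -> vsval (lpow (restr U U f) m u) = lpow f m (vsval u).
  move=> fU; have := @lpow_comm K _ _ (restr U U f) f (linfun (vsval : subvs_of U -> M)).
  move=> /(_ _ m u); rewrite !lfunE; apply => w.
  by rewrite [LHS]lfunE [in RHS]lfunE /=; exact: restrE.
apply: (@nilpotent_of_loops _ _ n); first exact: block_rep_relation.
  apply/lfunP => u; rewrite zero_lfunE; apply: val_inj.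
  by apply: (etrans (lE _ _ n u zshift_Vb)); rewrite (h 8) //; exact: subvsP.
apply/lfunP => u; rewrite zero_lfunE; apply: val_inj.
by apply: (etrans (lE _ _ n u zshift_Va)); rewrite (h 0) //; exact: subvsP.
Qed.

End OneModule.

Section OneHom.
Context (M N : bimodule J) (uM : unital M) (uN : unital N) (t : K) (f : 'Hom(M, N)).
Hypothesis f_hom : f \in @bimodule_hom_pred K J M N.

Let fa v : v \in Va M -> f v \in Va N. Proof. exact: (hom_Vend f_hom (k := 0)). Qed.
Let fb v : v \in Vb M -> f v \in Vb N. Proof. exact: (hom_Vend f_hom (k := 8)). Qed.

Lemma block_rep_hom_subproof :
  @rep2_family K (block_rep M t) (block_rep N t) (restr (Vb M) (Vb N) f) (restr (Va M) (Va N) f)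
    \in @rep_hom_pred K JP2_quiver (block_rep M t) (block_rep N t).
Proof.
apply: rep2_hom_subproof; apply/lfunP => u; rewrite ![LHS]comp_lfunE ![RHS]comp_lfunE;
  apply: val_inj; rewrite /= !restrE //;
  try by [exact: zshift_Va|exact: zshift_Vb|exact: nop_Va].
- exact: (hom_zshift _ f_hom).
- exact: (hom_nop f_hom).
- exact: (hom_zshift _ f_hom).
Qed.

End OneHom.

Context (te : K * bool).
Local Notation Bte := (fullsub (unital_bimod J) (in_block (@blk_hom K) te)).

Lemma block_obj_subproof (X : Bte) :
  nilpotent_rep (block_rep (sval (sval X)) te.1) /\ JP2_relation (block_rep (sval (sval X)) te.1).
Proof.
have uX := svalP (sval X); split; last exact: block_rep_relation.
by apply: (block_rep_nilpotent uX) => k v vV; exact: in_block_nilp (svalP X) vV.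
Qed.

Definition block_obj (X : Bte) : nilpotent_JP2_reps K :=
  exist _ (block_rep (sval (sval X)) te.1) (block_obj_subproof X).

Definition block_map (X Y : Bte) (f : hom X Y) : hom (block_obj X) (block_obj Y) :=
  RepHom (block_rep_hom_subproof (svalP (sval X)) (svalP (sval Y)) te.1
    (bhom_funP (f : bimodule_hom (sval (sval X)) (sval (sval Y))))).

Lemma hom_Va (M N : bimodule J) (f : bimodule_hom M N) v : v \in Va M -> f v \in Va N.
Proof. exact: (hom_Vend (bhom_funP f) (k := 0)). Qed.

Lemma hom_Vb (M N : bimodule J) (f : bimodule_hom M N) v : v \in Vb M -> f v \in Vb N.
Proof. exact: (hom_Vend (bhom_funP f) (k := 8)). Qed.

Lemma block_map_linear (X Y : Bte) : linear (@block_map X Y).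
Proof.
move=> k f g; pose M := sval (sval X); pose N := sval (sval Y).
pose fv (h : hom X Y) : 'Hom(M, N) := bhom_fun (h : bimodule_hom M N).
have e : fv (k *: f + g) = k *: fv f + fv g by [].
have at1 (h : hom X Y) : rep_hom_at (block_map h) vertex1 = restr (Vb M) (Vb N) (fv h) by [].
have at2 (h : hom X Y) : rep_hom_at (block_map h) vertex2 = restr (Va M) (Va N) (fv h) by [].
apply: rep_homP => x.
have -> : rep_hom_at (k *: block_map f + block_map g) x =
  k *: rep_hom_at (block_map f) x + rep_hom_at (block_map g) x by [].
case: x; first by rewrite !at1 e; exact: restr_linear.
by rewrite !at2 e; exact: restr_linear.
Qed.

Lemma block_map_id (X : Bte) : block_map (idc X) = idc (block_obj X).
Proof.
apply: rep_homP => -[]; apply/lfunP => u; apply: val_inj.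
- by rewrite [LHS]restrE ?id_lfunE // => v; rewrite id_lfunE.
- by rewrite [LHS]restrE ?id_lfunE // => v; rewrite id_lfunE.
Qed.

Lemma block_map_comp (X Y Z : Bte) (g : hom Y Z) (f : hom X Y) :
  block_map (compc g f) = compc (block_map g) (block_map f).
Proof.
apply: rep_homP => -[]; apply: restr_comp => v; try exact: hom_Vb; exact: hom_Va.
Qed.

Definition block_functor : linfunctor Bte (nilpotent_JP2_reps K) :=
  Linfunctor block_map_linear block_map_id block_map_comp.

Lemma block_functor_faithful (X Y : Bte) (f : hom X Y) : fmap block_functor f = 0 -> f = 0.
Proof.
move=> e; apply: (@bimodule_hom_eq K (sval X) (sval Y)) => k v.
rewrite [RHS]zero_lfunE /Vend; case: (k < 8)%N => vV.
  have /lfunP/(_ (Subvs vV))/(congr1 vsval) := rep_hom_eq_at vertex2 e.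
  by rewrite [LHS]restrE ?zero_lfunE //; exact: hom_Va.
have /lfunP/(_ (Subvs vV))/(congr1 vsval) := rep_hom_eq_at vertex1 e.
by rewrite [LHS]restrE ?zero_lfunE //; exact: hom_Vb.
Qed.

Section Full.
Context (X Y : Bte) (h : rep_hom (block_rep (sval (sval X)) te.1) (block_rep (sval (sval Y)) te.1)).

Let M := sval (sval X).
Let N := sval (sval Y).
Let uM : unital M := svalP (sval X).
Let uN : unital N := svalP (sval Y).
Let ha : 'Hom(subvs_of (Va M), subvs_of (Va N)) := h vertex2.
Let hb : 'Hom(subvs_of (Vb M), subvs_of (Vb N)) := h vertex1.
Let ga : 'Hom(M, N) := unrestr ha.
Let gb : 'Hom(M, N) := unrestr hb.

Let h_arrow (x y : JP2_vertex) (l : JP2_arrow x y) (u : block_rep M te.1 x) :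
  h y (@rmap K JP2_quiver _ x y l u) = @rmap K JP2_quiver _ x y l (h x u).
Proof.
have /asboolP/(_ x y l)/lfunP/(_ u) := rhom_funP h.
by rewrite [LHS]comp_lfunE [RHS]comp_lfunE.
Qed.

Let ga_zop v : v \in Va M -> ga (zop M v) = zop N (ga v).
Proof.
move=> vV; have [u ->] : exists u : subvs_of (Va M), v = vsval u by exists (Subvs vV).
have zE (P : bimodule J) w : zop P w = zshift P te.1 w + te.1 *: w.
  by rewrite zshiftE subrK.
rewrite !zE linearD linearZ /=; congr (_ + _).
rewrite -(restrE _ (zshift_Va uM te.1)) /ga !unrestrE -(restrE _ (zshift_Va uN te.1)).
congr vsval; exact: (h_arrow gamma).
Qed.

Let gb_zop v : v \in Vb M -> gb (zop M v) = zop N (gb v).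
Proof.
move=> vV; have [u ->] : exists u : subvs_of (Vb M), v = vsval u by exists (Subvs vV).
have zE (P : bimodule J) w : zop P w = zshift P te.1 w + te.1 *: w.
  by rewrite zshiftE subrK.
rewrite !zE linearD linearZ /=; congr (_ + _).
rewrite -(restrE _ (zshift_Vb uM te.1)) /gb !unrestrE -(restrE _ (zshift_Vb uN te.1)).
congr vsval; exact: (h_arrow alpha).
Qed.

Let gab_nop v : v \in Vb M -> ga (nop M v) = nop N (gb v).
Proof.
move=> vV; have [u ->] : exists u : subvs_of (Vb M), v = vsval u by exists (Subvs vV).
rewrite -(restrE _ (nop_Va uM)) /ga /gb !unrestrE -(restrE _ (nop_Va uN)).
congr vsval; exact: (h_arrow beta).
Qed.

Let g_Vend k v : v \in Vend M k -> gend ga gb k v \in Vend N k.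
Proof. by rewrite /gend /Vend; case: (k < 8)%N => _; exact: unrestr_mem. Qed.

(* Within the block, Va and Vb have a single parity, so parity is preserved for free. *)
Let g_part k b v : v \in Vend M k -> v \in part M b -> gend ga gb k v \in part N b.
Proof.
move=> vV vb; have vt := in_block_part (svalP X) vV.
have gt := in_block_part (svalP Y) (g_Vend vV).
have [<-//|/neq_negb e] := eqVneq te.2 b.
suff -> : v = 0 by rewrite linear0 mem0v.
by apply/eqP; rewrite -memv0 -(part_capb M b) memv_cap vb -e.
Qed.

Lemma block_map_full : exists f : hom X Y, block_map f = h.
Proof.
have gh : ext ga gb \in @bimodule_hom_pred K J M N.
  apply: ext_hom => // k v; rewrite /gend /Vend; case: (k < 8)%N; [exact: ga_zop|exact: gb_zop].
exists (BimoduleHom gh); apply: rep_homP => -[]; apply/lfunP => u; apply: val_inj.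
  apply: etrans (restrE _ (@hom_Vb _ _ (BimoduleHom gh))) _.
  by rewrite /= ext_Vb ?unrestrE //; exact: subvsP.
apply: etrans (restrE _ (@hom_Va _ _ (BimoduleHom gh))) _.
by rewrite /= ext_Va ?unrestrE //; exact: subvsP.
Qed.

End Full.

End BlockFunctor.

(** * The bimodule of a representation *)

(* Symbolic vectors of the free module on the words of [basis_word]: the word
   8 + k :: l stands for l applied to the argument and placed in coordinate k,
   where the letters of l are 24 for z and larger ones for n. *)
Definition table_mono (i : nat) (t : Z * word) : ncpoly :=
  if t.2 is k :: l then
    if [&& i < 8, 8 <= k < 24 & all (leq 24) l]%N then
      [seq (Z.mul t.1 r.1.1.2, (8 + r.1.2)%N :: match r.2 with
          0 => l | 1 => 24%N :: l | _ => rcons l 25%N end)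
        | r <- act_row i & r.1.1.1 == k - 8]%N
    else [:: (t.1, i :: t.2)]
  else [:: (t.1, i :: t.2)].

Definition table_act (i : nat) (p : ncpoly) : ncpoly :=
  pnorm (flatten [seq table_mono i t | t <- p]).

Definition table_eval (p : ncpoly) (j : nat) : ncpoly :=
  pnorm (flatten [seq pmono t.1 [::] [::]
    (foldr table_act [:: (Zpos xH, [:: 8 + j])]%N t.2) | t <- p]).

(** Every defining relation vanishes on each of the sixteen coordinates for symbolic z and n, so the
    table gives a bimodule for any commuting pair. *)
Definition relations_check : bool :=
  all (fun i => all (fun j => all (fun k =>
    let rA := jp_relA i j k in let rB := jp_relB i j k in
    all (fun l => (table_eval rA l == [::]) && (table_eval rB l == [::])) (iota 0 16))
    (iota 0 8)) (iota 0 8)) (iota 0 8).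

Definition span_check : bool :=
  all (fun k => (table_eval [:: (Zpos xH, basis_word k)] (if k < 8 then 0 else 8)
      == [:: (Zpos xH, [:: 8 + k])])
    && (table_eval [:: (Zpos xH, central_word)] k == [:: (Zpos 2, [:: 8 + k; 24])])
    && (table_eval [:: (Zpos xH, [:: 0]); (Zpos xH, [:: 7])] k == [:: (Zpos 2, [:: 8 + k])]))%N
  (iota 0 16).

Definition ends_check : bool :=
  [&& table_eval [:: (Zpos xH, [:: 0])] 0 == [:: (Zpos 2, [:: 8])],
      table_eval [:: (Zpos xH, [:: 2])] 0 == [::],
      table_eval [:: (Zpos xH, [:: 0])] 8 == [:: (Zpos 2, [:: 16])],
      table_eval [:: (Zpos xH, [:: 1])] 8 == [::] &
      table_eval [:: (Zpos xH, beta_word)] 8 == [:: (Zpos 4, [:: 8; 25])]]%N.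

Definition rows_check : bool :=
  all (fun i => all (fun r => [&& r.1.1.1 < 16, r.1.2 < 16 &
    word_parity r.1.2 == word_parity r.1.1.1 (+) jp_parity i]%N) (act_row i)) (iota 0 8).

Lemma relations_checkT : relations_check. Proof. by vm_cast_no_check (erefl true). Qed.

Lemma span_checkT : span_check. Proof. by vm_cast_no_check (erefl true). Qed.

Lemma ends_checkT : ends_check. Proof. by vm_cast_no_check (erefl true). Qed.

Lemma rows_checkT : rows_check. Proof. by vm_cast_no_check (erefl true). Qed.

Lemma row_ok i r : r \in act_row i -> [&& r.1.1.1 < 16, r.1.2 < 16 &
  word_parity r.1.2 == word_parity r.1.1.1 (+) jp_parity i]%N.
Proof.
case: (ltnP i 8) => i8; last by rewrite /act_row nth_default.
by have /allP/(_ i) := rows_checkT; rewrite mem_iota => /(_ i8)/allP; apply.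
Qed.

Section TableModule.
Context (K : numFieldType) (U : vectType K) (zU nU : 'End(U)).
Hypothesis zU_nU : forall u, zU (nU u) = nU (zU u).

Definition coords : vectType K := {ffun 'I_16 -> U}.

Definition delta (k : nat) (u : U) : coords := [ffun i : 'I_16 => if i == k :> nat then u else 0].

Lemma delta_linear k : linear (delta k).
Proof.
by move=> c u v; apply/ffunP => i; rewrite !ffunE; case: ifP; rewrite ?scaler0 ?addr0.
Qed.

HB.instance Definition _ k := GRing.isLinear.Build K U coords *:%R (delta k) (delta_linear k).

Lemma delta_sum (u : coords) : u = \sum_(k <- iota 0 16) delta k (u (inord k)).
Proof.
apply/ffunP => i; rewrite sum_ffunE (bigD1_seq (i : nat)) ?iota_uniq ?mem_iota //=.
rewrite ffunE eqxx inord_val big1 ?addr0 // => k /negPf ki.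
by rewrite ffunE eq_sym ki.
Qed.

Definition scal (s : nat) : 'End(U) := match s with 0 => \1%VF | 1 => zU | _ => nU end.

(** Besides the eight table operators, letter 8 + k moves coordinate 0 into place k, and letters
    from 24 on apply z or n coordinatewise. A symbolic vector is then an ordinary polynomial
    evaluated at [delta 0 u]. *)
Definition letter_op (i : nat) (u : coords) : coords :=
  if (i < 8)%N then
    \sum_(r <- act_row i) ZtoK K r.1.1.2 *: delta r.1.2 (scal r.2 (u (inord r.1.1.1)))
  else if (i < 24)%N then delta (i - 8) (u ord0)
  else [ffun k => (if i == 24%N then zU else nU) (u k)].

Lemma letter_op_linear i : linear (letter_op i).
Proof.
move=> c u v; rewrite /letter_op; case: ifP => _.
  rewrite scaler_sumr -big_split; apply: eq_bigr => r _ /=.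
  by rewrite !ffunE !linearP !scalerA mulrC.
case: ifP => _; first by rewrite !ffunE linearP.
by apply/ffunP => k; rewrite !ffunE linearP.
Qed.

HB.instance Definition _ i :=
  GRing.isLinear.Build K coords coords *:%R (letter_op i) (letter_op_linear i).

Let op (i : nat) : {linear coords -> coords} := letter_op i.

Definition tail_op (l : word) (u : U) : U :=
  foldr (fun i w => (if i == 24%N then zU else nU) w) u l.

Lemma weval_tail l k u : all (leq 24) l -> weval op l (delta k u) = delta k (tail_op l u).
Proof.
elim: l => [|i l IH] //= /andP[i24 /IH ->]; apply/ffunP => j; rewrite /letter_op.
have -> : (i < 8)%N = false by apply/negbTE; rewrite -leqNgt (leq_trans _ i24).
by rewrite ltnNge i24 /= !ffunE; case: (_ == k); rewrite ?linear0.
Qed.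

Lemma weval_coord k l u : (k < 16)%N -> all (leq 24) l ->
  weval op ((8 + k)%N :: l) (delta 0 u) = delta k (tail_op l u).
Proof.
move=> k16 l24; have lt8 : (8 + k < 8)%N = false by rewrite ltnNge leq_addr.
have lt24 : (8 + k < 24)%N by rewrite (ltn_add2l 8 k 16).
rewrite -[LHS]/(op (8 + k)%N (weval op l (delta 0 u))) weval_tail //.
by rewrite -[LHS]/(letter_op (8 + k) _) /letter_op lt8 lt24 addKn ffunE.
Qed.

(** New letters z go to the front and new letters n to the end, which normalizes words in the
    commuting pair; this is where zn = nz is used. *)
Lemma tail_op_rcons l u : tail_op (rcons l 25) u = nU (tail_op l u).
Proof.
rewrite /tail_op foldr_rcons /=; elim: l => //= i l ->.
by case: ifP => _; rewrite ?zU_nU.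
Qed.

Lemma letter_delta i k u : (i < 8)%N -> (k < 16)%N -> letter_op i (delta k u) =
  \sum_(r <- act_row i | r.1.1.1 == k) ZtoK K r.1.1.2 *: delta r.1.2 (scal r.2 u).
Proof.
move=> i8 k16; rewrite /letter_op i8 [RHS]big_mkcond; apply: eq_big_seq => r /row_ok.
case/and3P => j16 _ _; rewrite ffunE inordK //; case: ifP => // _.
by rewrite !linear0 ?scaler0.
Qed.

Lemma peval_table_mono i t u :
  peval op (table_mono i t) (delta 0 u) = letter_op i (ZtoK K t.1 *: weval op t.2 (delta 0 u)).
Proof.
case: t => c w; rewrite linearZ /=.
have fallback : peval op [:: (c, i :: w)] (delta 0 u) = ZtoK K c *: letter_op i (weval op w (delta 0 u)).
  exact: peval1.
case: w fallback => [|k l] // fallback; rewrite /table_mono /=.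
case: ifP => [|_]; last exact: fallback.
case/and3P => i8 /andP[k8 k24] l24 {fallback}.
have kE : k = (8 + (k - 8))%N by rewrite subnKC.
have k16 : (k - 8 < 16)%N by rewrite ltn_subLR.
have e : letter_op i (weval op (k :: l) (delta 0 u)) = \sum_(r <- act_row i | r.1.1.1 == (k - 8)%N)
    ZtoK K r.1.1.2 *: delta r.1.2 (scal r.2 (tail_op l u)).
  by rewrite {1}kE weval_coord // letter_delta.
apply: etrans (congr1 (fun x => ZtoK K c *: x) (esym e)); rewrite {e}.
rewrite scaler_sumr /peval big_map big_filter big_seq_cond [RHS]big_seq_cond.
apply: eq_bigr => r /andP[/row_ok /and3P[_ r16 _] _].
rewrite ZtoKM [RHS]scalerA; congr (_ *: _).
case: r r16 => [[[j d] m] [|[|s]]] m16.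
- by rewrite (weval_coord _ m16) // id_lfunE.
- exact: (weval_coord (l := 24%N :: l) _ m16).
- by rewrite (weval_coord _ m16) ?all_rcons ?l24 // tail_op_rcons.
Qed.

Lemma peval_flatten (ps : seq ncpoly) x :
  peval op (flatten ps) x = \sum_(p <- ps) peval op p x.
Proof. by rewrite /peval big_flatten. Qed.

Lemma peval_table_act i p u :
  peval op (table_act i p) (delta 0 u) = letter_op i (peval op p (delta 0 u)).
Proof.
rewrite /table_act peval_pnorm peval_flatten big_map {2}/peval linear_sum.
by apply: eq_bigr => t _; exact: peval_table_mono.
Qed.

Lemma peval_table_eval p j u : (j < 16)%N ->
  peval op (table_eval p j) (delta 0 u) = peval op p (delta j u).
Proof.
move=> j16; rewrite /table_eval peval_pnorm peval_flatten big_map {2}/peval.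
apply: eq_bigr => t _; rewrite peval_pmono /=; congr (_ *: _).
elim: t.2 => [|i w IH] /=; first by rewrite peval1 scale1r weval_coord.
by rewrite peval_table_act IH.
Qed.

Lemma peval_eval_eq p q j u : (j < 16)%N -> table_eval p j == q ->
  peval op p (delta j u) = peval op q (delta 0 u).
Proof. by move=> j16 /eqP <-; rewrite peval_table_eval. Qed.

Lemma peval_delta_ext p (f : coords -> coords) : linear f ->
  (forall k u, (k < 16)%N -> peval op p (delta k u) = f (delta k u)) ->
  forall v, peval op p v = f v.
Proof.
move=> fl h v; pose g : {linear coords -> coords} := HB.pack f (GRing.isLinear.Build K coords coords *:%R f fl).
rewrite (delta_sum v) -[f _]/(g _) !linear_sum; apply: eq_big_seq => k.
by rewrite mem_iota => /andP[_ k16]; exact: h.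
Qed.

End TableModule.

Section DefectLinear.
Context (K : numFieldType) (J : jordan_superalgebra K) (M : superspace K) (act : J -> M -> M).
Hypothesis act_lin : (forall x, linear (act x)) /\ (forall v, linear (act^~ v)).

Let lin := (actDl act_lin, actZl act_lin, actDr act_lin, actZr act_lin,
  @jmulDl, @jmulDr, @jmulZl, @jmulZr).

Lemma relA_defect_lin1 a b c y z v : linear (fun x => relA_defect act a b c x y z v).
Proof. by move=> k x x'; rewrite /relA_defect !lin; vcoords; ring. Qed.

Lemma relA_defect_lin2 a b c x z v : linear (fun y => relA_defect act a b c x y z v).
Proof. by move=> k y y'; rewrite /relA_defect !lin; vcoords; ring. Qed.

Lemma relA_defect_lin3 a b c x y v : linear (fun z => relA_defect act a b c x y z v).
Proof. by move=> k z z'; rewrite /relA_defect !lin; vcoords; ring. Qed.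

Lemma relB_defect_lin1 a b c y z v : linear (fun x => relB_defect act a b c x y z v).
Proof. by move=> k x x'; rewrite /relB_defect !lin; vcoords; ring. Qed.

Lemma relB_defect_lin2 a b c x z v : linear (fun y => relB_defect act a b c x y z v).
Proof. by move=> k y y'; rewrite /relB_defect !lin; vcoords; ring. Qed.

Lemma relB_defect_lin3 a b c x y v : linear (fun z => relB_defect act a b c x y z v).
Proof. by move=> k z z'; rewrite /relB_defect !lin; vcoords; ring. Qed.

End DefectLinear.

Section BasisExtension.
Context (K : numFieldType) (M : superspace K).
Local Notation J := (JP K 2).

Lemma jp_linear_eq0 (f : J -> M) b x : linear f -> x \in part J b ->
  (forall k, (k < 8)%N -> jp_parity k = b -> f (jp_basis K k) = 0) -> f x = 0.
Proof.
move=> f_lin xb h; pose g := HB.pack_for {linear J -> M} f (GRing.isLinear.Build K J M *:%R f f_lin).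
rewrite (jp_parityP xb) -[LHS]/(g _) linear_sum; apply: big1_seq => k.
by rewrite mem_iota => /andP[/eqP kb /andP[_ k8]]; rewrite linearZ /= h ?scaler0.
Qed.

(** The defects are linear in each algebra argument, so homogeneous basis elements suffice. *)
Lemma relations_hold_basis (act : J -> M -> M) (op : nat -> {linear M -> M}) :
  (forall x, linear (act x)) /\ (forall v, linear (act^~ v)) ->
  (forall i v, (i < 8)%N -> op i v = act (jp_basis K i) v) ->
  (forall i j k v, (i < 8)%N -> (j < 8)%N -> (k < 8)%N ->
    peval op (jp_relA i j k) v = 0 /\ peval op (jp_relB i j k) v = 0) ->
  relations_hold act.
Proof.
move=> act_lin opE h a b c x y z xa yb zc v; split.
  apply: (jp_linear_eq0 (relA_defect_lin1 act_lin a b c y z v) xa) => i i8 ia.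
  apply: (jp_linear_eq0 (relA_defect_lin2 act_lin a b c _ z v) yb) => j j8 jb.
  apply: (jp_linear_eq0 (relA_defect_lin3 act_lin a b c _ _ v) zc) => k k8 kc.
  by rewrite -ia -jb -kc -(peval_relA act_lin opE) //; exact: (h _ _ _ _ _ _ _).1.
apply: (jp_linear_eq0 (relB_defect_lin1 act_lin a b c y z v) xa) => i i8 ia.
apply: (jp_linear_eq0 (relB_defect_lin2 act_lin a b c _ z v) yb) => j j8 jb.
apply: (jp_linear_eq0 (relB_defect_lin3 act_lin a b c _ _ v) zc) => k k8 kc.
by rewrite -ia -jb -kc -(peval_relB act_lin opE) //; exact: (h _ _ _ _ _ _ _).2.
Qed.

End BasisExtension.

Section TableBimodule.
Context (K : numFieldType) (U : vectType K) (zU nU : 'End(U)) (eps : bool).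
Hypothesis zU_nU : forall u, zU (nU u) = nU (zU u).
Local Notation J := (JP K 2).
Local Notation coords := (coords U).
Local Notation letter_op := (letter_op zU nU).

(** Coordinate k stands for the k-th word applied to vectors of parity [eps], which fixes its
    parity. *)
Definition select (b : bool) (u : coords) : coords :=
  [ffun k : 'I_16 => if eps (+) word_parity k == b then u k else 0].

Lemma select_linear b : linear (select b).
Proof.
by move=> c u v; apply/ffunP => k; rewrite !ffunE; case: ifP; rewrite ?scaler0 ?addr0.
Qed.

HB.instance Definition _ b :=
  GRing.isLinear.Build K coords coords *:%R (select b) (select_linear b).

Definition table_part (b : bool) : {vspace coords} := lker (linfun (select (~~ b))).

Lemma mem_table_part b u : (u \in table_part b) = (select (~~ b) u == 0).
Proof. by rewrite memv_ker lfunE. Qed.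

Lemma selectD u : select false u + select true u = u.
Proof. by apply/ffunP => k; rewrite !ffunE; case: (_ (+) _); rewrite /= ?add0r ?addr0. Qed.

Lemma select_part b u : select b u \in table_part b.
Proof.
rewrite mem_table_part; apply/eqP/ffunP => k; rewrite !ffunE.
by case: eqP => // ->; case: b.
Qed.

Lemma table_cap : (table_part false :&: table_part true)%VS = 0%VS.
Proof.
apply/vspaceP => u; rewrite memv_cap !mem_table_part memv0.
apply/andP/eqP => [[/eqP h1 /eqP h0]|->]; last by rewrite !linear0 eqxx.
by rewrite -(selectD u) h0 h1 addr0.
Qed.

Lemma table_add : (table_part false + table_part true)%VS = fullv.
Proof.
apply/vspaceP => u; rewrite memvf; apply/memv_addP.
by exists (select false u); [|exists (select true u)]; rewrite ?select_part ?selectD.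
Qed.

Definition table_space : superspace K := Superspace table_cap table_add.

Lemma delta_part k w : delta k w \in table_part (eps (+) word_parity k).
Proof.
rewrite mem_table_part; apply/eqP/ffunP => j; rewrite !ffunE.
by case: eqP => // e; case: eqP e => // -> ; case: (_ (+) _).
Qed.

Lemma part_coord b u (k : 'I_16) : u \in table_part b -> u k != 0 ->
  eps (+) word_parity k = b.
Proof.
rewrite mem_table_part => /eqP/ffunP/(_ k); rewrite !ffunE.
by case: eqP => [_ ->|/eqP/neq_negb ->]; rewrite ?eqxx ?negbK.
Qed.

Lemma letter_op_part i b u : (i < 8)%N -> u \in table_part b ->
  letter_op i u \in table_part (jp_parity i (+) b).
Proof.
move=> i8 ub; rewrite /letter_op i8 big_seq; apply: memv_suml => r /row_ok.
case/and3P => j16 _ /eqP wp; rewrite memvZ //.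
have [->|/(part_coord ub)] := eqVneq (u (inord r.1.1.1)) 0; first by rewrite !linear0 mem0v.
rewrite inordK // => <-; have := delta_part r.1.2 (scal zU nU r.2 (u (inord r.1.1.1))).
by rewrite wp addbA addbC.
Qed.

Definition table_bact (x : J) (u : table_space) : table_space :=
  \sum_(k <- iota 0 8) (jp_coord k x / 2) *: letter_op k u.

Lemma table_bact_linear :
  (forall x, linear (table_bact x)) /\ (forall u, linear (table_bact^~ u)).
Proof.
split=> [x c u v|u c x y]; rewrite /table_bact scaler_sumr -big_split; apply: eq_bigr => k _ /=.
  by rewrite linearP /= scalerDr !scalerA mulrC.
rewrite linearP /= [_ *: (_ : K^o)]/(_ * _) mulrDl scalerDl -mulrA scalerA.
by [].
Qed.

Lemma table_bact_basis i u : (i < 8)%N -> letter_op i u = table_bact (jp_basis K i) u.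
Proof.
move=> i8; rewrite /table_bact (bigD1_seq i) ?iota_uniq ?mem_iota //.
rewrite jp_coord_basis // eqxx divff ?two_neq0 // scale1r big1_seq; first exact/esym/addr0.
move=> k; rewrite mem_iota => /andP[/negPf ki /andP[_ k8]].
by rewrite jp_coord_basis // ki mul0r scale0r.
Qed.

Lemma table_bact_part i j x u : x \in part J i -> u \in part table_space j ->
  table_bact x u \in part table_space (i (+) j).
Proof.
move=> xi uj; have lin := table_bact_linear.
suff : select (~~ (i (+) j)) (table_bact x u) = 0 by rewrite [_ \in _]mem_table_part => ->.
apply: (@jp_linear_eq0 K table_space (fun x => select (~~ (i (+) j)) (table_bact x u)) i x) => //.
  by move=> c y z; rewrite (lin.2 u) linearP.
move=> k k8 <-; rewrite -table_bact_basis //; apply/eqP.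
by rewrite -mem_table_part letter_op_part.
Qed.

Lemma table_relations : relations_hold table_bact.
Proof.
apply: (@relations_hold_basis K table_space table_bact (fun i => letter_op i)).
- exact: table_bact_linear.
- exact: table_bact_basis.
move=> i j k v i8 j8 k8.
have z : linear (fun _ : coords => 0 : coords) by move=> c u w; rewrite scaler0 addr0.
have /allP/(_ i) := relations_checkT; rewrite mem_iota => /(_ i8)/allP/(_ j).
rewrite mem_iota => /(_ j8)/allP/(_ k); rewrite mem_iota => /(_ k8)/allP h.
split; apply: (peval_delta_ext z) => l u l16;
  have := h l; rewrite mem_iota => /(_ l16)/andP[hA hB].
- by rewrite (peval_eval_eq zU_nU u l16 hA) peval_nil.
- by rewrite (peval_eval_eq zU_nU u l16 hB) peval_nil.
Qed.

Definition table_bimod : bimodule J :=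
  Bimodule table_bact_linear table_bact_part
    (null_ext_jordan table_bact_linear table_bact_part table_relations).

End TableBimodule.

Section TableStructure.
Context (K : numFieldType) (U : vectType K) (zU nU : 'End(U)) (eps : bool).
Hypothesis zU_nU : forall u, zU (nU u) = nU (zU u).
Local Notation J := (JP K 2).
Let M : bimodule J := table_bimod eps zU_nU.
Let op (i : nat) : {linear coords U -> coords U} := letter_op zU nU i.
Let d (k : nat) (u : U) : M := delta k u.

Let table_peval p q j u : (j < 16)%N -> table_eval p j == q ->
  peval op p (d j u) = peval op q (d 0 u).
Proof. exact: peval_eval_eq. Qed.

Let spanP k : (k < 16)%N ->
  [/\ table_eval [:: (Zpos xH, basis_word k)] (if k < 8 then 0 else 8) == [:: (Zpos xH, [:: 8 + k])],
      table_eval [:: (Zpos xH, central_word)] k == [:: (Zpos 2, [:: 8 + k; 24])] &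
      table_eval [:: (Zpos xH, [:: 0]); (Zpos xH, [:: 7])] k == [:: (Zpos 2, [:: 8 + k])]]%N.
Proof.
move=> k16; have /allP/(_ k) := span_checkT; rewrite mem_iota.
by move=> /(_ k16)/andP[/andP[]].
Qed.

Let bopM i v : (i < 8)%N -> bop M i v = op i v.
Proof. by move=> i8; rewrite bopE; exact/esym/table_bact_basis. Qed.

Let peval_coord (k : nat) c l u : (k < 16)%N -> all (leq 24) l ->
  peval op [:: (c, (8 + k)%N :: l)] (d 0 u) = ZtoK K c *: d k (tail_op zU nU l u).
Proof. by move=> k16 l24; rewrite peval1 weval_coord. Qed.

Lemma table_ext (f g : 'End(M)) : (forall k u, (k < 16)%N -> f (d k u) = g (d k u)) -> f = g.
Proof.
move=> h; apply/lfunP => v; rewrite (delta_sum v) !linear_sum.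
by apply: eq_big_seq => k; rewrite mem_iota => /andP[_ k16]; exact: h.
Qed.

Lemma table_unital : unital M.
Proof.
exists (2^-1 *: (jp_basis K 0 + jp_basis K 7)); first exact: jp_one.
have lin := bact_linear M.
suff e : bop M 0 + bop M 7 = 2 *: \1%VF.
  move=> v; rewrite (actZl lin) (actDl lin) -!bopE -add_lfunE e scale_lfunE id_lfunE.
  by rewrite scalerA mulVf ?scale1r ?two_neq0.
apply: table_ext => k u k16; rewrite add_lfunE scale_lfunE id_lfunE !bopM //.
have [_ _ h] := spanP k16; have := table_peval u k16 h.
by rewrite peval_coord // peval_cons peval1 !scale1r.
Qed.

Lemma zop_delta k u : (k < 16)%N -> zop M (d k u) = d k (zU u).
Proof.
move=> k16; rewrite zopE !bopM //; have [_ h _] := spanP k16.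
have := table_peval u k16 h; rewrite peval_coord // peval1 scale1r => e.
apply: (scalerI (two_neq0 K)); rewrite scalerA divff ?two_neq0 // scale1r; exact: e.
Qed.

Lemma nop_delta u : nop M (d 8 u) = d 0 (nU u).
Proof.
have n4 : (4 : K) != 0 by rewrite pnatr_eq0.
rewrite nopE !bopM //; have /and5P[_ _ _ _ h] := ends_checkT.
have := table_peval u (isT : 8 < 16)%N h; rewrite peval_coord // peval1 scale1r => e.
apply: (scalerI n4); rewrite scalerA divff // scale1r; exact: e.
Qed.

Lemma delta0_Va u : d 0 u \in Va M.
Proof.
have /and5P[h0 h2 _ _ _] := ends_checkT.
have := table_peval u (isT : 0 < 16)%N h0; have := table_peval u (isT : 0 < 16)%N h2.
rewrite peval_coord // peval_nil !peval1 !scale1r => e2 e0.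
by rewrite mem_Va !bopM //; apply/andP; split; apply/eqP; [exact: e0|exact: e2].
Qed.

Lemma delta8_Vb u : d 8 u \in Vb M.
Proof.
have /and5P[_ _ h0 h1 _] := ends_checkT.
have := table_peval u (isT : 8 < 16)%N h0; have := table_peval u (isT : 8 < 16)%N h1.
rewrite -[16%N]/(8 + 8)%N peval_coord // peval_nil !peval1 !scale1r => e1 e0.
by rewrite mem_Vb !bopM //; apply/andP; split; apply/eqP; [exact: e0|exact: e1].
Qed.

Let last_end (k : nat) : nat := if (k < 8)%N then 0%N else 8%N.

Lemma delta_Vend k u : d (last_end k) u \in Vend M k.
Proof. by rewrite /last_end /Vend; case: ifP => _; [exact: delta0_Va|exact: delta8_Vb]. Qed.

Lemma wop_delta k u : (k < 16)%N -> wop k (d (last_end k) u) = d k u.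
Proof.
move=> k16; have [h _ _] := spanP k16.
have l16 : (last_end k < 16)%N by rewrite /last_end; case: (k < 8)%N.
have := table_peval u l16 h; rewrite peval_coord // peval1 !scale1r /= => <-.
rewrite /wop; elim: (basis_word k) (basis_word_bound k) => //= i w IH /andP[i8 w8].
by rewrite {1}/mop i8 bopM // IH.
Qed.

Lemma dop_table j (v : M) : (j < 16)%N ->
  dop j v = d (last_end j) ((v : coords U) (inord j)).
Proof.
move=> j16; have -> : dop j v = \sum_(k <- iota 0 16) dop j (d k ((v : coords U) (inord k))).
  by rewrite {1}(delta_sum v) linear_sum.
rewrite (bigD1_seq j) ?iota_uniq ?mem_iota // -(wop_delta _ j16).
rewrite (dop_wop table_unital j16 j16 (delta_Vend _ _)) eqxx.
rewrite big1_seq; first exact: addr0.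
move=> k /andP[kj]; rewrite mem_iota => /andP[_ k16].
by rewrite -(wop_delta _ k16) (dop_wop table_unital j16 k16 (delta_Vend _ _)) (negPf kj).
Qed.

(** Va and Vb of the table bimodule are no larger than coordinates 0 and 8: such a v is the empty
    word applied to v, so by freeness its other coordinates vanish. *)
Lemma table_Vend k (v : M) : v \in Vend M k ->
  v = d (last_end k) ((v : coords U) (inord (last_end k))).
Proof.
move=> vV; have l16 : (last_end k < 16)%N by rewrite /last_end; case: (k < 8)%N.
have V_last : Vend M (last_end k) = Vend M k by rewrite /Vend /last_end; case: (k < 8)%N.
have wl : wop (last_end k) v = v by rewrite /last_end; case: (k < 8)%N.
rewrite {1}(delta_sum v) (bigD1_seq (last_end k)) ?iota_uniq ?mem_iota //.
rewrite big1_seq; first exact: addr0.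
move=> j /andP[jk]; rewrite mem_iota => /andP[_ j16].
rewrite -[LHS](wop_delta _ j16) -dop_table // -wl dop_wop ?V_last //; last exact: table_unital.
by rewrite eq_sym (negPf jk) linear0.
Qed.

Lemma table_zshift t k u : (k < 16)%N -> zshift M t (d k u) = d k (zU u - t *: u).
Proof. move=> k16; rewrite zshiftE zop_delta //.
have dZ : delta k (t *: u) = t *: delta k u by exact: linearZ.
have dB : delta k (zU u - t *: u) = delta k (zU u) - delta k (t *: u) by exact: linearB.
by rewrite /d dB dZ. Qed.

Lemma table_lpow t n k u : (k < 16)%N ->
  lpow (zshift M t) n (d k u) = d k (lpow (zU - t *: \1%VF) n u).
Proof.
move=> k16; elim: n u => [|n IH] u /=; first by rewrite !id_lfunE.
by rewrite !comp_lfunE IH table_zshift // !lfun_simp.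
Qed.

Definition table_obj : unital_bimod J := exist _ M table_unital.

Lemma table_in_block t n : lpow (zU - t *: \1%VF) n = 0 ->
  in_block (@blk_hom K) (t, eps) table_obj.
Proof.
move=> zn; apply: (in_block_intro (n := n)) => k v vV.
rewrite (table_Vend vV) table_lpow ?zn ?zero_lfunE; last by rewrite /last_end; case: (k < 8)%N.
split; last by exact: linear0.
have := delta_part eps (last_end k) ((v : coords U) (inord (last_end k))).
by rewrite (_ : word_parity _ = false) ?addbF // /last_end; case: (k < 8)%N.
Qed.

End TableStructure.

(** The idempotent i p of F X comes from an idempotent of X by full faithfulness; splitting the
    latter yields an object mapped to Y. *)
Lemma dense_retract (K : fieldType) (C D : lincat K) (F : linfunctor C D) :
  (forall (X Y : C) (f : hom X Y), fmap F f = 0 -> f = 0) ->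
  (forall (X Y : C) (g : hom (F X) (F Y)), exists f : hom X Y, fmap F f = g) ->
  (forall (X : C) (e : hom X X), compc e e = e ->
    exists (Y : C) (i : hom Y X) (p : hom X Y), compc p i = idc Y /\ compc i p = e) ->
  forall (Y : D) (X : C), retract_of Y (F X) -> exists X', isomorphic (F X') Y.
Proof.
move=> F0 Ffull split_idem Y X [i [p pi]]; have [f fE] := Ffull _ _ (compc i p).
have ff : compc f f = f.
  apply/eqP; rewrite -subr_eq0; apply/eqP/F0.
  rewrite fmapD -scaleN1r; have := fmap_linear F (-1) f 0; rewrite fmap0 !addr0 => ->.
  rewrite scaleN1r fmap_comp fE compA -(compA i p i) pi comp_id_right subrr //.
have [X' [j [q [qj jq]]]] := split_idem _ _ ff; exists X'.
exists (compc p (fmap F j)), (compc (fmap F q) i); split.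
  rewrite compA -(compA _ i p) -fE -!fmap_comp -jq.
  by rewrite compA qj comp_id_left qj fmap_id.
rewrite compA -(compA p) -fmap_comp jq fE compA pi comp_id_left pi //.
Qed.

(** * Density of the functor on a block *)

Section Density.
Context (K : numFieldType) (te : K * bool).
Local Notation J := (JP K 2).
Local Notation Bte := (fullsub (unital_bimod J) (in_block (@blk_hom K) te)).

Lemma block_split_idem (X : Bte) (e : hom X X) : compc e e = e ->
  exists (Y : Bte) (i : hom Y X) (p : hom X Y), compc p i = idc Y /\ compc i p = e.
Proof.
move=> ee; have [Y [i [p [pi ip]]]] := unital_bimod_split (X := sval X) ee.
have ds := @natural_idem_sum K _ _ (@blk_hom K) (@blk_hom_natural K) (@blk_hom_idem K)
  (@unital_bimod_split K J) te.
have YB : in_block (@blk_hom K) te Y.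
  by apply: (direct_sum_summand ds (svalP X)); exists i, p.
by exists (exist _ Y YB : Bte), i, p.
Qed.

Section OneRep.
Context (V : rep K JP2_quiver) (V_nilp : nilpotent_rep V) (V_rel : JP2_relation V).

Let a : 'End(V vertex1) := @rmap K JP2_quiver V vertex1 vertex1 alpha.
Let b : 'Hom(V vertex1, V vertex2) := @rmap K JP2_quiver V vertex1 vertex2 beta.
Let c : 'End(V vertex2) := @rmap K JP2_quiver V vertex2 vertex2 gamma.
Let U : vectType K := (V vertex2 * V vertex1)%type.
Let t := te.1.

(** Merging both vertices into U gives all sixteen coordinates the same type. Va and Vb of the model
    are then both copies of U. *)
Definition rep_z_fun (u : U) : U := (c u.1 + t *: u.1, a u.2 + t *: u.2).
Definition rep_n_fun (u : U) : U := (b u.2, 0).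

Lemma rep_z_linear : linear rep_z_fun.
Proof.
by move=> k u v; rewrite /rep_z_fun /= !linearP /=; congr (_, _); rewrite /= scalerDr addrACA.
Qed.

Lemma rep_n_linear : linear rep_n_fun.
Proof. by move=> k u v; rewrite /rep_n_fun /= linearP; congr (_, _); rewrite /= scaler0 addr0. Qed.

HB.instance Definition _ := GRing.isLinear.Build K U U *:%R rep_z_fun rep_z_linear.
HB.instance Definition _ := GRing.isLinear.Build K U U *:%R rep_n_fun rep_n_linear.

Definition rep_z : 'End(U) := linfun rep_z_fun.
Definition rep_n : 'End(U) := linfun rep_n_fun.

Lemma rep_zE u : rep_z u = (c u.1 + t *: u.1, a u.2 + t *: u.2). Proof. exact: lfunE. Qed.
Lemma rep_nE u : rep_n u = (b u.2, 0). Proof. exact: lfunE. Qed.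

Lemma rep_z_n u : rep_z (rep_n u) = rep_n (rep_z u).
Proof.
rewrite !rep_zE !rep_nE /= linear0 scaler0 addr0; congr (_, _).
rewrite linearD linearZ /=; congr (_ + _).
by have /lfunP/(_ u.2) := V_rel; rewrite !comp_lfunE => ->.
Qed.

Lemma rep_shiftE u : rep_z u - t *: u = (c u.1, a u.2).
Proof. by rewrite rep_zE; congr (_, _); rewrite /= addrK. Qed.

Lemma rep_z_nilp : exists n, lpow (rep_z - t *: \1%VF) n = 0.
Proof.
have [n [an cn]] := loops_of_nilpotent V_nilp; exists n; apply/lfunP => u.
suff e m : lpow (rep_z - t *: \1%VF) m u = (lpow c m u.1, lpow a m u.2).
  by rewrite e zero_lfunE [lpow c n]cn [lpow a n]an !zero_lfunE.
elim: m => [|m IH]; first by rewrite /= !id_lfunE; case: u.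
by rewrite /= !comp_lfunE IH add_lfunE opp_lfunE scale_lfunE id_lfunE rep_shiftE.
Qed.

Let M : bimodule J := table_bimod te.2 rep_z_n.

Lemma rep_in_block : in_block (@blk_hom K) te (table_obj te.2 rep_z_n).
Proof.
have [n zn] := rep_z_nilp; have := table_in_block te.2 rep_z_n zn.
by rewrite /t -surjective_pairing.
Qed.

Definition rep_model : Bte := exist _ _ rep_in_block.

Let in2_fun (v : V vertex2) : M := delta 0 ((v, 0) : U).
Let in1_fun (v : V vertex1) : M := delta 8 ((0, v) : U).
Let out2_fun (u : M) : V vertex2 := ((u : coords U) (inord 0)).1.
Let out1_fun (u : M) : V vertex1 := ((u : coords U) (inord 8)).2.

(** V2 sits in Va as the first factor of coordinate 0, V1 in Vb as the second factor of coordinate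
    8; z preserves the factors and n sends the second into the first, so the projections are
    morphisms. *)
Lemma rep_retract : retract_of (V : reps K JP2_quiver) (block_rep M t : reps K JP2_quiver).
Proof.
have in2_lin : linear (fun v => vsproj (Va M) (in2_fun v)).
  move=> k u v; rewrite -linearP; congr vsproj; rewrite /in2_fun -linearP; congr (delta 0 _).
  by congr (_, _); rewrite /= scaler0 addr0.
have in1_lin : linear (fun v => vsproj (Vb M) (in1_fun v)).
  move=> k u v; rewrite -linearP; congr vsproj; rewrite /in1_fun -linearP; congr (delta 8 _).
  by congr (_, _); rewrite /= scaler0 addr0.
have out2_lin : linear (fun u : subvs_of (Va M) => out2_fun (vsval u)).
  by move=> k u v; rewrite /out2_fun linearP !ffunE.
have out1_lin : linear (fun u : subvs_of (Vb M) => out1_fun (vsval u)).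
  by move=> k u v; rewrite /out1_fun linearP !ffunE.
pose L (W W' : vectType K) (f : W -> W') (fl : linear f) : 'Hom(W, W') :=
  linfun (HB.pack_for {linear W -> W'} f (GRing.isLinear.Build K W W' *:%R f fl)).
have LE (W W' : vectType K) (f : W -> W') (fl : linear f) v : L _ _ f fl v = f v.
  by rewrite lfunE.
have [i2 in2E] : exists i2 : 'Hom(V vertex2, subvs_of (Va M)), forall v, vsval (i2 v) = in2_fun v.
  by exists (L _ _ _ in2_lin) => v; rewrite LE vsprojK ?delta0_Va.
have [i1 in1E] : exists i1 : 'Hom(V vertex1, subvs_of (Vb M)), forall v, vsval (i1 v) = in1_fun v.
  by exists (L _ _ _ in1_lin) => v; rewrite LE vsprojK ?delta8_Vb.
have [p2 p2E] : exists p2 : 'Hom(subvs_of (Va M), V vertex2), forall u, p2 u = out2_fun (vsval u).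
  by exists (L _ _ _ out2_lin) => u; rewrite LE.
have [p1 p1E] : exists p1 : 'Hom(subvs_of (Vb M), V vertex1), forall u, p1 u = out1_fun (vsval u).
  by exists (L _ _ _ out1_lin) => u; rewrite LE.
have uM : unital M by exact: table_unital.
have zE k u : (k < 16)%N -> zshift M t (delta k u) = delta k (c u.1, a u.2).
  by move=> k16; rewrite (table_zshift _ _ t u k16) rep_shiftE.
have VaE (u : subvs_of (Va M)) : exists w, vsval u = delta 0 w :> M.
  by exists ((vsval u : coords U) (inord 0)); exact: (table_Vend (k := 0) (subvsP u)).
have VbE (u : subvs_of (Vb M)) : exists w, vsval u = delta 8 w :> M.
  by exists ((vsval u : coords U) (inord 8)); exact: (table_Vend (k := 8) (subvsP u)).
have coordE k w : (k < 16)%N -> (delta k w : coords U) (inord k) = w.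
  by move=> k16; rewrite ffunE inordK ?eqxx.
have i_hom : @rep2_family K V (block_rep M t) i1 i2
    \in @rep_hom_pred K JP2_quiver V (block_rep M t).
  apply: rep2_hom_subproof; apply/lfunP => v; rewrite ![LHS]comp_lfunE ![RHS]comp_lfunE;
    apply: val_inj; rewrite /=.
  - rewrite restrE; last exact: (zshift_Vb uM t).
    by rewrite !in1E /in1_fun zE //= linear0.
  - rewrite restrE; last exact: (nop_Va uM).
    by rewrite [LHS]in2E [in RHS]in1E nop_delta rep_nE.
  - rewrite restrE; last exact: (zshift_Va uM t).
    by rewrite !in2E /in2_fun zE //= linear0.
have p_hom : @rep2_family K (block_rep M t) V p1 p2
    \in @rep_hom_pred K JP2_quiver (block_rep M t) V.
  apply: rep2_hom_subproof; apply/lfunP => u; rewrite ![LHS]comp_lfunE ![RHS]comp_lfunE /=.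
  - rewrite !p1E restrE; last exact: (zshift_Vb uM t).
    by have [w ->] := VbE u; rewrite zE // /out1_fun !coordE.
  - rewrite [LHS]p2E [in RHS]p1E restrE; last exact: (nop_Va uM).
    by have [w ->] := VbE u; rewrite nop_delta rep_nE /out1_fun /out2_fun !coordE.
  - rewrite !p2E restrE; last exact: (zshift_Va uM t).
    by have [w ->] := VaE u; rewrite zE // /out2_fun !coordE.
exists (RepHom i_hom : hom (V : reps K JP2_quiver) (block_rep M t : reps K JP2_quiver)).
exists (RepHom p_hom : hom (block_rep M t : reps K JP2_quiver) (V : reps K JP2_quiver)).
apply: rep_homP => -[]; apply/lfunP => v; rewrite [LHS]comp_lfunE [RHS]id_lfunE.
  by rewrite [LHS]p1E in1E /out1_fun coordE.
by rewrite [LHS]p2E in2E /out2_fun coordE.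
Qed.

End OneRep.

Lemma block_functor_dense (Y : nilpotent_JP2_reps K) :
  exists X : Bte, isomorphic (block_functor te X) Y.
Proof.
case: Y => V [V_nilp V_rel].
apply: (dense_retract (@block_functor_faithful K te) (@block_map_full K te) block_split_idem
  (X := rep_model V_nilp V_rel)).
have [i [p pi]] := rep_retract V_rel.
by exists i, p.
Qed.

Lemma block_equivalent : equivalent Bte (nilpotent_JP2_reps K).
Proof.
exact: fully_faithful_equivalent (@block_functor_faithful K te) (@block_map_full K te)
  block_functor_dense.
Qed.

End Density.

(** * Determination of all blocks *)

Section Main.
Context (K : numClosedFieldType).
Local Notation J := (JP K 2).
Local Notation C := (unital_bimod J).

Lemma block_indecomposable te :
  indecomposable (fullsub C (in_block (@blk_hom K) te)).
Proof.
exact: indecomposable_equivalent (block_equivalent te) (nilpotent_JP2_reps_indecomposable K).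
Qed.

Lemma in_block_is_block te : block C (in_block (@blk_hom K) te).
Proof.
apply: in_block_block; [exact: blk_hom_natural|exact: blk_hom_idem| |exact: block_indecomposable].
exact: unital_bimod_split.
Qed.

Lemma block_is_in_block (B : C -> Prop) : block C B -> exists te, B = in_block (@blk_hom K) te.
Proof.
case/(block_in_block (@blk_hom_natural K) (@blk_hom_idem K) (@unital_bimod_split K J)
  (@blk_hom_nonzero K) block_indecomposable) => te h.
by exists te; apply/funext => X; apply/propext.
Qed.

(** On a common object both z - t and z - s are nilpotent on Va and Vb. A vector killed by z - t is
    scaled by t - s under z - s, so for t and s distinct z - t is injective as well, and the object
    is zero. *)
Lemma in_block_inj t s eps : in_block (@blk_hom K) (t, eps) = in_block (@blk_hom K) (s, eps) ->
  t = s.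
Proof.
move=> ts; have [[[X Xt] X0] _] := block_indecomposable (t, eps).
have Xs : in_block (@blk_hom K) (s, eps) X by rewrite -ts.
apply: contrapT => /eqP nts; apply: X0; apply: (@bimodule_hom_eq K X X) => k v vV.
rewrite [RHS]zero_lfunE [LHS]id_lfunE.
set M := sval X in v vV *; have uM : unital M := svalP X.
have eig w : w \in Vend M k -> zshift M t w = 0 -> w = 0.
  move=> wV w0; have sw : zshift M s w = (t - s) *: w.
    by move: w0; rewrite !zshiftE scalerBl => /subr0_eq->.
  have sn n : lpow (zshift M s) n w = (t - s) ^+ n *: w.
    elim: n => [|n IH] /=; first by rewrite id_lfunE expr0 scale1r.
    by rewrite comp_lfunE IH linearZ /= sw scalerA -exprSr.
  have := in_block_nilp Xs wV; rewrite [LHS]sn => /eqP.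
  by rewrite scaler_eq0 expf_eq0 subr_eq0 (negPf nts) andbF => /eqP.
have zV w : w \in Vend M k -> zshift M t w \in Vend M k.
  by move=> wV; rewrite zshiftE memvB ?memvZ // zop_Vend.
have lV n : lpow (zshift M t) n v \in Vend M k.
  by elim: n => [|n IH] /=; rewrite ?id_lfunE // comp_lfunE zV.
have : lpow (zshift M t) (fit_exp M) v = 0 := in_block_nilp Xt vV.
elim: (fit_exp M) => [|n IH] /=; first by rewrite id_lfunE.
by rewrite comp_lfunE => /(eig _ (lV n)).
Qed.

Lemma infinitely_many_blocks : ~ finitely_many (block C).
Proof.
case=> n [e eP].
(* Pigeonhole on the even blocks at the eigenvalues 0, ..., n, distinct in characteristic 0. *)
have ex (j : 'I_n.+1) : exists i : 'I_n, e i = in_block (@blk_hom K) (j%:R, false).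
  exact/eP/in_block_is_block.
pose h (j : 'I_n.+1) : 'I_n := sval (cid (ex j)).
have hP j : e (h j) = in_block (@blk_hom K) (j%:R, false) := svalP (cid (ex j)).
have h_inj : injective h.
  move=> j l jl; have := hP j; rewrite jl hP => /in_block_inj/eqP.
  by rewrite eqr_nat => /eqP/esym/val_inj.
by have := leq_card h h_inj; rewrite !card_ord ltnn.
Qed.

Lemma block_equivalent_reps (B : C -> Prop) : block C B ->
  equivalent (fullsub C B) (nilpotent_JP2_reps K).
Proof. by case/block_is_in_block => te ->; exact: block_equivalent. Qed.

End Main.

Theorem theorem4p17 (R : realType) :
  let C := unital_bimod (JP (complex R) 2) in
  [/\ ~ finitely_many (block C),
      forall B B' : C -> Prop, block C B -> block C B' ->
        equivalent (fullsub C B) (fullsub C B')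
    & forall B : C -> Prop, block C B ->
        equivalent (fullsub C B) (nilpotent_JP2_reps (complex R))].
Proof.
move=> C; split=> [|B B' hB hB'|B]; first exact: infinitely_many_blocks.
  exact: equivalent_trans (block_equivalent_reps hB) (equivalent_sym (block_equivalent_reps hB')).
exact: block_equivalent_reps.
Qed.
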